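(* Let $k$ be an algebraically closed field and let $R$ be a prime affine $k$-algebra that is module-finite over its center $Z(R)$. Let $d$ denote the PI degree of $R$, let $N \unlhd R$ denote the intersection of all non-regular maximal ideals of $R$, and let $U_R$ be the Azumaya subscheme of $\operatorname{Spec} Z(R)$, i.e. the open subscheme that is the non-vanishing locus of the ideal $I_R = N\cap Z(R)$. Then there is an isomorphism of coalgebras $$R^\circ \cong \Big(\varinjlim_{i \geq 1} \, (R/N^i)^\circ\Big) \oplus \big(\mathbb{M}^d \otimes \operatorname{Dist}(U_R)\big).$$
   Context: Algebras are unital and associative, coalgebras counital and coassociative; $\otimes=\otimes_k$. Affine means finitely generated as a $k$-algebra. Finite dual: for a $k$-algebra $A$, $A^\circ\subseteq A^*$ is the set of functionals whose kernel contains a two-sided ideal of finite codimension; it is a coalgebra with comultiplication dual to multiplication and counit evaluation at $1$, and $A^\circ\cong\varinjlim (A/I)^*$ over ideals $I$ of finite codimension. It is contravariantly functorial in $A$ (so the surjections $R/N^{i+1}\to R/N^i$ give the directed system in the statement). The comatrix coalgebra $\mathbb{M}^d$ has basis $\{E^{ij}\mid 1\le i,j\le d\}$ with $\Delta(E^{ij})=\sum_r E^{ir}\otimes E^{rj}$ and $\epsilon(E^{ij})=\delta_{ij}$; it is the dual coalgebra of the matrix algebra $\mathbb{M}_d(k)$. For a $k$-scheme $X$, $\operatorname{Dist}(X)=\varinjlim_S \Gamma(S,\mathcal{O}_S)^*$, the directed limit of dual coalgebras over the directed system of closed subschemes $S$ of $X$ that are finite over $k$. The PI degree of a prime PI algebra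 $S$ is the integer $d$ such that the localization of $S$ at the nonzero elements of $Z(S)$ has dimension $d^2$ over its center; for $R$ as in the statement it equals the maximal $k$-dimension of the simple $R$-modules. A prime ideal $P$ of $R$ is regular if the PI degree of $R/P$ equals the PI degree of $R$. If there are no non-regular maximal ideals, $N=R$. The closed points of $U_R$ are exactly the Azumaya locus $\{\mathfrak{m}\in\operatorname{Max}Z(R)\mid R_\mathfrak{m}\text{ is Azumaya over } Z(R)_\mathfrak{m}\}$. *)

(* Defs.v *)
From HB Require Import structures.
From mathcomp Require Import all_boot all_algebra.
From mathcomp Require Import generic_quotient.
From mathcomp Require Import boolp classical_sets functions.

Set Implicit Arguments.
Unset Strict Implicit.
Unset Printing Implicit Defensive.

Import GRing.Theory.
Local Open Scope ring_scope.
Local Open Scope classical_set_scope.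
Local Open Scope quotient_scope.

(* The library's algType excludes the zero algebra, which does occur below
   (as R/N^i when N = R, or as the coordinate ring of the empty subscheme);
   hence this record of unital associative algebras over a field, with an
   injection of algType into it. *)
Record alg_on (k : fieldType) (V : lmodType k) := AlgOn {
  alg_one : V;
  alg_mul : V -> V -> V;
  alg_mulA : associative alg_mul;
  alg_mul1 : left_id alg_one alg_mul;
  alg_mulr1 : right_id alg_one alg_mul;
  alg_mulDl : left_distributive alg_mul +%R;
  alg_mulDr : right_distributive alg_mul +%R;
  alg_scaleAl : forall (c : k) u v, c *: alg_mul u v = alg_mul (c *: u) v;
  alg_scaleAr : forall (c : k) u v, c *: alg_mul u v = alg_mul u (c *: v) }.

Record algebra (k : fieldType) := Algebra {
  alg_lmod : lmodType k;
  alg_str : alg_on alg_lmod }.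

Definition alg_sort (k : fieldType) (A : algebra k) : Type := alg_lmod A.
Coercion alg_sort : algebra >-> Sortclass.

HB.instance Definition _ (k : fieldType) (A : algebra k) :=
  GRing.Lmodule.copy (alg_sort A) (alg_lmod A).
HB.instance Definition _ (k : fieldType) (A : algebra k) :=
  GRing.Zmodule_isPzRing.Build (alg_sort A)
    (@alg_mulA _ _ (alg_str A)) (@alg_mul1 _ _ (alg_str A))
    (@alg_mulr1 _ _ (alg_str A)) (@alg_mulDl _ _ (alg_str A))
    (@alg_mulDr _ _ (alg_str A)).

Lemma ascalerAl (k : fieldType) (A : algebra k) (c : k) (u v : A) :
  c *: (u * v) = (c *: u) * v.
Proof. exact: (@alg_scaleAl _ _ (alg_str A)). Qed.
Lemma ascalerAr (k : fieldType) (A : algebra k) (c : k) (u v : A) :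
  c *: (u * v) = u * (c *: v).
Proof. exact: (@alg_scaleAr _ _ (alg_str A)). Qed.

Definition algebra_of (k : fieldType) (R : algType k) : algebra k :=
  @Algebra k R (@AlgOn k R 1 *%R (@mulrA R) (@mul1r R) (@mulr1 R) (@mulrDl R)
    (@mulrDr R) (@scalerAl k R) (@scalerAr k R)).
Coercion algebra_of : GRing.Algebra.type >-> algebra.

Record comalgebra (k : fieldType) := ComAlgebra {
  comalg_alg :> algebra k;
  comalg_mulC : commutative (@GRing.mul comalg_alg) }.

Record alghom (k : fieldType) (A B : algebra k) := AlgHom {
  alghom_fun :> A -> B;
  alghom_linear : linear alghom_fun;
  alghom_monoid : monoid_morphism alghom_fun }.

Record ideal (k : fieldType) (A : algebra k) := Ideal {
  ideal_set :> A -> Prop;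
  ideal0 : ideal_set 0;
  idealD : forall x y, ideal_set x -> ideal_set y -> ideal_set (x + y);
  idealMl : forall a x, ideal_set x -> ideal_set (a * x);
  idealMr : forall a x, ideal_set x -> ideal_set (x * a) }.

Section Quotient.
Variables (k : fieldType) (A : algebra k) (I : ideal A).

Lemma idealZ (c : k) x : I x -> I (c *: x).
Proof. by move=> Ix; rewrite -[x]mul1r ascalerAl; apply: idealMl. Qed.
Lemma idealN x : I x -> I (- x).
Proof. by rewrite -scaleN1r; apply: idealZ. Qed.
Lemma idealB x y : I x -> I y -> I (x - y).
Proof. by move=> Ix Iy; apply: idealD => //; apply: idealN. Qed.

Definition idealeq : rel A := fun x y => `[< I (x - y) >].
Lemma idealeq_refl : reflexive idealeq.
Proof. by move=> x; apply/asboolP; rewrite subrr; exact: ideal0. Qed.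
Lemma idealeq_sym : symmetric idealeq.
Proof. by move=> x y; apply/asboolP/asboolP => /idealN; rewrite opprB. Qed.
Lemma idealeq_trans : transitive idealeq.
Proof.
move=> y x z /asboolP xy /asboolP yz; apply/asboolP.
by rewrite -[x](subrK y) -addrA; apply: idealD.
Qed.
Canonical idealeq_equiv :=
  EquivRel idealeq idealeq_refl idealeq_sym idealeq_trans.

Definition quot_sort := {eq_quot idealeq}.
HB.instance Definition _ := Choice.on quot_sort.
Definition quot_pi (x : A) : quot_sort := \pi_{eq_quot idealeq} x.

Lemma quot_piP x y : quot_pi x = quot_pi y <-> I (x - y).
Proof.
split=> [e|Ixy]; first by apply/asboolP; move: e => /eqquotP.
by apply/eqquotP/asboolP.
Qed.
Lemma quot_ind (P : quot_sort -> Prop) :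
  (forall x, P (quot_pi x)) -> forall q, P q.
Proof. by move=> h q; rewrite -[q]reprK; apply: h. Qed.
Lemma quot_repr x : I (repr (quot_pi x) - x).
Proof. by apply/quot_piP; rewrite /quot_pi reprK. Qed.

Let q0 : quot_sort := quot_pi 0.
Let q1 : quot_sort := quot_pi 1.
Let qopp (x : quot_sort) := quot_pi (- repr x).
Let qadd (x y : quot_sort) := quot_pi (repr x + repr y).
Let qmul (x y : quot_sort) := quot_pi (repr x * repr y).
Let qscale c (x : quot_sort) := quot_pi (c *: repr x).

Let qaddE x y : qadd (quot_pi x) (quot_pi y) = quot_pi (x + y).
Proof.
by apply/quot_piP; rewrite opprD addrACA; apply: idealD; apply: quot_repr.
Qed.
Let qoppE x : qopp (quot_pi x) = quot_pi (- x).
Proof. by apply/quot_piP; rewrite -opprD; apply/idealN/quot_repr. Qed.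
Let qscaleE c x : qscale c (quot_pi x) = quot_pi (c *: x).
Proof. by apply/quot_piP; rewrite -scalerBr; apply/idealZ/quot_repr. Qed.
Let qmulE x y : qmul (quot_pi x) (quot_pi y) = quot_pi (x * y).
Proof.
apply/quot_piP.
have -> : repr (quot_pi x) * repr (quot_pi y) - x * y =
  repr (quot_pi x) * (repr (quot_pi y) - y) + (repr (quot_pi x) - x) * y.
  by rewrite mulrBr mulrBl addrA subrK.
by apply: idealD; [apply: idealMl | apply: idealMr]; apply: quot_repr.
Qed.

Let qaddA : associative qadd.
Proof. by do 3!elim/quot_ind=> ?; rewrite !qaddE addrA. Qed.
Let qaddC : commutative qadd.
Proof. by do 2!elim/quot_ind=> ?; rewrite !qaddE addrC. Qed.
Let qadd0 : left_id q0 qadd.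
Proof. by elim/quot_ind=> ?; rewrite !qaddE add0r. Qed.
Let qaddN : left_inverse q0 qopp qadd.
Proof. by elim/quot_ind=> ?; rewrite qoppE !qaddE addNr. Qed.
HB.instance Definition _ := GRing.isZmodule.Build quot_sort qaddA qaddC qadd0 qaddN.
Let addE x y : quot_pi x + quot_pi y = quot_pi (x + y).
Proof. exact: qaddE. Qed.

Let qscaleA a b v : qscale a (qscale b v) = qscale (a * b) v.
Proof. by elim/quot_ind: v => v; rewrite !qscaleE scalerA. Qed.
Let qscale1 : left_id 1 qscale.
Proof. by elim/quot_ind=> v; rewrite !qscaleE scale1r. Qed.
Let qscaleDr : right_distributive qscale +%R.
Proof.
by move=> a; do 2!elim/quot_ind=> ?; rewrite !(qscaleE, addE) scalerDr.
Qed.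
Let qscaleDl v : {morph qscale^~ v : a b / a + b}.
Proof.
by elim/quot_ind: v => v a b; rewrite !(qscaleE, addE) scalerDl.
Qed.
HB.instance Definition _ := GRing.Zmodule_isLmodule.Build k quot_sort
  qscaleA qscale1 qscaleDr qscaleDl.
Let scaleE (c : k) x : c *: quot_pi x = quot_pi (c *: x).
Proof. exact: qscaleE. Qed.

Let qmulA : associative qmul.
Proof. by do 3!elim/quot_ind=> ?; rewrite !qmulE mulrA. Qed.
Let qmul1 : left_id q1 qmul.
Proof. by elim/quot_ind=> ?; rewrite !qmulE mul1r. Qed.
Let qmulr1 : right_id q1 qmul.
Proof. by elim/quot_ind=> ?; rewrite !qmulE mulr1. Qed.
Let qmulDl : left_distributive qmul +%R.
Proof.
by do 3!elim/quot_ind=> ?; rewrite !(qmulE, addE) mulrDl.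
Qed.
Let qmulDr : right_distributive qmul +%R.
Proof.
by do 3!elim/quot_ind=> ?; rewrite !(qmulE, addE) mulrDr.
Qed.
Let qscalerAl (a : k) (u v : quot_sort) : a *: qmul u v = qmul (a *: u) v.
Proof.
elim/quot_ind: u => u; elim/quot_ind: v => v.
by rewrite !(scaleE, qmulE) ascalerAl.
Qed.
Let qscalerAr (a : k) (u v : quot_sort) : a *: qmul u v = qmul u (a *: v).
Proof.
elim/quot_ind: u => u; elim/quot_ind: v => v.
by rewrite !(scaleE, qmulE) ascalerAr.
Qed.

Definition quot : algebra k :=
  @Algebra k quot_sort (@AlgOn k quot_sort q1 qmul qmulA qmul1 qmulr1 qmulDl
    qmulDr qscalerAl qscalerAr).

Lemma quot_pi_linear : linear (quot_pi : A -> quot).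
Proof. by move=> a u v; rewrite -addE -scaleE. Qed.
Lemma quot_pi_monoid : monoid_morphism (quot_pi : A -> quot).
Proof. by split=> // x y; rewrite -qmulE. Qed.
Definition quot_proj : alghom A quot := AlgHom quot_pi_linear quot_pi_monoid.
End Quotient.

Section QuotMap.
Variables (k : fieldType) (A : algebra k) (I J : ideal A).
Hypothesis sIJ : I `<=` J.

Definition quot_map_fun (x : quot I) : quot J := quot_pi J (repr (x : quot_sort I)).
Lemma quot_map_funE x : quot_map_fun (quot_pi I x) = quot_pi J x.
Proof. by apply/quot_piP/sIJ/quot_repr. Qed.
Lemma quot_map_linear : linear quot_map_fun.
Proof.
move=> a; elim/quot_ind=> x; elim/quot_ind=> y.
by rewrite -(quot_pi_linear I) !quot_map_funE quot_pi_linear.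
Qed.
Lemma quot_map_monoid : monoid_morphism quot_map_fun.
Proof.
split; first by rewrite -(quot_pi_monoid I).1 quot_map_funE (quot_pi_monoid J).1.
elim/quot_ind=> x; elim/quot_ind=> y.
by rewrite -(quot_pi_monoid I).2 !quot_map_funE (quot_pi_monoid J).2.
Qed.
Definition quot_map : alghom (quot I) (quot J) :=
  AlgHom quot_map_linear quot_map_monoid.
End QuotMap.

Definition central (A : pzRingType) : set A := [set z | forall a, z * a = a * z].

Section Center.
Variables (k : fieldType) (A : algebra k).
Definition center_pred : {pred A} := fun z => `[< central z >].

Record center_sort := CenterElt {
  center_val :> A; _ : center_val \in center_pred }.
HB.instance Definition _ := [isSub for center_val].
HB.instance Definition _ := [Choice of center_sort by <:].

Let center_subring : subring_closed center_pred.
Proof.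
split; first by apply/asboolP => a; rewrite mul1r mulr1.
- move=> x y /asboolP cx /asboolP cy; apply/asboolP => a.
  by rewrite mulrBl mulrBr cx cy.
- move=> x y /asboolP cx /asboolP cy; apply/asboolP => a.
  by rewrite -mulrA cy mulrA cx mulrA.
Qed.
Let center_submod : subsemimod_closed center_pred.
Proof.
split; first split.
- by apply/asboolP => a; rewrite mul0r mulr0.
- move=> x y /asboolP cx /asboolP cy; apply/asboolP => a.
  by rewrite mulrDl mulrDr cx cy.
- move=> c x /asboolP cx; apply/asboolP => a.
  by rewrite -ascalerAl -ascalerAr cx.
Qed.
HB.instance Definition _ :=
  GRing.SubChoice_isSubPzRing.Build A center_pred center_sort center_subring.
HB.instance Definition _ := GRing.SubZmodule_isSubLmodule.Build k A center_pred
  center_sort center_submod.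
Let center_scalerAl (a : k) (u v : center_sort) : a *: (u * v) = (a *: u) * v.
Proof. by apply: val_inj; rewrite /= ascalerAl. Qed.
Let center_scalerAr (a : k) (u v : center_sort) : a *: (u * v) = u * (a *: v).
Proof. by apply: val_inj; rewrite /= ascalerAr. Qed.
Definition center_alg : algebra k := @Algebra k center_sort
  (@AlgOn k center_sort 1 *%R (@mulrA _) (@mul1r _) (@mulr1 _)
    (@mulrDl _) (@mulrDr _) center_scalerAl center_scalerAr).
Let center_mulC : commutative (@GRing.mul center_alg).
Proof.
by move=> [x px] y; apply: val_inj => /=; move/asboolP: px; apply.
Qed.
Definition center : comalgebra k := ComAlgebra center_mulC.
End Center.

(* The vector space generated by G subject to exactly the linear relations
   satisfied by all the maps G -> U in the class P: formal linear combinations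
   modulo "no map of the class P distinguishes them". It represents the functor
   U |-> P U; tensor products and colimits are both obtained in this way. *)
Section Presented.
Variables (k : fieldType) (G : Type).
Variable P : forall U : lmodType k, (G -> U) -> Prop.
Arguments P [U].

Definition formal_sum := seq (k * G).
HB.instance Definition _ := gen_eqMixin formal_sum.
HB.instance Definition _ := gen_choiceMixin formal_sum.

Definition formal_eval (U : lmodType k) (f : G -> U) (s : formal_sum) : U :=
  \sum_(p <- s) p.1 *: f p.2.

Definition formal_eq : rel formal_sum := fun s t =>
  `[< forall (U : lmodType k) (f : G -> U), P f -> formal_eval f s = formal_eval f t >].

Lemma formal_eq_refl : reflexive formal_eq.
Proof. by move=> s; apply/asboolP. Qed.
Lemma formal_eq_sym : symmetric formal_eq.
Proof. by move=> s t; apply/asboolP/asboolP => h U f Pf; rewrite h. Qed.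
Lemma formal_eq_trans : transitive formal_eq.
Proof.
by move=> t s u /asboolP st /asboolP tu; apply/asboolP => U f Pf; rewrite st ?tu.
Qed.
Canonical formal_equiv :=
  EquivRel formal_eq formal_eq_refl formal_eq_sym formal_eq_trans.

Definition presented := {eq_quot formal_eq}.
HB.instance Definition _ := Choice.on presented.

Definition pres_pi (s : formal_sum) : presented := \pi_{eq_quot formal_eq} s.
Definition pres_gen (g : G) : presented := pres_pi [:: (1, g)].
Definition pres_lift (U : lmodType k) (f : G -> U) (x : presented) : U :=
  formal_eval f (repr x).

Lemma pres_piP s t : pres_pi s = pres_pi t <->
  forall (U : lmodType k) (f : G -> U), P f -> formal_eval f s = formal_eval f t.
Proof.
split=> [e|h]; first by apply/asboolP; move: e => /eqquotP.
by apply/eqquotP/asboolP.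
Qed.
Lemma pres_lift_pi (U : lmodType k) (f : G -> U) s :
  P f -> pres_lift f (pres_pi s) = formal_eval f s.
Proof. by move=> Pf; apply: (pres_piP _ _).1 Pf; rewrite /pres_pi reprK. Qed.
Lemma pres_eqP (x y : presented) : x = y <->
  forall (U : lmodType k) (f : G -> U), P f -> pres_lift f x = pres_lift f y.
Proof.
split=> [->//|h]; rewrite -[x]reprK -[y]reprK.
exact/(pres_piP (repr x) (repr y)).
Qed.

Let padd (x y : presented) := pres_pi (repr x ++ repr y).
Let pscale c (x : presented) := pres_pi [seq (c * p.1, p.2) | p <- repr x].

Let lift0 (U : lmodType k) (f : G -> U) : P f -> pres_lift f (pres_pi [::]) = 0.
Proof. by move=> Pf; rewrite pres_lift_pi // /formal_eval big_nil. Qed.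
Let liftD (U : lmodType k) (f : G -> U) x y :
  P f -> pres_lift f (padd x y) = pres_lift f x + pres_lift f y.
Proof. by move=> Pf; rewrite pres_lift_pi // /formal_eval big_cat. Qed.
Let liftZ (U : lmodType k) (f : G -> U) c x :
  P f -> pres_lift f (pscale c x) = c *: pres_lift f x.
Proof.
move=> Pf; rewrite pres_lift_pi // /formal_eval big_map scaler_sumr.
by apply: eq_bigr => p _; rewrite scalerA.
Qed.

Let paddA : associative padd.
Proof. by move=> x y z; apply/pres_eqP => U f Pf; rewrite !liftD // addrA. Qed.
Let paddC : commutative padd.
Proof. by move=> x y; apply/pres_eqP => U f Pf; rewrite !liftD // addrC. Qed.
Let padd0 : left_id (pres_pi [::]) padd.
Proof. by move=> x; apply/pres_eqP => U f Pf; rewrite liftD // lift0 // add0r. Qed.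
Let paddN : left_inverse (pres_pi [::]) (pscale (-1)) padd.
Proof.
move=> x; apply/pres_eqP => U f Pf.
by rewrite liftD // liftZ // lift0 // scaleN1r addNr.
Qed.
HB.instance Definition _ :=
  GRing.isZmodule.Build presented paddA paddC padd0 paddN.

Let pscaleA a b v : pscale a (pscale b v) = pscale (a * b) v.
Proof. by apply/pres_eqP => U f Pf; rewrite !liftZ // scalerA. Qed.
Let pscale1 : left_id 1 pscale.
Proof. by move=> v; apply/pres_eqP => U f Pf; rewrite liftZ // scale1r. Qed.
Let pscaleDr : right_distributive pscale +%R.
Proof.
by move=> a u v; apply/pres_eqP => U f Pf; rewrite !(liftZ, liftD) // scalerDr.
Qed.
Let pscaleDl v : {morph pscale^~ v : a b / a + b}.
Proof.
by move=> a b; apply/pres_eqP => U f Pf; rewrite !(liftZ, liftD) // scalerDl.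
Qed.
HB.instance Definition _ := GRing.Zmodule_isLmodule.Build k presented
  pscaleA pscale1 pscaleDr pscaleDl.

Lemma pres_lift_linear (U : lmodType k) (f : G -> U) : P f -> linear (pres_lift f).
Proof. by move=> Pf a x y; rewrite liftD // liftZ. Qed.
Lemma pres_lift_gen (U : lmodType k) (f : G -> U) g :
  P f -> pres_lift f (pres_gen g) = f g.
Proof. by move=> Pf; rewrite pres_lift_pi // /formal_eval big_seq1 scale1r. Qed.
Lemma pres_genE (x : presented) : x = pres_lift pres_gen x.
Proof.
apply/pres_eqP => U f Pf; have L := pres_lift_linear Pf.
have E (s : formal_sum) : pres_lift f (formal_eval pres_gen s) = formal_eval f s.
  rewrite /formal_eval; elim: s => [|p s IH]; first by rewrite !big_nil lift0.
  by rewrite !big_cons L IH pres_lift_gen.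
exact/esym/E.
Qed.
End Presented.

Section LinearAux.
Variable k : fieldType.
Implicit Types U V W : lmodType k.

Lemma lin0 V U (h : V -> U) : linear h -> h 0 = 0.
Proof. by move=> H; have := H (-1) 0 0; rewrite scaleN1r addr0 oppr0 scaleN1r addNr. Qed.
Lemma linD V U (h : V -> U) x y : linear h -> h (x + y) = h x + h y.
Proof. by move=> H; have := H 1 x y; rewrite !scale1r. Qed.
Lemma linZ V U (h : V -> U) c x : linear h -> h (c *: x) = c *: h x.
Proof. by move=> H; have := H c x 0; rewrite !addr0 (lin0 H) addr0. Qed.
Lemma lin_sum V U (h : V -> U) (I : Type) (s : seq I) (c : I -> k) (x : I -> V) :
  linear h -> h (\sum_(i <- s) c i *: x i) = \sum_(i <- s) c i *: h (x i).
Proof.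
move=> H; elim: s => [|i s IH]; first by rewrite !big_nil lin0.
by rewrite !big_cons H IH.
Qed.
Lemma linD_sum V U (h : V -> U) (I : Type) (s : seq I) (x : I -> V) :
  linear h -> h (\sum_(i <- s) x i) = \sum_(i <- s) h (x i).
Proof.
move=> H; elim: s => [|i s IH]; first by rewrite !big_nil lin0.
by rewrite !big_cons linD // IH.
Qed.
Lemma lin_comp V U W (h : V -> U) (g : U -> W) :
  linear h -> linear g -> linear (fun x => g (h x)).
Proof. by move=> H H' a x y; rewrite H H'. Qed.
Lemma lin_id V : linear (fun x : V => x).
Proof. by []. Qed.
Lemma lin_scale V c : linear (fun x : V => c *: x).
Proof. by move=> a x y; rewrite scalerDr !scalerA mulrC. Qed.
Lemma lin_scalel V U (h : V -> k^o) (u : U) : linear h -> linear (fun x : V => h x *: u).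
Proof. by move=> H a x y; rewrite H scalerDl scalerA. Qed.
Lemma lin_add V U (h g : V -> U) : linear h -> linear g -> linear (fun x => h x + g x).
Proof. by move=> H H' a x y; rewrite H H' scalerDr addrACA. Qed.
End LinearAux.

Section Tensor.
Variables (k : fieldType) (V W : lmodType k).

Definition bilin (U : lmodType k) (f : V -> W -> U) :=
  (forall w, linear (fun v => f v w)) /\ (forall v, linear (f v)).

Definition tensor : lmodType k :=
  presented (fun (U : lmodType k) (f : V * W -> U) => bilin (fun v w => f (v, w))).

Definition tens (v : V) (w : W) : tensor := pres_gen _ (v, w).

Definition tlift (U : lmodType k) (f : V -> W -> U) (t : tensor) : U :=
  pres_lift (fun p => f p.1 p.2) t.

Lemma tens_bilin : bilin tens.
Proof.
by split=> [w|v] a x y; apply/pres_eqP => U f Pf;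
  rewrite pres_lift_linear // !pres_lift_gen //; apply Pf.
Qed.
Lemma tlift_linear (U : lmodType k) (f : V -> W -> U) : bilin f -> linear (tlift f).
Proof. exact: pres_lift_linear. Qed.
Lemma tlift_tens (U : lmodType k) (f : V -> W -> U) v w :
  bilin f -> tlift f (tens v w) = f v w.
Proof. by move=> bf; rewrite /tlift /tens pres_lift_gen. Qed.

Lemma tlift_comp (U U' : lmodType k) (f : V -> W -> U) (h : U -> U') t :
  linear h -> h (tlift f t) = tlift (fun x y => h (f x y)) t.
Proof. exact: lin_sum. Qed.
Lemma tlift_id t : tlift tens t = t.
Proof.
rewrite [RHS]pres_genE /tlift /pres_lift; congr formal_eval.
by apply/funext => -[].
Qed.
Lemma tens_ext (U : lmodType k) (h h' : tensor -> U) :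
  linear h -> linear h' -> (forall v w, h (tens v w) = h' (tens v w)) -> h =1 h'.
Proof.
move=> H H' e t; rewrite -[t]tlift_id !tlift_comp //; congr (tlift _ t).
by apply/funext => v; apply/funext => w.
Qed.
Lemma tlift_lin_fun (U X : lmodType k) (f : X -> V -> W -> U) t :
  (forall v w, linear (fun x => f x v w)) -> linear (fun x => tlift (f x) t).
Proof.
move=> H a x y; rewrite /tlift /pres_lift /formal_eval scaler_sumr -big_split /=.
apply: eq_bigr => p _; rewrite (H p.2.1 p.2.2) scalerDr !scalerA.
by rewrite mulrC.
Qed.
Lemma tlift_add (U : lmodType k) (f g : V -> W -> U) t :
  tlift f t + tlift g t = tlift (fun v w => f v w + g v w) t.
Proof.
rewrite /tlift /pres_lift /formal_eval -big_split /=.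
by apply: eq_bigr => p _; rewrite scalerDr.
Qed.
Lemma eq_tlift (U : lmodType k) (f g : V -> W -> U) t :
  (forall v w, f v w = g v w) -> tlift f t = tlift g t.
Proof. by move=> e; congr (tlift _ t); apply/funext => v; apply/funext. Qed.
End Tensor.
Notation "x \ox y" := (tens x y) (at level 40, left associativity) : ring_scope.

Lemma tlift_fubini (k : fieldType) (V W V' W' U : lmodType k)
    (f : V -> W -> V' -> W' -> U) t t' :
  tlift (fun x y => tlift (f x y) t') t = 
  tlift (fun x' y' => tlift (fun x y => f x y x' y') t) t'.
Proof.
rewrite /tlift /pres_lift /formal_eval.
under eq_bigr do rewrite scaler_sumr.
rewrite exchange_big /=; apply: eq_bigr => p _; rewrite scaler_sumr.
by apply: eq_bigr => q _; rewrite !scalerA mulrC.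
Qed.

Section LinearTensor.
Variables (k : fieldType) (X V W U : lmodType k).
Lemma lin_tensl (f : X -> V) (w : W) : linear f -> linear (fun x => f x \ox w).
Proof. by move=> H a x y; rewrite H (tens_bilin _ _).1. Qed.
Lemma lin_tensr (f : X -> W) (v : V) : linear f -> linear (fun x => v \ox f x).
Proof. by move=> H a x y; rewrite H (tens_bilin _ _).2. Qed.
Lemma lin_tlift (f : V -> W -> U) (g : X -> tensor V W) :
  bilin f -> linear g -> linear (fun x => tlift f (g x)).
Proof. by move=> /tlift_linear B L; apply: lin_comp. Qed.
Lemma bilinI (f : V -> W -> U) :
  (forall w, linear (fun v => f v w)) -> (forall v, linear (fun w => f v w)) -> bilin f.
Proof. by split. Qed.
End LinearTensor.

Record coalgebra (k : fieldType) := Coalgebra {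
  coalg_lmod :> lmodType k;
  comul : coalg_lmod -> tensor coalg_lmod coalg_lmod;
  counit : coalg_lmod -> k^o;
  comul_linear : linear comul;
  counit_linear : linear counit;
  (* in Sweedler notation,
     sum c_(1)(1) (x) c_(1)(2) (x) c_(2) = sum c_(1) (x) c_(2)(1) (x) c_(2)(2) *)
  comulA : forall c,
    tlift (fun x y => tlift (fun x1 x2 => x1 \ox (x2 \ox y)) (comul x)) (comul c) =
    tlift (fun x y => tlift (fun y1 y2 => x \ox (y1 \ox y2)) (comul y)) (comul c);
  counitl : forall c, tlift (fun x y => counit x *: y) (comul c) = c;
  counitr : forall c, tlift (fun x y => counit y *: x) (comul c) = c }.

Definition tmap (k : fieldType) (V W V' W' : lmodType k) (f : V -> V') (g : W -> W')
    (t : tensor V W) : tensor V' W' := tlift (fun v w => f v \ox g w) t.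

Record coalghom (k : fieldType) (C D : coalgebra k) := CoalgHom {
  coalghom_fun :> C -> D;
  coalghom_linear : linear coalghom_fun;
  coalghom_comul : forall c, comul (coalghom_fun c) =
                             tmap coalghom_fun coalghom_fun (comul c);
  coalghom_counit : forall c, counit (coalghom_fun c) = counit c }.

Definition coalg_iso (k : fieldType) (C D : coalgebra k) :=
  exists f : coalghom C D, bijective f.

Ltac linearity :=
  lazy beta; lazymatch goal with
  | |- bilin _ => apply: bilinI => ?; linearity
  | |- linear (fun x => x) => apply: lin_id
  | |- linear (fun x => tens _ _) =>
      first [apply: lin_tensl; solve [linearity] | apply: lin_tensr; solve [linearity]]
  | |- linear (fun x => tlift _ x) => apply: tlift_linear; linearity
  | |- linear (fun x => tlift (@?f x) (@?t x)) =>
      lazymatch t with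
      | (fun _ => ?t') => (apply: tlift_lin_fun => ? ?); linearity
      | _ => apply: lin_tlift; linearity
      end
  | |- linear (tens _) => exact: (tens_bilin _ _).2
  | |- linear (tlift _) => apply: tlift_linear; linearity
  | |- linear (fun x => GRing.scale _ _) =>
      first [apply: lin_scale | apply: lin_scalel; solve [linearity]]
  | |- linear (GRing.scale _) => apply: lin_scale
  | |- forall _, _ => idtac
  | |- _ => first [assumption | apply: comul_linear | apply: counit_linear
                  | apply: coalghom_linear | idtac]
  end.

Section CoalgLemmas.
Variables (k : fieldType) (C : coalgebra k) (U : lmodType k).
Lemma comulA_tri (G : C -> C -> C -> U) c :
  (forall y z, linear (fun x => G x y z)) -> (forall x z, linear (fun y => G x y z)) ->
  (forall x y, linear (fun z => G x y z)) ->
  tlift (fun x y => tlift (fun x1 x2 => G x1 x2 y) (comul x)) (comul c) =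
  tlift (fun x y => tlift (fun y1 y2 => G x y1 y2) (comul y)) (comul c).
Proof.
move=> H1 H2 H3.
have B3 x : bilin (G x) by split.
pose h := tlift (fun x => tlift (G x)).
have hB : bilin (fun x => tlift (G x)).
  split=> [t|x]; last exact: tlift_linear.
  by apply: tlift_lin_fun => v w; apply: H1.
have hL : linear h by apply: tlift_linear.
have hE x y z : h (x \ox (y \ox z)) = G x y z by rewrite /h !tlift_tens.
have := congr1 h (comulA c); rewrite !(tlift_comp _ _ hL).
under eq_tlift do rewrite (tlift_comp _ _ hL).
under [in RHS]eq_tlift do rewrite (tlift_comp _ _ hL).
under eq_tlift do under eq_tlift do rewrite hE.
by under [in RHS]eq_tlift do under eq_tlift do rewrite hE.
Qed.
Lemma counitl_lin (h : C -> U) c : linear h ->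
  tlift (fun x y => counit x *: h y) (comul c) = h c.
Proof.
move=> H; rewrite -{2}[c]counitl tlift_comp //.
by apply: eq_tlift => v w; rewrite linZ.
Qed.
Lemma counitr_lin (h : C -> U) c : linear h ->
  tlift (fun x y => counit y *: h x) (comul c) = h c.
Proof.
move=> H; rewrite -{2}[c]counitr tlift_comp //.
by apply: eq_tlift => v w; rewrite linZ.
Qed.
End CoalgLemmas.

Section TensorCoalgebra.
Variables (k : fieldType) (C D : coalgebra k).

Definition tcomul (t : tensor C D) : tensor (tensor C D) (tensor C D) :=
  tlift (fun c d => tlift (fun c1 c2 => tlift (fun d1 d2 =>
    (c1 \ox d1) \ox (c2 \ox d2)) (comul d)) (comul c)) t.
Definition tcounit (t : tensor C D) : k^o :=
  tlift (fun c d => counit c * counit d : k^o) t.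

Lemma tcomul_bilin : bilin (fun (c : C) (d : D) => tlift (fun c1 c2 => tlift (fun d1 d2 =>
    (c1 \ox d1) \ox (c2 \ox d2)) (comul d)) (comul c)).
Proof. linearity. Qed.
Lemma tcounit_bilin : bilin (fun (c : C) (d : D) => counit c * counit d : k^o).
Proof.
split=> [d|c] a x y; rewrite counit_linear; first by rewrite mulrDl -scalerAl.
by rewrite mulrDr -scalerAr.
Qed.
Lemma tcomul_linear : linear tcomul.
Proof. exact: tlift_linear tcomul_bilin. Qed.
Lemma tcounit_linear : linear tcounit.
Proof. exact: tlift_linear tcounit_bilin. Qed.
Let tcomulE c d : tcomul (c \ox d) = tlift (fun c1 c2 => tlift (fun d1 d2 =>
    (c1 \ox d1) \ox (c2 \ox d2)) (comul d)) (comul c).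
Proof. exact: tlift_tens tcomul_bilin. Qed.
Let tcounitE c d : tcounit (c \ox d) = counit c * counit d.
Proof. exact: tlift_tens tcounit_bilin. Qed.

Let liftE (U : lmodType k) (f : tensor C D -> tensor C D -> U) c d : bilin f ->
  tlift f (tcomul (c \ox d)) = tlift (fun c1 c2 => tlift (fun d1 d2 =>
    f (c1 \ox d1) (c2 \ox d2)) (comul d)) (comul c).
Proof.
move=> B; rewrite tcomulE tlift_comp; last exact: tlift_linear.
apply: eq_tlift => c1 c2; rewrite tlift_comp; last exact: tlift_linear.
by apply: eq_tlift => d1 d2; rewrite tlift_tens.
Qed.

Let tcomulA t :
    tlift (fun x y => tlift (fun x1 x2 => x1 \ox (x2 \ox y)) (tcomul x)) (tcomul t) =
    tlift (fun x y => tlift (fun y1 y2 => x \ox (y1 \ox y2)) (tcomul y)) (tcomul t).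
Proof.
have tl := tcomul_linear.
move: t; apply: tens_ext; [linearity|linearity|] => c d.
rewrite !liftE; [|linearity|linearity].
transitivity (tlift (fun x y => tlift (fun x1 x2 =>
   tlift (fun u v => tlift (fun u1 u2 => 
     (x1 \ox u1) \ox ((x2 \ox u2) \ox (y \ox v))) (comul u)) (comul d))
    (comul x)) (comul c)).
  apply: eq_tlift => c1 c2; rewrite [RHS]tlift_fubini; apply: eq_tlift => d1 d2.
  by rewrite liftE //; linearity.
transitivity (tlift (fun x y => tlift (fun x1 x2 =>
   tlift (fun u v => tlift (fun v1 v2 => 
     (x1 \ox u) \ox ((x2 \ox v1) \ox (y \ox v2))) (comul v)) (comul d))
    (comul x)) (comul c)).
  apply: eq_tlift => c1 c2; apply: eq_tlift => c3 c4.
  by rewrite (@comulA_tri k D _ (fun u v w => (c3 \ox u) \ox ((c4 \ox v) \ox (c2 \ox w)))) // => *; linearity.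
rewrite (@comulA_tri k C _ (fun x1 x2 y => tlift (fun u v => tlift (fun v1 v2 => 
     (x1 \ox u) \ox ((x2 \ox v1) \ox (y \ox v2))) (comul v)) (comul d))); try by move=> *; linearity.
apply: eq_tlift => c1 c2; rewrite tlift_fubini; apply: eq_tlift => d1 d2.
by rewrite liftE //; linearity.
Qed.
Let tcounitl t : tlift (fun x y => tcounit x *: y) (tcomul t) = t.
Proof.
have tl := tcomul_linear; have tc := tcounit_linear.
move: t; apply: tens_ext; [linearity|linearity|] => c d.
rewrite liftE; last linearity.
transitivity (tlift (fun x y => counit x *: (y \ox d)) (comul c)).
  apply: eq_tlift => c1 c2.
  under eq_tlift do rewrite tcounitE -scalerA.
  rewrite -tlift_comp; last linearity.
  by rewrite (counitl_lin (h := fun y => c2 \ox y)) //; linearity.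
by rewrite (counitl_lin (h := fun y => y \ox d)) //; linearity.
Qed.
Let tcounitr t : tlift (fun x y => tcounit y *: x) (tcomul t) = t.
Proof.
have tl := tcomul_linear; have tc := tcounit_linear.
move: t; apply: tens_ext; [linearity|linearity|] => c d.
rewrite liftE; last linearity.
transitivity (tlift (fun x y => counit y *: (x \ox d)) (comul c)).
  apply: eq_tlift => c1 c2.
  under eq_tlift do rewrite tcounitE -scalerA.
  rewrite -tlift_comp; last linearity.
  by rewrite (counitr_lin (h := fun y => c1 \ox y)) //; linearity.
by rewrite (counitr_lin (h := fun y => y \ox d)) //; linearity.
Qed.

Definition tensor_coalg : coalgebra k :=
  Coalgebra tcomul_linear tcounit_linear tcomulA tcounitl tcounitr.
End TensorCoalgebra.

Section SumCoalgebra.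
Variables (k : fieldType) (C D : coalgebra k).
Let S : lmodType k := (C * D)%type.
Let inl_ (c : C) : S := (c, 0).
Let inr_ (d : D) : S := (0, d).
Let inl_lin : linear inl_.
Proof. by move=> a x y; apply/eqP; rewrite xpair_eqE /= eqxx scaler0 addr0 eqxx. Qed.
Let inr_lin : linear inr_.
Proof. by move=> a x y; apply/eqP; rewrite xpair_eqE /= eqxx scaler0 addr0 eqxx. Qed.

Definition scomul (s : S) : tensor S S :=
  tmap inl_ inl_ (comul s.1) + tmap inr_ inr_ (comul s.2).
Definition scounit (s : S) : k^o := counit s.1 + counit s.2.
Let fst_lin : linear (fun s : S => s.1). Proof. by []. Qed.
Let snd_lin : linear (fun s : S => s.2). Proof. by []. Qed.
Let tl_lin (X : coalgebra k) (i : X -> S) : linear i -> linear (tmap i i).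
Proof.
move=> H; apply: tlift_linear; split=> [d|c]; first exact: lin_tensl.
exact: lin_tensr.
Qed.
Let scomul_linear : linear scomul.
Proof.
apply: lin_add.
  apply: (lin_comp fst_lin (g := fun c => tmap inl_ inl_ (comul c))).
  by apply: lin_comp; [exact: comul_linear|exact: tl_lin].
apply: (lin_comp snd_lin (g := fun c => tmap inr_ inr_ (comul c))).
by apply: lin_comp; [exact: comul_linear|exact: tl_lin].
Qed.
Let scounit_linear : linear scounit.
Proof.
apply: lin_add; first exact: (lin_comp fst_lin (@counit_linear k C)).
exact: (lin_comp snd_lin (@counit_linear k D)).
Qed.
Let liftmap (U : lmodType k) (X : coalgebra k) (i : X -> S) (f : S -> S -> U) t :
  bilin f -> linear i -> tlift f (tmap i i t) = tlift (fun x y => f (i x) (i y)) t.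
Proof.
move=> B L; rewrite /tmap tlift_comp; last exact: tlift_linear.
by apply: eq_tlift => x y; rewrite tlift_tens.
Qed.
Let liftE (U : lmodType k) (f : S -> S -> U) s : bilin f -> tlift f (scomul s) =
  tlift (fun x y => f (inl_ x) (inl_ y)) (comul s.1) +
  tlift (fun x y => f (inr_ x) (inr_ y)) (comul s.2).
Proof. by move=> B; rewrite linD ?liftmap //; exact: tlift_linear. Qed.
Let comul_inl c : scomul (inl_ c) = tmap inl_ inl_ (comul c).
Proof. by rewrite /scomul /= (lin0 (@comul_linear k D)) (lin0 (tl_lin inr_lin)) addr0. Qed.
Let comul_inr c : scomul (inr_ c) = tmap inr_ inr_ (comul c).
Proof. by rewrite /scomul /= (lin0 (@comul_linear k C)) (lin0 (tl_lin inl_lin)) add0r. Qed.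
Let sum_inj s : inl_ s.1 + inr_ s.2 = s.
Proof. by case: s => c d; apply/eqP; rewrite xpair_eqE /= addr0 add0r !eqxx. Qed.

Let scomulA s :
    tlift (fun x y => tlift (fun x1 x2 => x1 \ox (x2 \ox y)) (scomul x)) (scomul s) =
    tlift (fun x y => tlift (fun y1 y2 => x \ox (y1 \ox y2)) (scomul y)) (scomul s).
Proof.
have sl := scomul_linear.
rewrite !liftE; try by linearity.
have H (X : coalgebra k) (i : X -> S) c : linear i ->
   (forall x, scomul (i x) = tmap i i (comul x)) ->
   tlift (fun x y => tlift (fun x1 x2 => x1 \ox (x2 \ox i y)) (scomul (i x))) (comul c) =
   tlift (fun x y => tlift (fun y1 y2 => i x \ox (y1 \ox y2)) (scomul (i y))) (comul c).
  move=> L E.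
  under eq_tlift do (rewrite E liftmap //; last by linearity).
  under [in RHS]eq_tlift do (rewrite E liftmap //; last by linearity).
  by rewrite (@comulA_tri k X _ (fun x y z => i x \ox (i y \ox i z))) // => *; linearity.
by rewrite !H.
Qed.
Let scounitl s : tlift (fun x y => scounit x *: y) (scomul s) = s.
Proof.
have sl := scounit_linear; rewrite liftE; last by linearity.
rewrite -[RHS]sum_inj; congr (_ + _).
  rewrite -[RHS](counitl_lin _ inl_lin); apply: eq_tlift => x y.
  by rewrite /scounit /= (lin0 (@counit_linear k D)) addr0.
rewrite -[RHS](counitl_lin _ inr_lin); apply: eq_tlift => x y.
by rewrite /scounit /= (lin0 (@counit_linear k C)) add0r.
Qed.
Let scounitr s : tlift (fun x y => scounit y *: x) (scomul s) = s.
Proof.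
have sl := scounit_linear; rewrite liftE; last by linearity.
rewrite -[RHS]sum_inj; congr (_ + _).
  rewrite -[RHS](counitr_lin _ inl_lin); apply: eq_tlift => x y.
  by rewrite /scounit /= (lin0 (@counit_linear k D)) addr0.
rewrite -[RHS](counitr_lin _ inr_lin); apply: eq_tlift => x y.
by rewrite /scounit /= (lin0 (@counit_linear k C)) add0r.
Qed.
Definition sum_coalg : coalgebra k :=
  Coalgebra scomul_linear scounit_linear scomulA scounitl scounitr.
End SumCoalgebra.

(* A diagram of coalgebras; the composition of dhom plays no role in the
   formation of the colimit and is not recorded. *)
Record diagram (k : fieldType) := Diagram {
  dobj : Type;
  dcoalg : dobj -> coalgebra k;
  dhom : dobj -> dobj -> Type;
  dmap : forall i j, dhom i j -> coalghom (dcoalg i) (dcoalg j) }.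
Arguments dcoalg {k} d i.

Section Colimit.
Variables (k : fieldType) (D : diagram k).

Definition dcocone (U : lmodType k) (f : forall i, dcoalg D i -> U) :=
  (forall i, linear (f i)) /\
  (forall i j (h : dhom i j) c, f j (dmap h c) = f i c).

Definition colim_space : lmodType k :=
  presented (fun (U : lmodType k) (f : {i & dcoalg D i} -> U) =>
    dcocone (fun i c => f (existT _ i c))).

Definition colim_in_fun i (c : dcoalg D i) : colim_space :=
  pres_gen _ (existT (fun i => dcoalg D i) i c).
Definition colim_lift (U : lmodType k) (f : forall i, dcoalg D i -> U) :
    colim_space -> U :=
  pres_lift (fun p => f (tag p) (tagged p)).

Lemma colim_in_cocone : dcocone colim_in_fun.
Proof.
split=> [i a x y|i j h c]; apply/pres_eqP => U f Pf.
  by rewrite pres_lift_linear // !pres_lift_gen // (Pf.1 i).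
by rewrite !pres_lift_gen // Pf.2.
Qed.
Lemma colim_lift_linear (U : lmodType k) (f : forall i, dcoalg D i -> U) :
  dcocone f -> linear (colim_lift f).
Proof. by move=> Pf; apply: pres_lift_linear. Qed.
Lemma colim_lift_in (U : lmodType k) (f : forall i, dcoalg D i -> U) i c :
  dcocone f -> colim_lift f (@colim_in_fun i c) = f i c.
Proof. by move=> Pf; rewrite /colim_lift /colim_in_fun pres_lift_gen. Qed.
Lemma colim_ext (U : lmodType k) (h h' : colim_space -> U) :
  linear h -> linear h' ->
  (forall i c, h (@colim_in_fun i c) = h' (@colim_in_fun i c)) -> h =1 h'.
Proof.
move=> H H' e x; rewrite [x]pres_genE /pres_lift /formal_eval !lin_sum //.
by apply: eq_bigr => -[a [i c]] _; rewrite e.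
Qed.

Let in_lin i : linear (@colim_in_fun i). Proof. exact: colim_in_cocone.1. Qed.
Let comul_cocone : dcocone (fun i (c : dcoalg D i) =>
  tmap (@colim_in_fun i) (@colim_in_fun i) (comul c)).
Proof.
split=> [i|i j h c]; first by have L := @in_lin i; rewrite /tmap; linearity.
have Li := @in_lin i; have Lj := @in_lin j.
rewrite coalghom_comul /tmap tlift_comp; last by linearity.
apply: eq_tlift => v w; rewrite tlift_tens ?colim_in_cocone.2 //; linearity.
Qed.
Let counit_cocone : dcocone (fun i (c : dcoalg D i) => counit c : k^o).
Proof.
split=> [i|i j h c]; [exact: counit_linear | exact: coalghom_counit].
Qed.
Definition colim_comul : colim_space -> tensor colim_space colim_space :=
  colim_lift (fun i (c : dcoalg D i) =>
    tmap (@colim_in_fun i) (@colim_in_fun i) (comul c)).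
Definition colim_counit : colim_space -> k^o :=
  colim_lift (fun i (c : dcoalg D i) => counit c : k^o).
Let ccl : linear colim_comul. Proof. exact: colim_lift_linear. Qed.
Let ccul : linear colim_counit. Proof. exact: colim_lift_linear. Qed.
Let liftE (U : lmodType k) (f : colim_space -> colim_space -> U) i c : bilin f ->
  tlift f (colim_comul (@colim_in_fun i c)) =
  tlift (fun x y => f (@colim_in_fun i x) (@colim_in_fun i y)) (comul c).
Proof.
move=> B; rewrite /colim_comul colim_lift_in // /tmap tlift_comp.
  by apply: eq_tlift => x y; rewrite tlift_tens.
exact: tlift_linear.
Qed.
Let colim_comulA t :
    tlift (fun x y => tlift (fun x1 x2 => x1 \ox (x2 \ox y)) (colim_comul x)) (colim_comul t) =
    tlift (fun x y => tlift (fun y1 y2 => x \ox (y1 \ox y2)) (colim_comul y)) (colim_comul t).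
Proof.
move: t; apply: colim_ext; [linearity|linearity|] => i c.
have Li := @in_lin i; rewrite !liftE; try by linearity.
under eq_tlift do (rewrite liftE //; last by linearity).
under [in RHS]eq_tlift do (rewrite liftE //; last by linearity).
by rewrite (@comulA_tri k _ _ (fun x y z => colim_in_fun x \ox (colim_in_fun y \ox colim_in_fun z)))
  // => *; linearity.
Qed.
Let colim_counitl t : tlift (fun x y => colim_counit x *: y) (colim_comul t) = t.
Proof.
move: t; apply: colim_ext; [linearity|linearity|] => i c.
rewrite liftE; last by linearity.
under eq_tlift do rewrite /colim_counit colim_lift_in //.
exact: counitl_lin.
Qed.
Let colim_counitr t : tlift (fun x y => colim_counit y *: x) (colim_comul t) = t.
Proof.
move: t; apply: colim_ext; [linearity|linearity|] => i c.
rewrite liftE; last by linearity.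
under eq_tlift do rewrite /colim_counit colim_lift_in //.
exact: counitr_lin.
Qed.

Definition colim : coalgebra k :=
  Coalgebra ccl ccul colim_comulA colim_counitl colim_counitr.

Definition colim_in i : coalghom (dcoalg D i) colim.
Proof.
apply: (@CoalgHom k (dcoalg D i) colim (@colim_in_fun i)) => [|c|c].
- exact: (@in_lin).
- by rewrite /= /colim_comul colim_lift_in.
- by rewrite /= /colim_counit colim_lift_in.
Defined.

(* colim is the colimit in the category of coalgebras *)
Lemma colim_universal (E : coalgebra k) (f : forall i, coalghom (dcoalg D i) E) :
  (forall i j (h : dhom i j) c, f j (dmap h c) = f i c) ->
  exists g : coalghom colim E, (forall i c, g (colim_in i c) = f i c) /\
    forall g' : coalghom colim E,
      (forall i c, g' (colim_in i c) = f i c) -> forall x, g' x = g x.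
Proof.
move=> fc; have cf : dcocone (fun i => f i : _ -> E).
  by split=> // i; exact: coalghom_linear.
have gl := colim_lift_linear cf.
have g1 x : comul (colim_lift (fun i => f i : _ -> E) x) =
   tmap (colim_lift (fun i => f i : _ -> E)) (colim_lift (fun i => f i : _ -> E)) (colim_comul x).
  move: x; apply: colim_ext.
  - by apply: lin_comp gl _; exact: comul_linear.
  - by apply: lin_tlift => //; linearity.
  - move=> i c; rewrite colim_lift_in // coalghom_comul /tmap liftE; last by linearity.
    by apply: eq_tlift => x y; rewrite !colim_lift_in.
have g2 x : counit (colim_lift (fun i => f i : _ -> E) x) = colim_counit x.
  move: x; apply: (colim_ext (U := k^o)).
  - by apply: lin_comp gl _; exact: counit_linear.
  - exact: ccul.
  - move=> i c; rewrite colim_lift_in // coalghom_counit /colim_counit colim_lift_in //.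
exists (@CoalgHom k colim E _ gl g1 g2); split=> [i c|g' Hg'].
  exact: colim_lift_in.
apply: (colim_ext (@coalghom_linear _ _ _ g') gl).
by move=> i c; rewrite (Hg' i c) /= colim_lift_in.
Qed.
End Colimit.

Section Comatrix.
Variables (k : fieldType) (d : nat).
Let M : lmodType k := 'M[k]_d.
Let E (i j : 'I_d) : M := delta_mx i j.

(* The basis element E^{ij} is delta_mx i j. *)
Definition comatrix_comul (m : M) : tensor M M :=
  \sum_i \sum_j m i j *: \sum_r (delta_mx i r : M) \ox (delta_mx r j : M).
Definition comatrix_counit (m : M) : k^o := \tr m.

Let cl : linear comatrix_comul.
Proof.
move=> a x y; rewrite /comatrix_comul scaler_sumr -big_split; apply: eq_bigr => i _.
rewrite scaler_sumr -big_split; apply: eq_bigr => j _.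
by rewrite !mxE scalerDl scalerA.
Qed.
Let ul : linear comatrix_counit.
Proof. by move=> a x y; rewrite /comatrix_counit mxtraceD mxtraceZ. Qed.
Let mat_ext (U : lmodType k) (h h' : M -> U) :
  linear h -> linear h' -> (forall i j, h (E i j) = h' (E i j)) -> h =1 h'.
Proof.
move=> H H' e m; rewrite [m]matrix_sum_delta !linD_sum //; apply: eq_bigr => i _.
by rewrite !linD_sum //; apply: eq_bigr => j _; rewrite !linZ // e.
Qed.

Lemma comatrix_comulE i j : comatrix_comul (E i j) = \sum_r E i r \ox E r j.
Proof.
rewrite /comatrix_comul (bigD1 i) //= [X in _ + X]big1 ?addr0; last first.
  by move=> i' /negPf ni; apply: big1 => j' _; rewrite mxE ni scale0r.
rewrite (bigD1 j) //= [X in _ + X]big1 ?addr0; last first.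
  by move=> j' /negPf nj; rewrite mxE nj andbF scale0r.
by rewrite mxE !eqxx scale1r.
Qed.
Lemma comatrix_counitE i j : comatrix_counit (E i j) = (i == j)%:R.
Proof.
rewrite /comatrix_counit /mxtrace (bigD1 i) //= big1 ?addr0; last first.
  by move=> i' /negPf ni; rewrite mxE ni.
by rewrite mxE eqxx.
Qed.
Let liftE (U : lmodType k) (f : M -> M -> U) i j : bilin f ->
  tlift f (comatrix_comul (E i j)) = \sum_r f (E i r) (E r j).
Proof.
move=> B; rewrite comatrix_comulE linD_sum; last exact: tlift_linear.
by apply: eq_bigr => r _; rewrite tlift_tens.
Qed.
Let comatrix_comulA m :
  tlift (fun x y => tlift (fun x1 x2 => x1 \ox (x2 \ox y)) (comatrix_comul x))
        (comatrix_comul m) =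
  tlift (fun x y => tlift (fun y1 y2 => x \ox (y1 \ox y2)) (comatrix_comul y))
        (comatrix_comul m).
Proof.
have Lc := cl; have Lu := ul; move: m; apply: mat_ext; [linearity|linearity|] => i j; rewrite !liftE; try by linearity.
under eq_bigr do (rewrite liftE; last by linearity).
rewrite exchange_big /=; apply: eq_bigr => r _.
by rewrite liftE; last by linearity.
Qed.
Let comatrix_counitl m :
  tlift (fun x y => comatrix_counit x *: y) (comatrix_comul m) = m.
Proof.
have Lc := cl; have Lu := ul; move: m; apply: mat_ext; [linearity|linearity|] => i j; rewrite liftE; last by linearity.
rewrite (bigD1 i) //= comatrix_counitE eqxx scale1r big1 ?addr0 // => r nr.
by rewrite comatrix_counitE eq_sym (negPf nr) scale0r.
Qed.
Let comatrix_counitr m :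
  tlift (fun x y => comatrix_counit y *: x) (comatrix_comul m) = m.
Proof.
have Lc := cl; have Lu := ul; move: m; apply: mat_ext; [linearity|linearity|] => i j; rewrite liftE; last by linearity.
rewrite (bigD1 j) //= comatrix_counitE eqxx scale1r big1 ?addr0 // => r nr.
by rewrite comatrix_counitE (negPf nr) scale0r.
Qed.
Definition comatrix : coalgebra k :=
  Coalgebra cl ul comatrix_comulA comatrix_counitl comatrix_counitr.
End Comatrix.

Definition findim (k : fieldType) (V : lmodType k) : Prop :=
  exists n, inhabited (Vector.axiom n V).

Lemma findim_inj (k : fieldType) (V : lmodType k) n (phi : V -> 'rV[k]_n) :
  linear phi -> injective phi -> findim V.
Proof.
move=> L inj.
pose P m := `[< exists vs : seq V, size vs = m /\ free (map phi vs) >].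
have exP : exists m, P m.
  by exists 0%N; apply/asboolP; exists [::]; split=> //; exact: nil_free.
have ub m : P m -> (m <= n)%N.
  move=> /asboolP[vs [<- fr]]; rewrite -(size_map phi).
  move: fr; rewrite /free => /eqP <-.
  by apply: leq_trans (dimvS (subvf _)) _; rewrite dimvf /dim /= mul1n.
case: (ex_maxnP exP ub) => m /asboolP[vs [sz fr]] mx.
have span v : phi v \in <<map phi vs>>%VS.
  apply/negP => /negP nin.
  have : P m.+1.
    by apply/asboolP; exists (v :: vs); split; rewrite /= ?sz // free_cons nin.
  by move=> /mx; rewrite ltnn.
pose X := in_tuple (map phi vs).
have szX : size (map phi vs) = size vs by rewrite size_map.
exists (size (map phi vs)); constructor.
pose f v : 'rV[k]_(size (map phi vs)) := \row_i coord X i (phi v).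
pose g (r : 'rV[k]_(size (map phi vs))) : V := \sum_i r 0 i *: nth 0 vs i.
have Xi (i : 'I_(size (map phi vs))) : phi (nth 0 vs i) = X`_i.
  by rewrite /= (nth_map 0) // -szX.
have phig r : phi (g r) = \sum_i r 0 i *: X`_i.
  by rewrite /g lin_sum //; apply: eq_bigr => i _; rewrite Xi.
exists f.
  by move=> a x y; apply/rowP => i; rewrite !mxE L linearP.
exists g => [v|r].
  apply: inj; rewrite phig [RHS](@coord_span _ _ _ X (phi v) (span v)).
  by apply: eq_bigr => i _; rewrite mxE.
by apply/rowP => i; rewrite mxE phig coord_sum_free.
Qed.

Section FiniteDual.
Variables (k : fieldType) (A : algebra k).

Definition ideal_capI (I J : ideal A) : ideal A.
Proof.
apply: (@Ideal k A (fun x => I x /\ J x)) => [|x y [? ?] [? ?]|a x [? ?]|a x [? ?]].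
- by split; exact: ideal0.
- by split; exact: idealD.
- by split; exact: idealMl.
- by split; exact: idealMr.
Defined.

Lemma findim_capI (I J : ideal A) :
  findim (quot I) -> findim (quot J) -> findim (quot (ideal_capI I J)).
Proof.
move=> [m [[f lf bf]]] [n [[g lg bg]]].
have sI : ideal_capI I J `<=` I by move=> x [].
have sJ : ideal_capI I J `<=` J by move=> x [].
pose phi (q : quot (ideal_capI I J)) : 'rV[k]_(m + n) :=
  row_mx (f (quot_map sI q)) (g (quot_map sJ q)).
apply: (@findim_inj _ _ _ phi) => [a x y|].
  by rewrite /phi !alghom_linear lf lg scale_row_mx add_row_mx.
elim/quot_ind=> x; elim/quot_ind=> y /eq_row_mx[/(bij_inj bf) eI /(bij_inj bg) eJ].
rewrite /= !(quot_map_funE sI) in eI; rewrite /= !(quot_map_funE sJ) in eJ.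
apply/quot_piP; split; [exact: (quot_piP I x y).1 eI|exact: (quot_piP J x y).1 eJ].
Qed.

Definition finite_dual_pred : {pred A -> k^o} := fun f =>
  `[< linear f /\ exists I : ideal A, findim (quot I) /\ forall x, I x -> f x = 0 >].

Record finite_dual_sort := FiniteDual {
  finite_dual_fun :> A -> k^o;
  _ : finite_dual_fun \in finite_dual_pred }.
HB.instance Definition _ := [isSub for finite_dual_fun].
HB.instance Definition _ := [Choice of finite_dual_sort by <:].

Definition full_ideal : ideal A.
Proof. by apply: (@Ideal k A (fun=> True)). Defined.

Let findim_full : findim (quot full_ideal).
Proof.
apply: (@findim_inj _ _ 0 (fun=> 0)) => [a x y|]; first by rewrite scaler0 add0r.
by elim/quot_ind=> x; elim/quot_ind=> y _; apply/quot_piP.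
Qed.

Let closed : subsemimod_closed finite_dual_pred.
Proof.
split; first split.
- apply/asboolP; split; first by move=> a x y; change (0 = a *: 0 + 0 :> k^o); rewrite scaler0 addr0.
  by exists full_ideal; split.
- move=> f g /asboolP[lf [I [fI kI]]] /asboolP[lg [J [fJ kJ]]]; apply/asboolP; split.
    exact: lin_add.
  exists (ideal_capI I J); split; first exact: findim_capI.
  by move=> x [Ix Jx]; change (f x + g x = 0); rewrite (kI x Ix) (kJ x Jx); exact: addr0.
- move=> c f /asboolP[lf [I [fI kI]]]; apply/asboolP; split.
    exact: (lin_comp lf (@lin_scale k k^o c)).
  by exists I; split=> // x Ix; change (c *: f x = 0); rewrite (kI x Ix); exact: scaler0.
Qed.
HB.instance Definition _ :=
  GRing.SubChoice_isSubLmodule.Build k (A -> k^o) finite_dual_pred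
    finite_dual_sort closed.

Definition finite_dual_space : lmodType k := finite_dual_sort.
Implicit Types f g : finite_dual_space.

Lemma finite_dual_linear f : linear (f : A -> k^o).
Proof. by case: f => f /= /asboolP[]. Qed.
Lemma finite_dual_ker f :
  exists I : ideal A, findim (quot I) /\ forall x, I x -> f x = 0.
Proof. by case: f => f /= /asboolP[]. Qed.
Lemma finite_dual_ext f g : (forall a, f a = g a) -> f = g.
Proof. by move=> e; apply: val_inj; apply/funext. Qed.

Definition pairing2 (t : tensor finite_dual_space finite_dual_space) (a b : A) : k^o :=
  tlift (fun g h : finite_dual_space => g a * h b : k^o) t.

(* The comultiplication is dual to the multiplication: comul f is the tensor t
   with <t, a (x) b> = f (a * b), which exists and is unique by
   finite_dual_comulP and pairing2_inj. *)
Definition finite_dual_comul f : tensor finite_dual_space finite_dual_space :=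
  xget 0 [set t | forall a b, pairing2 t a b = f (a * b)].
Definition finite_dual_counit f : k^o := f 1.
End FiniteDual.
Arguments finite_dual_pred {k} A.

(* A tensor is determined by its values on pairs of points when its two factors
   are separated by points. *)
Section Separation.
Variables (k : fieldType) (V W : lmodType k) (X Y : Type).
Variables (ev : V -> X -> k^o) (ew : W -> Y -> k^o).
Hypotheses (evL : forall x, linear (fun v => ev v x)).
Hypotheses (ewL : forall y, linear (fun w => ew w y)).
Hypotheses (ev0 : forall v, (forall x, ev v x = 0) -> v = 0).
Hypotheses (ew0 : forall w, (forall y, ew w y = 0) -> w = 0).

Let interp (l : seq (V * X)) (v : V) : V := \sum_(p <- l) ev v p.2 *: p.1.

Let interp_exists (s : seq V) :
  exists l, {in s, forall v, interp l v = v}.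
Proof.
elim: s => [|v s [l Hl]]; first by exists [::].
have [e|ne] := eqVneq (interp l v) v.
  by exists l => u; rewrite inE => /orP[/eqP->|/Hl].
pose r := v - interp l v.
have [x rx] : exists x, ev r x != 0.
  apply: contrapT => h; move: ne; rewrite eq_sym -subr_eq0 -/r => /negP; apply.
  apply/eqP/ev0 => x; apply/eqP/negP => /negP nz; apply: h; by exists x.
pose l' := ((ev r x)^-1 *: r, x) ::
  [seq (p.1 - (ev p.1 x / ev r x) *: r, p.2) | p <- l].
have El' u : interp l' u = interp l u + (ev (u - interp l u) x / ev r x) *: r.
  rewrite /interp big_cons big_map /=.
  under eq_bigr do rewrite scalerBr.
  rewrite sumrB addrCA; congr (_ + _).
  have -> : ev (u - interp l u) x = ev u x - \sum_(p <- l) ev u p.2 *: ev p.1 x.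
    rewrite -scaleN1r addrC (evL x) scaleN1r addrC; congr (_ - _).
    exact: (lin_sum _ _ _ (evL x)).
  rewrite mulrBl scalerBl scalerA; congr (_ - _).
  rewrite mulr_suml scaler_suml; apply: eq_bigr => p _.
  by rewrite !scalerA mulrA.
exists l' => u; rewrite inE => /orP[/eqP->|us]; rewrite El'.
  by rewrite -/r divff // scale1r addrC subrK.
rewrite Hl // subrr (lin0 (evL x)) mul0r scale0r addr0 //.
Qed.

Lemma tensor_separated (t : tensor V W) :
  (forall x y, tlift (fun v w => ev v x * ew w y : k^o) t = 0) -> t = 0.
Proof.
move=> h.
have [l Hl] := interp_exists [seq p.2.1 | p <- (repr t : formal_sum k (V * W))].
rewrite -[t]tlift_id.
transitivity (tlift (fun v w => interp l v \ox w) t).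
  rewrite /tlift /pres_lift /formal_eval; apply: eq_big_seq => p pt.
  by rewrite Hl //; apply: map_f.
transitivity (\sum_(p <- l) p.1 \ox tlift (fun v w => ev v p.2 *: w) t).
  transitivity (tlift (fun v w => \sum_(p <- l) p.1 \ox (ev v p.2 *: w)) t).
    apply: eq_tlift => v w; rewrite /interp.
    rewrite (linD_sum _ _ (h := fun z => z \ox w)); last by linearity.
    apply: eq_bigr => p _.
    by rewrite (linZ _ _ ((tens_bilin _ _).1 w)) (linZ _ _ ((tens_bilin _ _).2 p.1)).
  rewrite {1}/tlift /pres_lift /formal_eval.
  under eq_bigr do rewrite scaler_sumr.
  rewrite exchange_big /=; apply: eq_bigr => p _.
  by rewrite tlift_comp //; exact: (tens_bilin _ _).2.
rewrite big1 // => p _.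
have -> : tlift (fun v w => ev v p.2 *: w) t = 0.
  apply: ew0 => y; rewrite (tlift_comp _ _ (ewL y)) -[RHS](h p.2 y).
  by apply: eq_tlift => v w; rewrite (linZ _ _ (ewL y)).
exact: lin0 ((tens_bilin _ _).2 _).
Qed.
End Separation.

Definition zero_ideal (k : fieldType) (A : algebra k) : ideal A.
Proof.
by apply: (@Ideal k A (fun x => x = 0)) => [|x y -> ->|a x ->|a x ->] //;
  rewrite ?addr0 ?mulr0 ?mul0r.
Defined.

Section FiniteDualCoalgebra.
Variables (k : fieldType) (A : algebra k).
Let V : lmodType k := finite_dual_space A.
Implicit Types f g : V.

Let evL a : linear (fun f : V => f a : k^o).
Proof. by []. Qed.
Let mul_lin (a b : A) : bilin (fun g h : V => g a * h b : k^o).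
Proof.
split=> [h|g] c x y; first by rewrite evL mulrDl -scalerAl.
by rewrite evL mulrDr -scalerAr.
Qed.
Lemma pairing2_linear (a b : A) : linear (fun t => pairing2 t a b).
Proof. exact: tlift_linear (mul_lin a b). Qed.
Lemma pairing2_tens g h (a b : A) : pairing2 (g \ox h) a b = g a * h b.
Proof. exact: tlift_tens (mul_lin a b). Qed.

Lemma finite_dual_sub (U : lmodType k) (x y : U) : x - y = 0 -> x = y.
Proof. by move/eqP; rewrite subr_eq0 => /eqP. Qed.

Lemma pairing2_inj (t u : tensor V V) :
  (forall a b, pairing2 t a b = pairing2 u a b) -> t = u.
Proof.
move=> e; apply: finite_dual_sub.
apply: (tensor_separated (ev := fun (f : V) a => f a) (ew := fun (f : V) a => f a)) => //.
- by move=> f f0; apply: finite_dual_ext.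
- by move=> f f0; apply: finite_dual_ext.
- move=> a b; rewrite -/(pairing2 (t - u) a b).
  by rewrite -scaleN1r addrC (pairing2_linear a b) scaleN1r addrC e subrr.
Qed.

Let pairing3 (t : tensor V (tensor V V)) (a b c : A) : k^o :=
  tlift (fun (g : V) u => g a * pairing2 u b c : k^o) t.
Let pairing3_inj t u :
  (forall a b c, pairing3 t a b c = pairing3 u a b c) -> t = u.
Proof.
move=> e; apply: finite_dual_sub.
apply: (tensor_separated (ev := fun (f : V) a => f a)
  (ew := fun t (p : A * A) => pairing2 t p.1 p.2)) => //.
- by move=> p; apply: pairing2_linear.
- by move=> f f0; apply: finite_dual_ext.
- move=> v v0; apply: pairing2_inj => a b; rewrite (v0 (a, b)).
  by rewrite (lin0 (pairing2_linear a b)).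
- move=> a [b c] /=.
  have L : linear (fun t => pairing3 t a b c).
    apply: tlift_linear; split=> [h|g] r x y; first by rewrite evL mulrDl -scalerAl.
    by rewrite pairing2_linear mulrDr -scalerAr.
  rewrite -/(pairing3 (t - u) a b c).
  by rewrite -scaleN1r addrC L scaleN1r addrC e subrr.
Qed.

Lemma finite_dual_comul_exists f :
  exists t : tensor V V, forall a b, pairing2 t a b = f (a * b).
Proof.
have [I [[n [[q ql [r qr rq]]]] fI]] := finite_dual_ker f.
have lf := finite_dual_linear f.
pose s (j : 'I_n) : A := repr (r (delta_mx 0 j) : quot_sort I).
have cP j : (fun a => q (quot_pi I a) 0 j : k^o) \in finite_dual_pred A.
  apply/asboolP; split.
    by move=> c x y; rewrite quot_pi_linear ql !mxE.
  exists I; split; first by exists n; constructor; exists q => //; exists r.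
  move=> x Ix; have -> : quot_pi I x = (0 : quot I).
    rewrite -(lin0 (quot_pi_linear I)); apply/quot_piP; by rewrite subr0.
  by rewrite (lin0 ql) mxE.
have gP j : (fun b => f (s j * b) : k^o) \in finite_dual_pred A.
  apply/asboolP; split; first by move=> c x y; rewrite mulrDr -ascalerAr lf.
  exists I; split; first by exists n; constructor; exists q => //; exists r.
  by move=> x Ix; apply: fI; apply: idealMl.
exists (\sum_j (FiniteDual (cP j) : V) \ox (FiniteDual (gP j) : V)) => a b.
rewrite (linD_sum _ _ (pairing2_linear a b)).
under eq_bigr do rewrite pairing2_tens /=.
have Ia : I (a - \sum_j q (quot_pi I a) 0 j *: s j).
  apply/quot_piP; apply: (can_inj qr).
  rewrite (lin_sum _ _ _ (quot_pi_linear I)) (lin_sum _ _ _ ql).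
  rewrite {1}[q _]row_sum_delta; apply: eq_bigr => j _; congr (_ *: _).
  by rewrite /s /quot_pi reprK rq.
rewrite -[a in RHS](subrK (\sum_j q (quot_pi I a) 0 j *: s j)) mulrDl.
rewrite (linD _ _ lf) (fI _ (idealMr b Ia)) add0r mulr_suml.
rewrite (linD_sum _ _ lf); apply: eq_bigr => j _.
by rewrite -ascalerAl (linZ _ _ lf).
Qed.

Lemma finite_dual_comulP f a b : pairing2 (finite_dual_comul f) a b = f (a * b).
Proof.
rewrite /finite_dual_comul; case: xgetP => [t _ tP|]; first exact: tP.
by have [t tP] := finite_dual_comul_exists f => /(_ t); case.
Qed.

Let fc_linear : linear (@finite_dual_comul k A).
Proof.
move=> c x y; apply: pairing2_inj => a b.
by rewrite pairing2_linear !finite_dual_comulP.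
Qed.
Let fu_linear : linear (@finite_dual_counit k A).
Proof. by []. Qed.
Let fcomulA f :
  tlift (fun x y => tlift (fun x1 x2 => x1 \ox (x2 \ox y)) (finite_dual_comul x))
        (finite_dual_comul f) =
  tlift (fun x y => tlift (fun y1 y2 => x \ox (y1 \ox y2)) (finite_dual_comul y))
        (finite_dual_comul f).
Proof.
apply: pairing3_inj => a b c.
have B : bilin (fun (g : V) u => g a * pairing2 u b c : k^o).
  split=> [h|g] r x y; first by rewrite evL mulrDl -scalerAl.
  by rewrite pairing2_linear mulrDr -scalerAr.
have L := tlift_linear B.
have E x y z : pairing3 (x \ox (y \ox z)) a b c = x a * (y b * z c).
  by rewrite /pairing3 tlift_tens // pairing2_tens.
rewrite /pairing3 !(tlift_comp _ _ L).
transitivity (pairing2 (finite_dual_comul f) (a * b) c).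
  apply: eq_tlift => x y; rewrite (tlift_comp _ _ L) -finite_dual_comulP.
  have lm : linear (fun z : k^o => z * y c : k^o) by move=> r u v; rewrite mulrDl -scalerAl.
  rewrite /pairing2 (tlift_comp _ _ lm); apply: eq_tlift => u v.
  by rewrite -/(pairing3 _ a b c) E mulrA.
rewrite finite_dual_comulP -mulrA -finite_dual_comulP.
apply: eq_tlift => x y; rewrite (tlift_comp _ _ L) -finite_dual_comulP.
have lm : linear (fun z : k^o => x a * z : k^o) by move=> r u v; rewrite mulrDr -scalerAr.
rewrite /pairing2 (tlift_comp _ _ lm); apply: eq_tlift => u v.
by rewrite -/(pairing3 _ a b c) E.
Qed.
Let fcounitl f : tlift (fun x y : V => finite_dual_counit x *: y) (finite_dual_comul f) = f.
Proof.
apply: finite_dual_ext => a; rewrite (tlift_comp _ _ (evL a)).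
have := finite_dual_comulP f 1 a; rewrite mul1r => <-.
by apply: eq_tlift => x y.
Qed.
Let fcounitr f : tlift (fun x y : V => finite_dual_counit y *: x) (finite_dual_comul f) = f.
Proof.
apply: finite_dual_ext => a; rewrite (tlift_comp _ _ (evL a)).
have := finite_dual_comulP f a 1; rewrite mulr1 => <-.
by apply: eq_tlift => x y; exact: mulrC.
Qed.

Definition finite_dual : coalgebra k :=
  Coalgebra fc_linear fu_linear fcomulA fcounitl fcounitr.
End FiniteDualCoalgebra.

(* For finite-dimensional A, A^o is the full dual A^*. *)
Lemma finite_dual_findim (k : fieldType) (A : algebra k) (f : A -> k^o) :
  findim A -> linear f -> f \in finite_dual_pred A.
Proof.
move=> [n [[q ql qb]]] lf; apply/asboolP; split=> //.
have Z : forall x y : A, zero_ideal A (x - y) -> x = y.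
  by move=> x y /eqP; rewrite subr_eq0 => /eqP.
exists (zero_ideal A); split; last by move=> x ->; exact: lin0.
pose h (x : quot (zero_ideal A)) := q (repr (x : quot_sort _)).
have hE x : h (quot_pi _ x) = q x by congr q; exact/Z/quot_repr.
apply: (@findim_inj _ _ _ h) => [c|].
  elim/quot_ind=> x; elim/quot_ind=> y.
  by rewrite -(quot_pi_linear (zero_ideal A)) !hE ql.
by elim/quot_ind=> x; elim/quot_ind=> y; rewrite !hE => /(bij_inj qb) ->.
Qed.

Section FiniteDualMap.
Variables (k : fieldType) (A B : algebra k) (phi : alghom A B).

Definition ideal_preim (J : ideal B) : ideal A.
Proof.
apply: (@Ideal k A (fun a => J (phi a))) => [|x y Jx Jy|a x Jx|a x Jx].
- by rewrite (lin0 (alghom_linear phi)); exact: ideal0.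
- by rewrite (linD _ _ (alghom_linear phi)); exact: idealD.
- by rewrite (alghom_monoid phi).2; exact: idealMl.
- by rewrite (alghom_monoid phi).2; exact: idealMr.
Defined.

Lemma findim_preim (J : ideal B) : findim (quot J) -> findim (quot (ideal_preim J)).
Proof.
move=> [n [[f lf bf]]].
pose h (q : quot (ideal_preim J)) : 'rV[k]_n := f (quot_pi J (phi (repr (q : quot_sort _)))).
have hE x : h (quot_pi _ x) = f (quot_pi J (phi x)).
  rewrite /h; congr f; apply/quot_piP.
  have := quot_repr (ideal_preim J) x; rewrite /= -scaleN1r addrC.
  by rewrite (alghom_linear phi) scaleN1r addrC.
apply: (@findim_inj _ _ _ h) => [a|].
  elim/quot_ind=> x; elim/quot_ind=> y.
  by rewrite -(quot_pi_linear (ideal_preim J)) !hE alghom_linear quot_pi_linear lf.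
elim/quot_ind=> x; elim/quot_ind=> y; rewrite !hE => /(bij_inj bf) e.
apply/quot_piP; have := (quot_piP J _ _).1 e.
by rewrite /= -scaleN1r addrC -(alghom_linear phi) scaleN1r addrC.
Qed.

Lemma finite_dual_map_subproof (f : finite_dual B) :
  (fun a => f (phi a) : k^o) \in finite_dual_pred A.
Proof.
apply/asboolP; split.
  exact: (lin_comp (alghom_linear phi) (finite_dual_linear f)).
have [J [fJ kJ]] := finite_dual_ker f.
by exists (ideal_preim J); split; [exact: findim_preim | move=> x /kJ].
Qed.
Definition finite_dual_map_fun (f : finite_dual B) : finite_dual A :=
  FiniteDual (finite_dual_map_subproof f).

Let map_linear : linear finite_dual_map_fun.
Proof. by move=> c x y; apply: finite_dual_ext. Qed.
Let map_comul f : comul (finite_dual_map_fun f) =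
  tmap finite_dual_map_fun finite_dual_map_fun (comul f).
Proof.
apply: pairing2_inj => a b; rewrite finite_dual_comulP /=.
rewrite (alghom_monoid phi).2 -finite_dual_comulP /tmap.
rewrite (tlift_comp _ _ (pairing2_linear a b)).
by apply: eq_tlift => x y; rewrite pairing2_tens.
Qed.
Let map_counit f : counit (finite_dual_map_fun f) = counit f.
Proof. by rewrite /= /finite_dual_counit /= (alghom_monoid phi).1. Qed.

Definition finite_dual_map : coalghom (finite_dual B) (finite_dual A) :=
  CoalgHom map_linear map_comul map_counit.
End FiniteDualMap.

Section RingTheory.
Variables (k : fieldType) (A : algebra k).

Definition ideal_bigcap (F : set (ideal A)) : ideal A.
Proof.
apply: (@Ideal k A (fun x => forall J, F J -> J x)) =>
  [J _|x y Hx Hy J FJ|a x Hx J FJ|a x Hx J FJ].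
- exact: ideal0.
- by apply: idealD; [exact: Hx | exact: Hy].
- exact/idealMl/Hx.
- exact/idealMr/Hx.
Defined.

Definition ideal_gen (S : set A) : ideal A := ideal_bigcap [set J | S `<=` J].

Definition ideal_mul (I J : ideal A) : ideal A :=
  ideal_gen [set z | exists x y, [/\ I x, J y & z = x * y]].

Definition ideal_pow (I : ideal A) (i : nat) : ideal A :=
  iter i (ideal_mul I) (full_ideal A).

Lemma ideal_powS (I : ideal A) i j : (i <= j)%N -> ideal_pow I j `<=` ideal_pow I i.
Proof.
move=> /subnK <-; elim: (j - i)%N => [//|m IH] x H; apply: IH.
by apply: H => z [u [v [_ Jv ->]]]; exact: idealMl.
Qed.

Definition is_prime_ideal (P : ideal A) : Prop :=
  ~ P 1 /\ forall I J : ideal A, ideal_mul I J `<=` P -> I `<=` P \/ J `<=` P.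

Definition is_maximal_ideal (M : ideal A) : Prop :=
  ~ M 1 /\ forall J : ideal A, M `<=` J -> ~ J 1 -> J `<=` M.

Definition prime_algebra : Prop := is_prime_ideal (zero_ideal A).

(* A is finitely generated as a k-algebra: a subalgebra containing a suitable
   finite set is all of A *)
Definition affine : Prop := exists s : seq A, forall S : set A,
  S 1 -> (forall (c : k) x y, S x -> S y -> S (c *: x + y)) ->
  (forall x y, S x -> S y -> S (x * y)) -> (forall x, x \in s -> S x) -> forall x, S x.

Definition module_finite_over_center : Prop :=
  exists n (s : 'I_n -> A), forall a, exists z : 'I_n -> A,
    (forall i, central (z i)) /\ a = \sum_i z i * s i.

Definition center_incl : alghom (center A) A.
Proof. by apply: (@AlgHom k (center A) A (@center_val k A)). Defined.
End RingTheory.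

(* f : S -> Q exhibits Q as the ring of fractions of S with respect to its
   nonzero central elements. *)
Definition is_central_localization (S Q : pzRingType) (f : {rmorphism S -> Q}) : Prop :=
  [/\ forall z, central z -> z != 0 -> exists u, u * f z = 1 /\ f z * u = 1,
      forall q, exists s z, [/\ central z, z != 0 & q * f z = f s]
    & forall s, f s = 0 <-> exists z, [/\ central z, z != 0 & z * s = 0]].

Definition has_dim_over_center (Q : pzRingType) (n : nat) : Prop :=
  exists b : 'I_n -> Q, forall q, exists! c : 'I_n -> Q,
    (forall i, central (c i)) /\ q = \sum_i c i * b i.

Definition PI_degree (S : pzRingType) (d : nat) : Prop :=
  exists (Q : pzRingType) (f : {rmorphism S -> Q}),
    is_central_localization f /\ has_dim_over_center Q (d ^ 2).

Section Regular.
Variables (k : fieldType) (R : algebra k).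

(* PI degrees are unique, so this says that those of R and R/P agree. *)
Definition regular_ideal (P : ideal R) : Prop :=
  exists d, PI_degree R d /\ PI_degree (quot P) d.

Definition nonregular_ideal : ideal R :=
  ideal_bigcap [set M | is_maximal_ideal M /\ ~ regular_ideal M].

End Regular.

(* Index i stands for the coalgebra (R/N^(i+1))^o, so that only the positive
   powers of N occur. *)
Definition power_system (k : fieldType) (R : algebra k) (N : ideal R) : diagram k :=
  @Diagram k nat (fun i => finite_dual (quot (ideal_pow N i.+1)))
    (fun i j => (i <= j)%N)
    (fun i j (h : (i <= j)%N) =>
       finite_dual_map (quot_map (@ideal_powS k R N i.+1 j.+1 h))).

Section Dist.
Variables (k : fieldType) (A : comalgebra k) (I : ideal A).

Definition spec_point (B : comalgebra k) (p : ideal B) : Prop :=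
  ~ p 1 /\ forall a b, p (a * b) -> p a \/ p b.
(* U is the open subscheme of Spec A which is the non-vanishing locus of I. *)
Definition open_point (p : ideal A) : Prop := spec_point p /\ ~ (I `<=` p).

(* A morphism Spec B -> Spec A is an algebra homomorphism phi : A -> B.
   It defines a closed immersion Spec B -> U when
   - it maps Spec B into U;
   - it is a homeomorphism of Spec B onto a closed subset of U: it is injective
     on points and the image of a closed subset V(b) is of the form V(a) `&` U;
   - it is surjective on stalks: for p in U, the stalk of the structure sheaf
     of U is the localization A_p, that of the direct image of the structure sheaf
     of Spec B is the localization B_p at phi(A - p), and every fraction
     b / phi(t) in B_p is of the form phi(a) / phi(s). *)
Definition closed_immersion (B : comalgebra k) (phi : alghom A B) : Prop :=
  [/\ forall q : ideal B, spec_point q -> open_point (ideal_preim phi q),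
      forall q q' : ideal B, spec_point q -> spec_point q' ->
        (forall a, q (phi a) <-> q' (phi a)) -> (forall b, q b <-> q' b),
      forall J : ideal B, exists J' : ideal A, forall p, open_point p ->
        (J' `<=` p <->
         exists q : ideal B, [/\ spec_point q, J `<=` q & forall a, q (phi a) <-> p a])
    & forall p, open_point p -> forall b t, ~ p t ->
        exists a s u, [/\ ~ p s, ~ p u & phi u * (phi s * b) = phi u * (phi t * phi a)]].

(* A scheme finite over k is Spec B with B a finite-dimensional commutative
   algebra, which may be taken to be an algebra structure on k^n. *)
Record finite_closed_subscheme := FiniteClosedSubscheme {
  subscheme_dim : nat;
  subscheme_str : alg_on 'rV[k]_subscheme_dim;
  subscheme_mulC : commutative (@GRing.mul (Algebra subscheme_str));
  subscheme_map : alghom A (ComAlgebra subscheme_mulC);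
  subscheme_closed : closed_immersion subscheme_map }.

Definition coordinate_algebra (S : finite_closed_subscheme) : comalgebra k :=
  ComAlgebra (subscheme_mulC (f := S)).

(* S is contained in T when its immersion factors through that of T *)
Record subscheme_le (S T : finite_closed_subscheme) := SubschemeLe {
  subscheme_restr :> alghom (coordinate_algebra T) (coordinate_algebra S);
  subscheme_restrP : forall a, subscheme_restr (subscheme_map T a) = subscheme_map S a }.

(* Dist(U) for the open subscheme U of Spec A which is the non-vanishing locus of
   I. By finite_dual_findim, finite_dual (coordinate_algebra S) is the dual
   coalgebra Gamma(S, O_S)^*. *)
Definition Dist : coalgebra k := colim (@Diagram k finite_closed_subscheme
  (fun S => finite_dual (coordinate_algebra S)) subscheme_le
  (fun S T r => finite_dual_map (subscheme_restr r))).
End Dist.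

(* Main.v *)
From HB Require Import structures.
From mathcomp Require Import all_boot all_algebra.
From mathcomp Require Import zify ring perm.
From mathcomp Require Import boolp classical_sets.
Require Import Defs.

Set Implicit Arguments.
Unset Strict Implicit.
Unset Printing Implicit Defensive.

Import GRing.Theory.
Local Open Scope ring_scope.
Local Open Scope classical_set_scope.

(* Write Z for the center of A = R, I for the intersection of Z with N, and d for
   the PI degree. A functional in the finite dual kills an ideal of finite
   codimension, and a primary decomposition of the trace of this ideal on Z
   splits the functional into pieces supported at single maximal ideals m of Z.

   If m contains I, every maximal ideal of A above the ideal killed by the piece
   is non-regular, so this ideal contains a power of N and the piece comes from
   (A/N^i)^o.

   If m does not contain I, a Capelli polynomial composed with Razmyslov's
   transform gives a central alternating form in d^2 variables which does not
   vanish on matrix units modulo M, where M is a maximal ideal over m. Cramer's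
   rule for this form expands the elements of A over Z locally at m and gives
   M = mA; lifting matrix units, A/m^l A is the algebra of d x d matrices over
   Z/m^l. For S a finite closed subscheme of the Azumaya locus these coordinates
   glue to a homomorphism rho_S from A onto the d x d matrices over the functions
   on S, with kernel generated by the ideal of S in Z. Dually,
   E^{uv} (x) g |-> (r |-> g (rho_S(r)_uv)) embeds M^d (x) Dist in the finite
   dual, and its image contains the pieces supported on the Azumaya locus.

   The two images are independent: for every S some x in I is 1 on S, while x^i
   lies in N^i. *)

(** * Ideals of finite codimension *)

(** [A] need not be a matrix algebra on the whole Azumaya locus. A finite closed subscheme only sees
    infinitesimal neighbourhoods of finitely many closed points, and there [A] splits because k is
    algebraically closed. A splitting is not unique, while the colimit over S requires the maps
    rho_S to be compatible with restriction. Hence matrix units are lifted along all powers of m at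
    once, one system of coordinates is fixed for each m independently of S, and the entries of rho_S
    are characterized by congruences that mention no decomposition of S.

    The centrality of Razmyslov's values can only be tested modulo maximal ideals. This needs a
    Nullstellensatz for [A]: quotients by maximal ideals are matrix algebras over k, and the maximal
    ideals meet in 0. It is obtained without finiteness properties of Z: after inverting one central
    element, [A] is free with finitely many structure constants and coordinates of generators
    involved, and these are specialized at a point. Chain conditions are used only above ideals of
    finite codimension. *)

Section Codim.
Variables (k : fieldType) (V : lmodType k).

Definition lin_closed (P : set V) :=
  P 0 /\ forall (c : k) x y, P x -> P y -> P (c *: x + y).

Lemma lin_closed_sum (P : set V) (I : Type) (s : seq I) (c : I -> k) (x : I -> V) :
  lin_closed P -> (forall i, P (x i)) -> P (\sum_(i <- s) c i *: x i).
Proof.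
move=> [P0 PD] Px; elim: s => [|i s IH]; first by rewrite big_nil.
by rewrite big_cons; apply: PD.
Qed.

(** [mu P] is the largest number of elements of [P] with linearly independent images under [h]. It
    replaces the dimension of [P] modulo the kernel of [h] in all chain arguments below, for ideals,
    left ideals and mere subspaces alike. *)
Lemma codim_measure n (h : V -> 'rV[k]_n) : linear h ->
  exists mu : set V -> nat, (forall P, (mu P <= n)%N) /\
    forall P Q, lin_closed P -> (forall x, h x = 0 -> P x) -> P `<=` Q ->
      (mu P <= mu Q)%N /\ (mu P = mu Q -> Q `<=` P).
Proof.
move=> L.
pose fr (P : set V) m := `[< exists vs : seq V,
  [/\ size vs = m, free (map h vs) & forall v, v \in vs -> P v] >].
have exfr P : exists m, fr P m.
  by exists 0%N; apply/asboolP; exists [::]; split=> //; exact: nil_free.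
have ub P m : fr P m -> (m <= n)%N.
  move=> /asboolP[vs [<- f _]]; rewrite -(size_map h).
  move: f; rewrite /free => /eqP <-.
  by apply: leq_trans (dimvS (subvf _)) _; rewrite dimvf /dim /= mul1n.
exists (fun P => ex_maxn (exfr P) (ub P)); split.
  by move=> P; case: ex_maxnP => m /ub.
move=> P Q lP kP PQ.
case: ex_maxnP => m /asboolP[vs [sz f Pvs]] _.
case: ex_maxnP => m' _ mx'; split.
  by apply: mx'; apply/asboolP; exists vs; split=> // v /Pvs /PQ.
move=> e; subst m'; move=> x Qx.
have hx : h x \in <<map h vs>>%VS.
  apply/negP => /negP nin; have : fr Q m.+1.
    apply/asboolP; exists (x :: vs); split; rewrite /= ?sz ?free_cons ?nin //.
    by move=> v; rewrite inE => /orP[/eqP->|/Pvs /PQ].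
  by move=> /mx'; rewrite ltnn.
pose X := in_tuple (map h vs).
have hE : h x = \sum_(i < size (map h vs)) coord X i (h x) *: h vs`_i.
  rewrite {1}(coord_span (X := X) hx); apply: eq_bigr => i _.
  by rewrite /= (nth_map 0) // -(size_map h).
pose y := \sum_(i < size (map h vs)) coord X i (h x) *: vs`_i.
have Py : P y.
  apply: lin_closed_sum => // i; apply: Pvs; apply: mem_nth.
  by rewrite -(size_map h).
rewrite -[x](subrK y) -[x - y]scale1r; apply: lP.2 => //.
apply: kP; rewrite -scaleN1r addrC L scaleN1r /y lin_sum // -hE.
by rewrite addNr.
Qed.
End Codim.

Section Ideals.
Variables (k : fieldType) (A : algebra k).
Implicit Types (I J P M : ideal A).

Lemma ideal_lin_closed I : lin_closed I.
Proof.
by split=> [|c x y Ix Iy]; [exact: ideal0 | apply: idealD => //; exact: idealZ].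
Qed.

Lemma ideal_sum I (T : Type) (s : seq T) (Q : pred T) (F : T -> A) :
  (forall i, Q i -> I (F i)) -> I (\sum_(i <- s | Q i) F i).
Proof.
move=> h; elim/big_rec: _ => [|i x Qi Ix]; first exact: ideal0.
by apply: idealD => //; exact: h.
Qed.

Definition ideal_add I J : ideal A.
Proof.
apply: (@Ideal k A (fun x => exists a b, [/\ I a, J b & x = a + b])).
- by exists 0, 0; rewrite addr0; split=> //; exact: ideal0.
- move=> _ _ [a [b [Ia Jb ->]]] [c [d [Ic Jd ->]]]; exists (a + c), (b + d).
  by rewrite addrACA; split=> //; exact: idealD.
- move=> r _ [a [b [Ia Jb ->]]]; exists (r * a), (r * b).
  by rewrite mulrDr; split=> //; exact: idealMl.
- move=> r _ [a [b [Ia Jb ->]]]; exists (a * r), (b * r).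
  by rewrite mulrDl; split=> //; exact: idealMr.
Defined.

Lemma ideal_addl I J : I `<=` ideal_add I J.
Proof. by move=> x Ix; exists x, 0; rewrite addr0; split=> //; exact: ideal0. Qed.
Lemma ideal_addr I J : J `<=` ideal_add I J.
Proof. by move=> x Ix; exists 0, x; rewrite add0r; split=> //; exact: ideal0. Qed.

Lemma ideal_mul_in I J x y : I x -> J y -> ideal_mul I J (x * y).
Proof. by move=> Ix Jy K h; apply: h; exists x, y. Qed.
Lemma ideal_mul_min I J (K : ideal A) :
  (forall x y, I x -> J y -> K (x * y)) -> ideal_mul I J `<=` K.
Proof. by move=> h z; apply=> _ [x [y [Ix Jy ->]]]; exact: h. Qed.

Lemma prime_idealP P : is_prime_ideal P <->
  ~ P 1 /\ forall a b, (forall x, P (a * x * b)) -> P a \/ P b.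
Proof.
split=> -[P1 h]; split=> //; last first.
  move=> I J IJ; have [|nI] := pselect (I `<=` P); first by left.
  right=> b Jb; have [a [Ia nPa]] : exists a, I a /\ ~ P a.
    apply: contrapT => H; apply: nI => a Ia; apply: contrapT => nPa.
    by apply: H; exists a.
  by case: (h a b) => // x; apply: IJ; apply: ideal_mul_in => //; exact: idealMr.
move=> a b ab.
(* [I] is a two-sided ideal containing [a], and [J] is its right annihilator modulo [P], which
   contains [b]; their product lies in [P] by construction. *)
have [I HI] : exists I : ideal A, forall x, I x <-> forall y, P (x * y * b).
  unshelve eexists (@Ideal k A (fun x => forall y, P (x * y * b)) _ _ _ _) => //.
  - by move=> y; rewrite !mul0r; exact: ideal0.
  - by move=> x y Hx Hy z; rewrite !mulrDl; exact: idealD.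
  - by move=> c x Hx z; rewrite -!mulrA; apply: idealMl; rewrite mulrA.
  - by move=> c x Hx z; rewrite -(mulrA x).
have [J HJ] : exists J : ideal A, forall y, J y <-> forall x, I x -> P (x * y).
  unshelve eexists (@Ideal k A (fun y => forall x, I x -> P (x * y)) _ _ _ _) => //.
  - by move=> y _; rewrite mulr0; exact: ideal0.
  - by move=> x y Hx Hy z Iz; rewrite mulrDr; apply: idealD; [exact: Hx|exact: Hy].
  - by move=> c x Hx z Iz; rewrite mulrA; apply: Hx; exact: idealMr.
  - by move=> c x Hx z Iz; rewrite mulrA; apply: idealMr; exact: Hx.
have [IP|JP] := h I J (ideal_mul_min (fun x y Ix Jy => (HJ y).1 Jy x Ix)).
  by left; apply: IP; apply/HI.
by right; apply: JP; apply/HJ => x /HI/(_ 1); rewrite mulr1.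
Qed.

Lemma maximal_prime M : is_maximal_ideal M -> is_prime_ideal M.
Proof.
move=> [M1 mx]; split=> // I J IJ.
have H (K : ideal A) : ~ K `<=` M -> exists a b, [/\ K a, M b & 1 = a + b].
  move=> nK; apply: contrapT => h; apply: nK => x Kx.
  by apply: (mx (ideal_add K M) (@ideal_addr K M) _ x) => //; exact: ideal_addl.
have [|/H[a [b [Ia Mb e]]]] := pselect (I `<=` M); first by left.
have [|/H[c [d [Jc Md e']]]] := pselect (J `<=` M); first by right.
exfalso; apply: M1; rewrite -[1]mulr1 {1}e e' mulrDl !mulrDr.
apply: idealD; [apply: idealD | apply: idealD].
- by apply: IJ; exact: ideal_mul_in.
- exact: idealMl.
- exact: idealMr.
- exact: idealMr.
Qed.

Lemma maximal_above J : ~ J 1 -> exists M, is_maximal_ideal M /\ J `<=` M.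
Proof.
move=> J1; pose T := {K : ideal A | J `<=` K /\ ~ K 1}.
pose R (K L : T) := `[< sval K `<=` sval L >].
have tJ : T := exist _ J (conj (fun x h => h) J1).
have [||F Ftot|[M [JM M1]] mx] := @ZL_preorder T tJ R.
- by move=> K; apply/asboolP.
- by move=> K L N /asboolP KL /asboolP LN; apply/asboolP => x /KL /LN.
- have [[K0 FK0]|F0] := pselect (exists K, F K); last first.
    by exists tJ => K FK; exfalso; apply: F0; exists K.
  have join K L : F K -> F L -> exists N, [/\ F N, sval K `<=` sval N & sval L `<=` sval N].
    move=> FK FL; have [/asboolP KL|/asboolP LK] := Ftot _ _ FK FL.
      by exists L; split=> // x.
    by exists K; split=> // x.
  unshelve eexists; first unshelve eexists
    (@Ideal k A (fun x => exists K, F K /\ sval K x) _ _ _ _).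
  + by exists K0; split=> //; exact: ideal0.
  + move=> x y [K [FK Kx]] [L [FL Ly]]; have [N [FN KN LN]] := join _ _ FK FL.
    by exists N; split=> //; apply: idealD; [exact: KN|exact: LN].
  + by move=> a x [K [FK Kx]]; exists K; split=> //; exact: idealMl.
  + by move=> a x [K [FK Kx]]; exists K; split=> //; exact: idealMr.
  + split=> [x Jx|[K [_ K1]]]; last by case: (svalP K).
    by exists K0; split=> //; case: (svalP K0) => + _; apply.
  + by move=> K FK; apply/asboolP => x Kx; exists K.
- exists M; split=> //; split=> // K MK K1.
  have JK : J `<=` K by move=> x /JM /MK.
  have := mx (exist _ K (conj JK K1)); rewrite /R /= => /(_ _)/asboolP; apply.
  exact/asboolP.
Qed.

Lemma quot_eq0 I x : quot_pi I x = 0 :> quot I <-> I x.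
Proof.
rewrite -(lin0 (quot_pi_linear I)) -[x in X in _ <-> X]subr0.
exact: quot_piP.
Qed.

End Ideals.

Lemma prime_quot (k : fieldType) (A : algebra k) (P : ideal A) : is_prime_ideal P -> prime_algebra (quot P).
Proof.
move=> /prime_idealP[P1 h]; apply/(prime_idealP _); split=> /=.
  by rewrite -(quot_pi_monoid P).1 => /quot_eq0.
elim/quot_ind=> a; elim/quot_ind=> b H.
have [|Pa|Pb] := h a b; [|by left; apply/quot_eq0|by right; apply/quot_eq0].
by move=> x; apply/quot_eq0; rewrite !(quot_pi_monoid P).2; exact: H.
Qed.

Section PrimeAlgebra.
Variables (k : fieldType) (A : algebra k) (A_prime : prime_algebra A).

Lemma prime_nz : (1 : A) <> 0.
Proof. exact: A_prime.1. Qed.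

Lemma prime_mul (a b : A) : (forall x, a * x * b = 0) -> a = 0 \/ b = 0.
Proof. by have [_] := (prime_idealP (zero_ideal A)).1 A_prime; apply. Qed.

Lemma central_regular (z a : A) : central z -> z * a = 0 -> z = 0 \/ a = 0.
Proof.
move=> cz za; apply: prime_mul => x.
by rewrite cz -mulrA za mulr0.
Qed.

End PrimeAlgebra.

Lemma lin_dep (k : fieldType) (V : lmodType k) m n (h : V -> 'rV[k]_n) (x : 'I_m -> V) :
  linear h -> (n < m)%N ->
  exists c : 'I_m -> k, (exists i, c i != 0) /\ h (\sum_i c i *: x i) = 0.
Proof.
move=> L nm; pose M := \matrix_i h (x i).
have [u uM u0] : exists2 u : 'rV_m, u *m M = 0 & u != 0.
  apply: contrapT => H.
  have : row_free M.
    apply: inj_row_free => u uM; apply/eqP/negP => /negP u0.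
    by apply: H; exists u.
  by rewrite /row_free => /eqP e; have := rank_leq_col M; rewrite e leqNgt nm.
exists (u 0); split.
  apply: contrapT => H; move/negP: u0; apply; apply/eqP/rowP => i.
  rewrite mxE; apply/eqP/negP => /negP ui; apply: H; by exists i.
rewrite lin_sum // -[RHS]uM mulmx_sum_row.
by apply: eq_bigr => i _; rewrite rowK.
Qed.

(** * Finite-dimensional prime algebras are matrix algebras *)

Section PrimeFindim.
Variables (k : closedFieldType) (S : algebra k) (S_prime : prime_algebra S).
Variables (n : nat) (h : S -> 'rV[k]_n) (hL : linear h).
Hypothesis h_inj : forall x, h x = 0 -> x = 0.

Definition left_closed (L : set S) := lin_closed L /\ forall a x, L x -> L (a * x).

Lemma minimal_left_ideal : exists L, [/\ left_closed L, exists2 x, L x & x != 0 &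
  forall L', left_closed L' -> L' `<=` L -> (exists2 x, L' x & x != 0) -> L `<=` L'].
Proof.
have [mu [_ muP]] := codim_measure hL.
pose Q m := `[< exists L, [/\ left_closed L, exists2 x, L x & x != 0 & mu L = m] >].
have exQ : exists m, Q m.
  exists (mu setT); apply/asboolP; exists setT; split=> //.
  by exists 1 => //; apply/eqP/prime_nz.
case: (ex_minnP exQ) => m /asboolP[L [lL xL muL]] mn.
exists L; split=> // L' lL' L'L xL'.
have [] := muP L' L lL'.1 _ L'L; first by move=> x /h_inj ->; exact: lL'.1.1.
move=> le; apply; apply/eqP; rewrite eqn_leq le muL; apply: mn.
by apply/asboolP; exists L'.
Qed.

(* [e] generates a minimal left ideal, so [eSe] is a division algebra over the
   algebraically closed field [k]. *)
Lemma split_idempotent : exists e : S, [/\ e != 0, e * e = e &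
  forall s, exists c : k, e * s * e = c *: e].
Proof.
have [L [lL [x0 Lx0 x0n] Lmin]] := minimal_left_ideal.
(* Schur's lemma: the elements of [L] killed by right multiplication by [v] form a left ideal, which
   is 0 or [L] by minimality. *)
have annL (v : S) l0 : L l0 -> l0 * v != 0 -> forall l, L l -> l * v = 0 -> l = 0.
  move=> Ll0 l0v l Ll lv; apply: contrapT => ln.
  move/eqP: l0v; apply; pose L' := [set l | L l /\ l * v = 0].
  have : L `<=` L'.
    apply: Lmin.
    - split; first split.
      + by split; [exact: lL.1.1|rewrite mul0r].
      + move=> c x y [Lx xv] [Ly yv]; split; first exact: lL.1.2.
        by rewrite mulrDl -ascalerAl xv yv scaler0 addr0.
      + move=> a x [Lx xv]; split; first exact: lL.2.
        by rewrite -mulrA xv mulr0.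
    - by move=> x [].
    - by exists l => //; exact/eqP.
  by move=> /(_ _ Ll0)[].
have [s0 xs] : exists s, x0 * s * x0 != 0.
  apply: contrapT => H; have [] := prime_mul S_prime (a := x0) (b := x0).
  - by move=> s; apply/eqP/negP => /negP ?; apply: H; exists s.
  - exact/eqP.
  - exact/eqP.
pose x := s0 * x0; have Lx : L x by exact: lL.2.
have x0x : x0 * x != 0 by rewrite mulrA.
(* [L * x] is a nonzero left ideal inside [L], so it is [L] and contains [x]. Then [e * e - e] is
   killed by [x], hence zero. *)
have [e Le ex] : exists2 e, L e & e * x = x.
  pose L' := [set y | exists2 l, L l & y = l * x].
  have : L `<=` L'.
    apply: Lmin.
    - split; first split.
      + by exists 0; [exact: lL.1.1|rewrite mul0r].
      + move=> c _ _ [a La ->] [b Lb ->]; exists (c *: a + b); first exact: lL.1.2.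
        by rewrite mulrDl ascalerAl.
      + by move=> a _ [b Lb ->]; exists (a * b); [exact: lL.2|rewrite mulrA].
    - by move=> _ [l Ll ->]; exact: lL.2.
    - by exists (x0 * x) => //; exists x0.
  by move=> /(_ _ Lx)[e Le e1]; exists e.
have LB y z : L y -> L z -> L (y - z).
  by move=> Ly Lz; rewrite addrC -scaleN1r; exact: lL.1.2.
have ee : e * e = e.
  apply/eqP; rewrite -subr_eq0; apply/eqP; apply: (annL x x0) => //.
    by apply: LB => //; exact: lL.2.
  by rewrite mulrBl -mulrA !ex subrr.
have e0 : e != 0.
  apply/eqP => e0; move: x0x; rewrite -ex e0 mul0r mulr0 eqxx //.
exists e; split=> // s; pose u := e * s * e.
have Lu : L u by exact: lL.2.
have eu : e * u = u by rewrite /u !mulrA ee.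
have div v y : e * v = v -> v != 0 -> L y -> y * v = 0 -> y = 0.
  by move=> ev v0; apply: (annL v e) => //; rewrite ev.
pose pw i := iter i (GRing.mul u) e.
have epw i : e * pw i = pw i by case: i => [|i] //=; rewrite mulrA eu.
(* The value of [p] at [u] in the corner [eSe], whose unit is [e]. An annihilating polynomial exists
   by dimension; splitting off linear factors leaves [(u - a e) * ev q = 0] with [ev q] nonzero,
   which forces [u = a e]. *)
pose ev (p : {poly k}) := \sum_(i < size p) p`_i *: pw i.
have evE m (p : {poly k}) : (size p <= m)%N -> ev p = \sum_(i < m) p`_i *: pw i.
  move=> sm; rewrite /ev (big_ord_widen _ (fun i => p`_i *: pw i) sm) big_mkcond /=.
  apply: eq_bigr => i _; case: ltnP => // si; by rewrite nth_default // scale0r.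
have evX (q : {poly k}) a : ev (q * ('X - a%:P)) = (u - a *: e) * ev q.
  rewrite (evE (size q).+1); last first.
    apply: leq_trans (size_polyMleq _ _) _.
    by rewrite size_XsubC addn2.
  under eq_bigr do rewrite mulrBr coefB coefMX coefMC scalerBl.
  rewrite sumrB mulrBl; congr (_ - _).
    rewrite big_ord_recl /= scale0r add0r mulr_sumr.
    by apply: eq_bigr => i _; rewrite ascalerAr.
  rewrite big_ord_recr /= [q`_(size q)]nth_default // mul0r scale0r addr0.
  rewrite mulr_sumr; apply: eq_bigr => i _.
  by rewrite -ascalerAr -ascalerAl epw scalerA.
have eev (q : {poly k}) : e * ev q = ev q.
  rewrite mulr_sumr; apply: eq_bigr => i _; by rewrite -ascalerAr epw.
have [c [[i0 ci0] hc]] := lin_dep (fun i : 'I_n.+1 => pw i) hL (ltnSn n).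
pose p := \poly_(i < n.+1) c (inord i).
have p0 : p != 0.
  apply/eqP => /polyP/(_ i0); rewrite coef_poly ltn_ord coef0 inord_val => e1.
  by rewrite e1 eqxx in ci0.
have evp : ev p = 0.
  rewrite (evE n.+1) ?size_poly //; apply: h_inj; rewrite -[RHS]hc; congr h.
  by apply: eq_bigr => i _; rewrite coef_poly ltn_ord inord_val.
move: evp p0; have [m] := ubnP (size p); elim: m p => // m IH p szp evp p0.
have [sp|sp] := leqP (size p) 1.
  move: evp; rewrite (evE 1%N) // big_ord1 /= => /eqP.
  rewrite scaler_eq0 (negPf e0) orbF => /eqP c0.
  by move: p0; rewrite [p]size1_polyC // c0 eqxx.
have [a /factor_theorem[q pE]] := closed_rootP p (negbT (gtn_eqF sp)).
have q0 : q != 0 by apply: contra_neq p0 => q0; rewrite pE q0 mul0r.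
have [evq|evq] := eqVneq (ev q) 0.
  apply: (IH q) => //; move: szp; rewrite pE size_Mmonic ?monicXsubC //.
  by rewrite size_XsubC addn2.
exists a; apply/eqP; rewrite -subr_eq0; apply/eqP; apply: (div (ev q)) => //.
  by apply: LB => //; rewrite -[_ *: _]addr0; apply: lL.1.2 => //; exact: lL.1.1.
by rewrite -evX -pE.
Qed.

(** The functional [b] with [e s e = b(s) e] pairs [eS] with [Se]. A maximal dual system [f], [g]
    for this pairing gives dual bases, that is [u = 1] below, and [b (g i * s * f j)] is the matrix
    of left multiplication by [s] on [Se]. *)
Lemma prime_findim_matrix : exists m (psi : S -> 'M[k]_m),
  [/\ (0 < m)%N, linear psi, monoid_morphism psi,
      forall X, exists x, psi x = X & forall x, psi x = 0 -> x = 0].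
Proof.
have [e [e0 ee /choice[b bP]]] := split_idempotent.
have sc_inj (x y : k) : x *: e = y *: e -> x = y.
  move=> /eqP; rewrite -subr_eq0 -scalerBl scaler_eq0 (negPf e0) orbF subr_eq0.
  by move/eqP.
have bL c x y : b (c *: x + y) = c * b x + b y.
  apply: sc_inj; rewrite -bP mulrDr mulrDl -ascalerAr -ascalerAl !bP.
  by rewrite scalerDl scalerA.
have bM x y : b (x * e * y) = b x * b y.
  by apply: sc_inj; rewrite -bP -scalerA -(bP y) -(mulrA e y) ascalerAl -(bP x) !mulrA.
have b0 : b 0 = 0 by apply: sc_inj; rewrite -bP mulr0 mul0r scale0r.
have bLin : linear (b : S -> k^o) by move=> c x y; rewrite bL.
have bD x y : b (x + y) = b x + b y by exact: (linD _ _ bLin).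
have bZ c x : b (c *: x) = c * b x by exact: (linZ _ _ bLin).
have bB x y : b (x - y) = b x - b y by rewrite bD -scaleN1r bZ mulN1r.
have bS I (r : seq I) (F : I -> S) : b (\sum_(i <- r) F i) = \sum_(i <- r) b (F i).
  exact: (linD_sum _ _ bLin).
pose Q m := `[< exists f g : nat -> S, forall i j, (i < m)%N -> (j < m)%N ->
  b (g i * f j) = (i == j)%:R >].
have exQ : exists m, Q m by exists 0%N; apply/asboolP; exists (fun=> 0), (fun=> 0).
(* The elements [f i * e] are independent: multiplying a relation by [e * g i] on the left isolates
   its [i]-th coefficient. *)
have ubQ m : Q m -> (m <= n)%N.
  move=> /asboolP[f [g fg]]; rewrite leqNgt; apply/negP => nm.
  have [c [[i ci]]] := lin_dep (fun i : 'I_m => f i * e) hL nm.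
  move=> /h_inj /(congr1 (GRing.mul (e * g i))).
  rewrite mulr0 mulr_sumr (eq_bigr (fun j : 'I_m => (c j * (i == j)%:R) *: e)).
    rewrite -scaler_suml (bigD1 i) //= eqxx mulr1 big1 => [|j ji].
      by move/eqP; rewrite addr0 scaler_eq0 (negPf ci) (negPf e0).
    by rewrite eq_sym (negPf ji) mulr0.
  by move=> j _; rewrite -ascalerAr !mulrA -(mulrA e) bP fg // scalerA.
case: (ex_maxnP exQ ubQ) => m /asboolP[f [g fg]] mx.
pose u := \sum_(i < m) f i * e * g i.
have bu x y : b (x * u * y) = \sum_(i < m) b (x * f i) * b (g i * y).
  rewrite mulr_sumr mulr_suml bS; apply: eq_bigr => i _.
  by rewrite -bM !mulrA.
(* Otherwise [s' = s - u s] is orthogonal to all the [g i] but not to everything, by primeness. A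
   Gram-Schmidt step then extends the dual system by a multiple of [s'] and a corrected [t]. *)
have use s : u * s * e = s * e.
  apply: contrapT => ne; pose s' := s - u * s.
  have [t bts] : exists t, b (t * s') != 0.
    apply: contrapT => H; have [] := prime_mul S_prime (a := e) (b := s' * e).
    - move=> t; rewrite mulrA -(mulrA e) bP; apply/eqP/negP => /negP.
      rewrite scaler_eq0 negb_or => /andP[bt _]; apply: H; by exists t.
    - exact/eqP.
    - by move=> /eqP; rewrite mulrBl subr_eq0 => /eqP ?; apply: ne.
  have gs i : (i < m)%N -> b (g i * s') = 0.
    move=> im; rewrite mulrBr bB -[u * s]mul1r -{1}[g i]mulr1 !mulrA mulr1.
    rewrite bu (bigD1 (Ordinal im)) //= fg // eqxx mul1r big1 ?addr0 ?subrr //.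
    move=> j ji; rewrite fg // (_ : _ == _ = false) ?mul0r //.
    by apply/eqP => ij; move/eqP: ji; apply; apply: val_inj.
  have : Q m.+1.
    apply/asboolP.
    exists (fun i => if (i < m)%N then f i else (b (t * s'))^-1 *: s').
    exists (fun i => if (i < m)%N then g i else
       t - \sum_(j < m) b (t * f j) *: g j) => i j.
    have lastm i' : (i' < m.+1)%N -> (i' < m)%N = false -> i' = m.
      by rewrite ltnS leq_eqVlt => /orP[/eqP->//|->].
    move=> im jm; case: ifP => im'; case: ifP => jm'.
    - exact: fg.
    - rewrite -ascalerAr bZ gs // mulr0 (lastm _ jm jm').
      by rewrite ltn_eqF.
    - rewrite mulrBl bB mulr_suml bS (bigD1 (Ordinal jm')) //= -ascalerAl bZ fg //.
      rewrite eqxx mulr1 big1 ?addr0 => [|l lj].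
        by rewrite subrr (lastm _ im im') gtn_eqF.
      rewrite -ascalerAl bZ fg // (_ : _ == _ = false) ?mulr0 //.
      by apply/eqP => ij; move/eqP: lj; apply; apply: val_inj.
    - rewrite (lastm _ im im') (lastm _ jm jm') eqxx -ascalerAr bZ mulrBl bB.
      rewrite mulr_suml bS big1 ?subr0 ?mulVf // => l _.
      by rewrite -ascalerAl bZ gs // mulr0.
  by move=> /mx; rewrite ltnn.
have u1 : u = 1.
  have [] := prime_mul S_prime (a := 1 - u) (b := e).
  - by move=> x; rewrite mulrBl mulrBl mul1r use subrr.
  - by move/eqP; rewrite subr_eq0 => /eqP.
  - by move/eqP; rewrite (negPf e0).
have b1 x y : b (x * y) = \sum_(i < m) b (x * f i) * b (g i * y).
  by rewrite -bu u1 mulr1.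
exists m, (fun s => \matrix_(i < m, j < m) b (g i * s * f j)); split.
- rewrite lt0n; apply/eqP => m0; have := prime_nz S_prime.
  by rewrite -u1 /u m0 big_ord0.
- move=> c x y; apply/matrixP => i j.
  by rewrite !mxE mulrDr mulrDl -ascalerAr -ascalerAl bL.
- split; first by apply/matrixP => i j; rewrite !mxE mulr1 fg.
  move=> x y; apply/matrixP => i j; rewrite !mxE.
  rewrite mulrA -(mulrA (g i * x)) b1; apply: eq_bigr => l _.
  by rewrite !mxE mulrA.
- move=> X; exists (\sum_i \sum_j X i j *: (f i * e * g j)).
  apply/matrixP => p q; rewrite mxE mulr_sumr mulr_suml bS.
  rewrite (bigD1 p) //= [X in _ + X]big1 ?addr0 => [|i ip].
    rewrite mulr_sumr mulr_suml bS (bigD1 q) //= [X in _ + X]big1 ?addr0 => [|j jq].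
      by rewrite -ascalerAr -ascalerAl bZ !mulrA -(mulrA _ (g q)) bM !fg // !eqxx !mulr1.
    rewrite -ascalerAr -ascalerAl bZ !mulrA -(mulrA _ (g j)) bM !fg //.
    by rewrite (negPf (jq : nat_of_ord j != q)) !mulr0.
  rewrite mulr_sumr mulr_suml bS big1 // => j _.
  rewrite -ascalerAr -ascalerAl bZ !mulrA -(mulrA _ (g j)) bM !fg //.
  by rewrite eq_sym (negPf (ip : nat_of_ord i != p)) mul0r mulr0.
- move=> x /matrixP X0; rewrite -[x]mul1r -[1 * x]mulr1 -u1 mulr_suml mulr_suml.
  rewrite big1 // => i _; rewrite mulr_sumr big1 // => j _.
  have := X0 i j; rewrite !mxE => X0'; rewrite !mulrA.
  have -> : f i * e * g i * x * f j * e * g j = f i * (e * (g i * x * f j) * e) * g j.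
    by rewrite !mulrA.
  by rewrite bP X0' scale0r mulr0 mul0r.
Qed.
End PrimeFindim.

(** * Cofinite ideals, their powers and the maximal ideals above them *)

Section Cofinite.
Variables (k : fieldType) (A : algebra k).
Implicit Types (I J K N : ideal A).

(** The linear map need not be onto, so [n] is only an upper bound of the codimension and serves for
    every larger ideal as well. *)
Definition cofinite n (J : set A) :=
  exists h : A -> 'rV[k]_n, linear h /\ forall x, h x = 0 <-> J x.

Lemma findim_cofinite J : findim (quot J) <-> exists n, cofinite n J.
Proof.
split=> [[n [[f lf bf]]]|[n [h [hL hJ]]]].
  exists n, (fun x => f (quot_pi J x)); split.
    by move=> c x y; rewrite quot_pi_linear lf.
  move=> x; split=> [e|Jx].
    by apply/quot_eq0; apply: (bij_inj bf); rewrite e (lin0 lf).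
  by have /quot_eq0 -> := Jx; exact: lin0.
pose g (q : quot J) := h (repr (q : quot_sort J)).
have gE x : g (quot_pi J x) = h x.
  apply/eqP; rewrite -subr_eq0 -scaleN1r addrC -hL scaleN1r addrC; apply/eqP.
  exact/hJ/quot_repr.
apply: (@findim_inj _ _ n g) => [c|].
  elim/quot_ind=> x; elim/quot_ind=> y.
  by rewrite -(quot_pi_linear J) !gE hL.
elim/quot_ind=> x; elim/quot_ind=> y; rewrite !gE => e.
apply/quot_piP/hJ; rewrite -scaleN1r addrC hL scaleN1r e addNr //.
Qed.

Lemma cofinite_sup n J K : J `<=` K -> cofinite n J -> cofinite n K.
Proof.
move=> JK [h [hL hJ]].
pose fr m := `[< exists vs : seq A,
  [/\ size vs = m, free (map h vs) & forall v, v \in vs -> K v] >].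
have exfr : exists m, fr m.
  by exists 0%N; apply/asboolP; exists [::]; split=> //; exact: nil_free.
have ub m : fr m -> (m <= n)%N.
  move=> /asboolP[vs [<- f _]]; rewrite -(size_map h).
  move: f; rewrite /free => /eqP <-.
  by apply: leq_trans (dimvS (subvf _)) _; rewrite dimvf /dim /= mul1n.
case: (ex_maxnP exfr ub) => m /asboolP[vs [sz f Kvs]] mx.
pose U := <<map h vs>>%VS.
have hU x : K x -> h x \in U.
  move=> Kx; apply/negP => /negP nin; have : fr m.+1.
    apply/asboolP; exists (x :: vs); split; rewrite /= ?sz ?free_cons ?nin //.
    by move=> v; rewrite inE => /orP[/eqP->|/Kvs].
  by move=> /mx; rewrite ltnn.
(* Following [h] by a projection with kernel [U], the span of [h(K)], enlarges the kernel to [K] and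
   keeps the target. *)
exists (fun x => h x - projv U (h x)); split.
  move=> c x y; rewrite hL linearP scalerBr addrACA opprD //.
move=> x; split=> [/eqP|/hU hx]; last by rewrite projv_id // subrr.
rewrite subr_eq0 => /eqP hx; have {hx} : h x \in U by rewrite hx memv_proj.
pose X := in_tuple (map h vs) => hx.
pose y := \sum_(i < size (map h vs)) coord X i (h x) *: vs`_i.
have hE : h x = h y.
  rewrite lin_sum // {1}(coord_span (X := X) hx); apply: eq_bigr => i _.
  by rewrite /= (nth_map 0) // -(size_map h).
have Ky : K y.
  apply: ideal_sum => i _; apply: idealZ; apply: Kvs; apply: mem_nth.
  by rewrite -(size_map h).
rewrite -[x](subrK y); apply: idealD => //; apply/JK/hJ.
by rewrite -scaleN1r addrC hL scaleN1r hE addNr.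
Qed.

Lemma ideal_powX N x n : N x -> ideal_pow N n (x ^+ n).
Proof. by move=> Nx; elim: n => [|n IH] //; rewrite exprS; exact: ideal_mul_in. Qed.

Lemma ideal_powD_in N i j x y :
  ideal_pow N i x -> ideal_pow N j y -> ideal_pow N (i + j) (x * y).
Proof.
elim: i x y => [|i IH] x y Nx Ny; first exact: idealMl.
have [K HK] : exists K : ideal A, forall x, K x <-> forall y, ideal_pow N j y ->
    ideal_pow N (i.+1 + j) (x * y).
  unshelve eexists (@Ideal k A (fun x => forall y, ideal_pow N j y ->
    ideal_pow N (i.+1 + j) (x * y)) _ _ _ _) => //
    [z _|a b Ka Kb z Nz|a b Kb z Nz|a b Kb z Nz].
  - by rewrite mul0r; exact: ideal0.
  - by rewrite mulrDl; apply: idealD; [exact: Ka|exact: Kb].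
  - by rewrite -mulrA; apply: idealMl; exact: Kb.
  - by rewrite -mulrA; apply: Kb; exact: idealMl.
suff : ideal_mul N (ideal_pow N i) `<=` K by move=> /(_ _ Nx)/HK; apply.
apply: ideal_mul_min => a b Na Nb; apply/HK => z Nz; rewrite -mulrA.
by apply: ideal_mul_in => //; exact: IH.
Qed.

Lemma ideal_powD_mul N i j :
  ideal_pow N (i + j) `<=` ideal_mul (ideal_pow N i) (ideal_pow N j).
Proof.
elim: i => [|i IH].
  by move=> x Nx; rewrite -[x]mul1r; exact: ideal_mul_in.
have [K HK] : exists K : ideal A, forall y, K y <-> forall x, N x ->
    ideal_mul (ideal_pow N i.+1) (ideal_pow N j) (x * y).
  unshelve eexists (@Ideal k A (fun y => forall x, N x ->
    ideal_mul (ideal_pow N i.+1) (ideal_pow N j) (x * y)) _ _ _ _) => //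
    [z _|a b Ka Kb z Nz|a b Kb z Nz|a b Kb z Nz].
  - by rewrite mulr0; exact: ideal0.
  - by rewrite mulrDr; apply: idealD; [exact: Ka|exact: Kb].
  - by rewrite mulrA; apply: Kb; exact: idealMr.
  - by rewrite mulrA; apply: idealMr; exact: Kb.
apply: ideal_mul_min => x y Nx /IH; suff KP : ideal_mul (ideal_pow N i) (ideal_pow N j) `<=` K.
  by move=> /KP/HK; apply.
apply: ideal_mul_min => a b Na Nb; apply/HK => z Nz; rewrite mulrA.
by apply: ideal_mul_in => //; exact: ideal_mul_in.
Qed.
End Cofinite.

(** A presentation of [A/M] as a full matrix algebra; [0 < m] excludes the zero quotient. In the
    setting of the theorem every maximal ideal has one, by [maximal_mx_rep]. *)
Definition mx_rep (k : fieldType) (A : algebra k) (M : set A) m (psi : A -> 'M[k]_m) :=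
  [/\ (0 < m)%N, linear psi, monoid_morphism psi,
      forall X, exists x, psi x = X & forall x, psi x = 0 <-> M x].

Section MxRep.
Variables (k : fieldType) (A : algebra k) (M : ideal A) (m : nat) (psi : A -> 'M[k]_m).
Hypothesis psiM : mx_rep M psi.

Lemma mx_rep_maximal : is_maximal_ideal M.
Proof.
case: psiM => m0 L [p1 pM] sj kM; split.
  move=> /kM; rewrite p1 => /matrixP/(_ (Ordinal m0) (Ordinal m0))/eqP.
  by rewrite !mxE eqxx oner_eq0.
move=> K MK K1 x Kx; apply: contrapT => nMx; apply: K1.
have [i [j nz]] : exists i j, psi x i j != 0.
  apply: contrapT => H; apply: nMx; apply/kM/matrixP => i j; rewrite mxE.
  by apply/eqP/negP => /negP nz; apply: H; exists i, j.
have /choice[y ly] (p : 'I_m) : exists y, psi y = (psi x i j)^-1 *: delta_mx p i.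
  exact: sj.
have /choice[z lz] (p : 'I_m) : exists z, psi z = delta_mx j p by exact: sj.
(* Matrix units move the nonzero entry of [psi x] to every diagonal position, so that [psi w = 1]
   although [w] lies in [K]. *)
pose w := \sum_p y p * x * z p.
have Kw : K w by apply: ideal_sum => p _; apply: idealMr; exact: idealMl.
have : M (1 - w).
  apply/kM; rewrite (linD _ _ L) -scaleN1r (linZ _ _ L) p1 scaleN1r.
  rewrite (linD_sum _ _ L); apply/eqP; rewrite subr_eq0; apply/eqP.
  apply/matrixP => a b; rewrite summxE mxE (bigD1 a) //= big1 ?addr0 => [|p pa].
    rewrite !pM ly lz -!mulmxE -!scalemxAl !mxE (bigD1 j) //= big1 ?addr0 => [|l lj].
      rewrite !mxE eqxx (bigD1 i) //= big1 ?addr0 => [|l li].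
        rewrite !mxE !eqxx mul1r /= [b == a]eq_sym; case: (a == b) => /=.
          by rewrite mulr1 mulVf.
        by rewrite !mulr0.
      by rewrite !mxE (negPf li) andbF mul0r.
    by rewrite !mxE (negPf lj) mulr0.
  rewrite !pM ly lz -!mulmxE -!scalemxAl !mxE big1 ?mulr0 // => l _.
  rewrite !mxE big1 ?mul0r // => q _.
  by rewrite !mxE eq_sym (negPf pa) mul0r.
by move=> /MK K1w; rewrite -[1](subrK w); exact: idealD.
Qed.

Lemma mx_rep_central z : central z -> exists c : k, psi z = c%:M.
Proof.
case: psiM => m0 L [p1 pM] sj kM cz.
have comm X : psi z *m X = X *m psi z.
  by have [x <-] := sj X; rewrite !mulmxE -!pM cz.
pose o := Ordinal m0; exists (psi z o o); apply/matrixP => i j.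
have /matrixP/(_ i o) := comm (delta_mx j o).
rewrite !mxE (bigD1 j) //= big1 => [|l lj]; last by rewrite !mxE (negPf lj) mulr0.
rewrite mxE !eqxx mulr1 addr0 => ->; rewrite (bigD1 o) //= big1 => [|l lo].
  by rewrite mxE eqxx andbT addr0; case: eqP; rewrite ?mul1r // mul0r.
by rewrite mxE (negPf lo) andbF mul0r.
Qed.
End MxRep.

Section CofiniteClosed.
Variables (k : closedFieldType) (A : algebra k).
Implicit Types (I J K N P : ideal A).

Lemma prime_cofinite_mx_rep n P : is_prime_ideal P -> cofinite n P ->
  exists m (psi : A -> 'M[k]_m), mx_rep P psi.
Proof.
move=> pP [h [hL hP]].
pose g (q : quot P) := h (repr (q : quot_sort P)).
have gE x : g (quot_pi P x) = h x.
  apply/eqP; rewrite -subr_eq0 -scaleN1r addrC -hL scaleN1r addrC; apply/eqP.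
  exact/hP/quot_repr.
have gL : linear g.
  move=> c; elim/quot_ind=> x; elim/quot_ind=> y.
  by rewrite -(quot_pi_linear P) !gE hL.
have gi x : g x = 0 -> x = 0.
  by elim/quot_ind: x => x; rewrite gE => /hP /quot_eq0.
have [m [psi [m0 L [p1 pM] sj kM]]] := prime_findim_matrix (prime_quot pP) gL gi.
exists m, (fun x => psi (quot_pi P x)); split=> //.
- by move=> c x y; rewrite quot_pi_linear L.
- split; first by rewrite (quot_pi_monoid P).1.
  by move=> x y; rewrite (quot_pi_monoid P).2.
- by move=> X; have [] := sj X; elim/quot_ind=> x <-; exists x.
- move=> x; split=> [/kM/quot_eq0 //|/quot_eq0 ->]; exact: lin0.
Qed.

(* An ideal contained in all the maximal ideals above J is nilpotent modulo J:
   otherwise some power N^i is idempotent modulo J, and an ideal maximal among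
   those above J not containing N^i is prime, hence maximal. *)
Lemma cofinite_radical_pow n J N : cofinite n J ->
  (forall M, is_maximal_ideal M -> J `<=` M -> N `<=` M) -> ideal_pow N n `<=` J.
Proof.
move=> cJ NM; have [h [hL hJ]] := cJ; have [mu [mun muP]] := codim_measure hL.
pose Q i := ideal_add (ideal_pow N i) J.
have kQ (K : ideal A) : J `<=` K -> forall x, h x = 0 -> K x by move=> JK x /hJ /JK.
have QS i : Q i.+1 `<=` Q i.
  move=> _ [a [b [Na Jb ->]]]; exists a, b; split=> //.
  exact: (ideal_powS (leqnSn i)).
(* The measure is at most [n], so one of the [n + 1] inclusions with [i <= n] is an equality; this
   is where the exponent [n] of the statement comes from. *)
have [i [ilen st]] : exists i, (i <= n)%N /\ Q i `<=` Q i.+1.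
  apply: contrapT => H.
  have lt i : (i <= n)%N -> (mu (Q i.+1) < mu (Q i))%N.
    move=> ilen; have [le eq] := muP _ _ (ideal_lin_closed (Q i.+1))
      (kQ _ (@ideal_addr _ _ (ideal_pow N i.+1) J)) (QS i).
    rewrite ltn_neqAle le andbT; apply/eqP => /eq QQ; apply: H; by exists i.
  have le i : (i <= n.+1)%N -> (mu (Q i) + i <= n)%N.
    elim: i => [|i IH] ii; first by rewrite addn0 mun.
    by apply: leq_trans (IH (ltnW ii)); rewrite addnS -addSn leq_add2r lt.
  by have := le _ (leqnn _); rewrite addnS ltnNge leq_addl.
have stab l : ideal_pow N i `<=` ideal_add (ideal_pow N (i + l)) J.
  elim: l => [|l IH]; first by rewrite addn0; exact: ideal_addl.
  move=> x Nx; have [a [b [Na Jb ->]]] := st x (ideal_addl J Nx).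
  apply: idealD; last exact: ideal_addr.
  move: a Na; apply: ideal_mul_min => u v Nu /IH[c [e [Nc Je ->]]].
  exists (u * c), (u * e); rewrite mulrDr addnS; split=> //; last exact: idealMl.
  exact: ideal_mul_in.
suff NiJ : ideal_pow N i `<=` J by move=> x /(ideal_powS ilen) /NiJ.
apply: contrapT => nNJ.
pose T m := `[< exists K : ideal A, [/\ J `<=` K, ~ ideal_pow N i `<=` K & mu K = m] >].
have exT : exists m, T m by exists (mu J); apply/asboolP; exists J; split=> // x.
have ubT m : T m -> (m <= n)%N by move=> /asboolP[K [_ _ <-]].
case: (ex_maxnP exT ubT) => m /asboolP[K [JK NK muK]] mx.
have big (L : ideal A) : ~ L `<=` K -> ideal_pow N i `<=` ideal_add L K.
  move=> LK; apply: contrapT => nN; apply: LK => x Lx.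
  have KL := @ideal_addr _ _ L K.
  have [le eq] := muP K _ (ideal_lin_closed K) (kQ _ JK) KL.
  apply: eq; last exact: ideal_addl.
  apply/eqP; rewrite eqn_leq le muK; apply: mx; apply/asboolP.
  by exists (ideal_add L K); split=> // y /JK; exact: ideal_addr.
have pK : is_prime_ideal K.
  split=> [K1|I1 I2 I12]; first by apply: NK => x _; rewrite -[x]mulr1; exact: idealMl.
  have [|/big N1] := pselect (I1 `<=` K); first by left.
  have [|/big N2] := pselect (I2 `<=` K); first by right.
  exfalso; apply: NK => x /(stab i)[a [b [+ Jb ->]]]; move=> /ideal_powD_mul Na.
  apply: idealD; last exact: JK.
  move: a Na; apply: ideal_mul_min => u v /N1[c [e [Ic Ke ->]]] /N2[f [g [If Kg ->]]].
  rewrite mulrDl !mulrDr; apply: idealD; apply: idealD.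
  - by apply: I12; exact: ideal_mul_in.
  - exact: idealMl.
  - exact: idealMr.
  - exact: idealMr.
have [q [psi psiK]] := prime_cofinite_mx_rep pK (cofinite_sup JK cJ).
have NsubK := NM _ (mx_rep_maximal psiK) JK.
apply: NK => x Ix; have [a [b [Na Jb ->]]] := st x (ideal_addl J Ix).
apply: idealD; last exact: JK.
move: a Na; apply: ideal_mul_min => u v Nu _; apply: idealMr; exact: NsubK.
Qed.
End CofiniteClosed.

(** * Points of subalgebras of a domain *)

Section PointExtension.
Variables (k : closedFieldType) (D : idomainType).

(* The image of [pi] is a [k]-subalgebra of D having, for each nonzero element,
   a [k]-point at which it does not vanish. *)
Definition enough_points (A : comNzRingType) (kappa : {rmorphism k -> A})
    (pi : {rmorphism A -> D}) :=
  forall e, pi e != 0 -> exists chi : {rmorphism A -> k},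
    [/\ forall c, chi (kappa c) = c, forall a, pi a = 0 -> chi a = 0 & chi e != 0].

Section Step.
Variables (A : comNzRingType) (kappa : {rmorphism k -> A}) (pi : {rmorphism A -> D}).
Variable a : D.
Let ca : commr_rmorph pi a. Proof. by move=> x; exact: mulrC. Qed.
Let pia : {rmorphism {poly A} -> D} := horner_morph ca.
Let piaE p : pia p = (map_poly pi p).[a]. Proof. by []. Qed.
(** Degrees are those of the images over [D], since coefficients in the kernel of [pi] must count as
    zero. [red] is a step of pseudo-division: leading coefficients are multiplied by and never
    inverted. *)
Let sz (p : {poly A}) := size (map_poly pi p).
Let lc (p : {poly A}) := p`_(sz p).-1.
Let red (u v : {poly A}) := (lc v)%:P * u - (lc u)%:P * 'X^(sz u - sz v) * v.

Let lcE p : pi (lc p) = lead_coef (map_poly pi p).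
Proof. by rewrite lead_coefE coef_map. Qed.
Let lc_neq0 p : (0 < sz p)%N -> pi (lc p) != 0.
Proof. by rewrite lcE lead_coef_eq0 -size_poly_gt0. Qed.

Let sz_red u v : (0 < sz v)%N -> (sz v <= sz u)%N -> (sz (red u v) < sz u)%N.
Proof.
move=> v0 vu; have u0 := leq_trans v0 vu.
rewrite -(prednK u0) ltnS; apply/leq_sizeP => j.
rewrite coef_map /red /= coefB rmorphB -mulrA !coefCM coefXnM !rmorphM /= !lcE.
rewrite leq_eqVlt => /orP[/eqP<-|uj].
  rewrite ifF; last by apply/negbTE; lia.
  have -> : ((sz u).-1 - (sz u - sz v) = (sz v).-1)%N by lia.
  by rewrite -!coef_map -!lead_coefE mulrC subrr.
have uj' : (sz u <= j)%N by rewrite -(prednK u0).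
rewrite -coef_map nth_default // mulr0 sub0r; apply/eqP; rewrite oppr_eq0.
case: ltnP => jd; first by rewrite rmorph0 mulr0.
rewrite -coef_map [(map_poly _ _)`_ _]nth_default ?mulr0 //.
by rewrite -/(sz v); lia.
Qed.

Let sz_min (Q : {poly A} -> Prop) : (exists p, Q p) ->
  exists p, Q p /\ forall q, Q q -> (sz p <= sz q)%N.
Proof.
move=> [p Qp]; pose T n := `[< exists q, Q q /\ sz q = n >].
have exT : exists n, T n by exists (sz p); apply/asboolP; exists p.
case: (ex_minnP exT) => n /asboolP[q [Qq <-]] mn; exists q; split=> // r Qr.
by apply: mn; apply/asboolP; exists r.
Qed.

Let sz0 p : sz p = 0%N -> forall i, pi p`_i = 0.
Proof. by move=> /eqP; rewrite size_poly_eq0 => /eqP e i; rewrite -coef_map e coef0. Qed.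

Let redE u v : pia (red u v) =
  pi (lc v) * pia u - pi (lc u) * a ^+ (sz u - sz v) * pia v.
Proof.
rewrite /red rmorphB !rmorphM /= rmorphXn /=.
by rewrite !horner_morphC horner_morphX.
Qed.

(* Points lift along [A[X] -> D], ['X |-> a]: to any non-root if [a] is
   transcendental over the image of A, and otherwise to a root of the
   specialization of a polynomial of minimal degree killing [a]. *)
Lemma enough_points_poly :
  enough_points kappa pi -> enough_points (polyC \o kappa) pia.
Proof.
move=> ext q0 q0n.
pose Ann p := pia p = 0 /\ (0 < sz p)%N.
have point (chi : {rmorphism A -> k}) (t : k) (cc : forall c, chi (kappa c) = c) :
    (forall p, pia p = 0 -> (map_poly chi p).[t] = 0) -> (map_poly chi q0).[t] != 0 ->
    exists chi' : {rmorphism {poly A} -> k},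
    [/\ forall c, chi' ((polyC \o kappa) c) = c, forall p, pia p = 0 -> chi' p = 0
      & chi' q0 != 0].
  move=> H1 H2; have ct : commr_rmorph chi t by move=> x; exact: mulrC.
  exists (horner_morph ct : {rmorphism {poly A} -> k}); split=> // c.
  by rewrite /= horner_morphC.
have [[p0 Ap0]|nAnn] := pselect (exists p, Ann p); last first.
  have H p : pia p = 0 -> forall i, pi p`_i = 0.
    move=> pp; apply: sz0; apply/eqP; rewrite -leqn0 leqNgt; apply/negP => sp.
    by apply: nAnn; exists p.
  have [i qi] : exists i, pi q0`_i != 0.
    apply: contrapT => h; move/eqP: q0n; apply; rewrite piaE.
    suff -> : map_poly pi q0 = 0 by rewrite horner0.
    apply/polyP => i; rewrite coef_map coef0; apply/eqP/negP => /negP ?.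
    by apply: h; exists i.
  have [chi [cc ck ce]] := ext _ qi.
  have : map_poly chi q0 != 0.
    by apply: contraNneq ce => e; rewrite -coef_map e coef0.
  move=> /closed_nonrootP[t tn]; apply: (point chi t) => // p pp.
  suff -> : map_poly chi p = 0 by rewrite horner0.
  by apply/polyP => j; rewrite coef_map coef0; apply: ck; exact: H.
have [p [[pap szp] pmin]] := sz_min (ex_intro _ p0 Ap0).
have szp1 : (1 < sz p)%N.
  rewrite ltn_neqAle szp andbT; apply/eqP => e; move/eqP: pap; apply/negP.
  rewrite piaE; have := lc_neq0 szp; rewrite lcE [map_poly pi p]size1_polyC -/(sz p) -?e //.
  by rewrite lead_coefC hornerC.
have small q : pia q = 0 -> (sz q < sz p)%N -> forall i, pi q`_i = 0.
  move=> paq sq; apply: sz0; apply/eqP; rewrite -leqn0 leqNgt; apply/negP => s0.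
  by have := pmin q (conj paq s0); rewrite leqNgt sq.
(* In the algebraic case some multiple of [q0] takes at [a] the value of a nonzero constant [e], as
   a norm would. A point with [e] nonzero then has [q0] nonzero too. *)
have [e [en [g eg]]] : exists e, pi e != 0 /\ exists g, pia (e%:P - g * q0) = 0.
  pose Mul H := pia H != 0 /\ exists g, pia (H - g * q0) = 0.
  have MulM u v H : Mul H -> pia (u * v) = pia H -> pia v != 0.
    by move=> [Hn _] e; apply: contra_neq Hn => v0; rewrite -e rmorphM /= v0 mulr0.
  have [|H [[Hn [g Hg]] Hmin]] := sz_min (Q := Mul).
    by exists q0; split=> //; exists 1; rewrite mul1r subrr rmorph0.
  have szH : (0 < sz H)%N.
    rewrite lt0n; apply: contra_neq Hn => h0.
    rewrite piaE; suff -> : map_poly pi H = 0 by rewrite horner0.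
    by apply/polyP => i; rewrite coef_map coef0 /= sz0.
  have HE : pia H = pia g * pia q0.
    by apply/eqP; rewrite -subr_eq0 -rmorphM -rmorphB Hg.
  have [sH|sH] := leqP (sz H) 1.
    exists H`_0; have e1 : pia (H`_0)%:P = pia H.
      rewrite !piaE [map_poly pi H]size1_polyC // map_polyC /= hornerC coef_map //.
      by rewrite hornerC.
    split; first by rewrite -[pi _](horner_morphC ca) -/pia e1.
    by exists g; rewrite rmorphB /= e1 -rmorphB.
  have sHp : (sz H < sz p)%N.
    rewrite ltnNge; apply/negP => pH.
    have := Hmin (red H p); rewrite leqNgt sz_red //= => h; suff : false by [].
    apply: h; rewrite /Mul redE pap mulr0 subr0 mulf_neq0 ?lc_neq0 //; split=> //.
    exists ((lc p)%:P * g); rewrite rmorphB rmorphM /= redE pap mulr0 subr0 HE.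
    by rewrite rmorphM /= horner_morphC mulrA subrr.
  (* [F] is a pseudo-remainder of [p] by [H], and [F(a) = - G(a) H(a)]. If [G(a)] is nonzero, [F]
     contradicts the minimality of [H]; otherwise [G] is zero or at least as long as [p], and the
     sizes do not match. *)
  pose Lin F := exists c G, pi c != 0 /\ F = c%:P * p - G * H.
  have [|F [[c [G [cn FE]]] Fmin]] := sz_min (Q := Lin).
    by exists p, 1, 0; rewrite rmorph1 oner_neq0 mul1r mul0r subr0.
  have FH : (sz F < sz H)%N.
    rewrite ltnNge; apply/negP => HF.
    have := Fmin (red F H); rewrite leqNgt sz_red //= => h; suff : false by [].
    apply: h; exists (lc H * c), ((lc H)%:P * G + (lc F)%:P * 'X^(sz F - sz H)).
    rewrite rmorphM mulf_neq0 ?lc_neq0 //; split=> //.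
    by rewrite /red {1}FE mulrBr mulrDl opprD addrA polyCM !mulrA.
  have paF : pia F = - (pia G * pia H).
    by rewrite FE rmorphB !rmorphM /= -/pia pap mulr0 sub0r.
  have [G0|Gn] := eqVneq (pia G) 0; last first.
    have := Hmin F; rewrite leqNgt FH /= => h; suff : false by [].
    apply: h; rewrite /Mul paF oppr_eq0 mulf_neq0 //; split=> //.
    exists (- (G * g)); rewrite rmorphB rmorphM /= paF HE rmorphN rmorphM /=.
    by rewrite mulNr opprK mulrA addNr.
  exfalso; have szF : sz F = size (map_poly pi (c%:P * p) - map_poly pi (G * H)).
    by rewrite FE -rmorphB.
  have szc : size (map_poly pi (c%:P * p)) = sz p.
    by rewrite rmorphM /= map_polyC /= mul_polyC size_scale.
  have [Gz|Gnz] := eqVneq (map_poly pi G) 0.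
    move: szF; rewrite (rmorphM _ G H) /= Gz mul0r subr0 szc => e.
    by move: FH; rewrite e ltnNge (ltnW sHp).
  have := pmin G; rewrite /Ann lt0n size_poly_eq0 => /(_ (conj G0 Gnz)) szG.
  have szGH : size (map_poly pi (G * H)) = (sz G + sz H).-1.
    rewrite rmorphM size_mul //; by rewrite -size_poly_gt0.
  move: szF; rewrite -opprB size_polyN size_polyDl ?size_polyN ?szc ?szGH; lia.
(* The leading coefficient of [p] is kept nonzero so that the specialized [p] is not constant and
   has a root, and so that pseudo-division by [p] can be undone after specialization. *)
have [|chi [cc ck]] := ext (lc p * e).
  by rewrite rmorphM mulf_neq0 ?lc_neq0.
rewrite rmorphM mulf_eq0 negb_or => /andP[clc ce].
have : size (map_poly chi p) != 1.
  apply/eqP => s1; move/negP: clc; apply.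
  by rewrite /lc -coef_map nth_default // s1; lia.
move=> /closed_rootP[t /eqP rt].
have K q : pia q = 0 -> (map_poly chi q).[t] = 0.
  have [m] := ubnP (sz q); elim: m q => // m IH q szq paq.
  have [sqp|spq] := ltnP (sz q) (sz p).
    suff -> : map_poly chi q = 0 by rewrite horner0.
    by apply/polyP => j; rewrite coef_map coef0; apply: ck; exact: small.
  have := IH (red q p); rewrite redE paq pap !mulr0 subrr => /(_ _ erefl).
  rewrite /red rmorphB !rmorphM /= !map_polyC /= hornerD hornerN !hornerM rt mulr0 subr0.
  rewrite hornerC => h; have {h}/eqP := h (leq_trans (sz_red szp spq) szq).
  by rewrite mulf_eq0 (negPf clc) => /eqP.
apply: (point chi t) => //; apply: contraNneq ce => q00.
have := K _ eg; rewrite rmorphB rmorphM /= map_polyC /= hornerD hornerN hornerM q00.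
by rewrite mulr0 subr0 hornerC => ->.
Qed.
End Step.

Lemma enough_points_gen (iota : {rmorphism k -> D}) (s : seq D) :
  exists (A : comNzRingType) (kappa : {rmorphism k -> A}) (pi : {rmorphism A -> D}),
  [/\ forall c, pi (kappa c) = iota c, forall a, a \in s -> exists x, pi x = a
    & enough_points kappa pi].
Proof.
elim: s => [|a s [A [kappa [pi [pk ps ext]]]]].
  exists k, idfun, iota; split=> // e en; exists idfun; split=> //.
    by move=> c /eqP; rewrite fmorph_eq0 => /eqP.
  by apply: contra_neq en => /= ->; rewrite rmorph0.
have ca : commr_rmorph pi a by move=> x; exact: mulrC.
exists {poly A}, (polyC \o kappa), (horner_morph ca); split.
- by move=> c; rewrite /= horner_morphC pk.
- move=> b; rewrite inE => /orP[/eqP->|/ps[x <-]].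
    by exists 'X; exact: horner_morphX.
  by exists x%:P; exact: horner_morphC.
- exact: enough_points_poly.
Qed.
End PointExtension.

(** * Maximal ideals of prime algebras finite over their center *)

(* A copy of the center, whose integral domain structure is inferred from the
   proof of primeness. *)
Definition cdom (k : fieldType) (A : algebra k) (h : prime_algebra A) : Type :=
  alg_sort (center A).

Section CenterDomain.
Variables (k : fieldType) (A : algebra k) (A_prime : prime_algebra A).
Local Notation D := (cdom A_prime).

HB.instance Definition _ := GRing.PzRing.copy D (alg_sort (center A)).

Definition cval (z : D) : A := center_incl A z.

Lemma cval_inj : injective cval. Proof. exact: val_inj. Qed.
Lemma cval_central z : central (cval z).
Proof. by case: z => z zP; apply/asboolP. Qed.
Lemma cval_onto z : central z -> exists d, cval d = z.
Proof. by move=> cz; exists (@CenterElt k A z (introT (asboolP _) cz)). Qed.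
Lemma cvalD x y : cval (x + y) = cval x + cval y. Proof. by []. Qed.
Lemma cvalN x : cval (- x) = - cval x. Proof. by []. Qed.
Lemma cvalM x y : cval (x * y) = cval x * cval y. Proof. by []. Qed.
Lemma cval0 : cval 0 = 0. Proof. by []. Qed.
Lemma cval_sum (I : Type) (s : seq I) (P : pred I) (F : I -> D) :
  cval (\sum_(i <- s | P i) F i) = \sum_(i <- s | P i) cval (F i).
Proof. exact: (big_morph cval cvalD cval0). Qed.
Lemma cvalX x n : cval (x ^+ n) = cval x ^+ n.
Proof. by elim: n => // n IH; rewrite !exprS cvalM IH. Qed.

Let mulC : commutative (@GRing.mul D). Proof. exact: (@comalg_mulC k (center A)). Qed.
HB.instance Definition _ := GRing.PzRing_hasCommutativeMul.Build D mulC.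
Let nz : (1 : D) != 0.
Proof. by apply/eqP => /(congr1 cval); exact: prime_nz. Qed.
HB.instance Definition _ := GRing.PzSemiRing_isNonZero.Build D nz.

Let unit_ : {pred D} := fun x => `[< exists y, y * x = 1 >].
Let inv_ (x : D) : D := if unit_ x then xget 0 [set y | y * x = 1] else x.
Let mulVx : {in unit_, left_inverse 1 inv_ *%R}.
Proof.
move=> x xu; rewrite /inv_ /= [unit_ x]xu.
by case: xgetP => [y _ //|h]; move/asboolP: xu => -[y /h].
Qed.
Let unitPl (x y : D) : y * x = 1 -> unit_ x.
Proof. by move=> e; apply/asboolP; exists y. Qed.
Let inv_out : {in [predC unit_], inv_ =1 id}.
Proof. by move=> x nx; rewrite /inv_ ifN. Qed.
HB.instance Definition _ := GRing.ComNzRing_hasMulInverse.Build D mulVx unitPl inv_out.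

Let integral : GRing.integral_domain_axiom D.
Proof.
move=> x y /(congr1 cval) /(central_regular A_prime (cval_central x)).
by case=> e; apply/orP; [left | right]; apply/eqP/cval_inj.
Qed.
HB.instance Definition _ := GRing.ComUnitRing_isIntegral.Build D integral.

Lemma cval_regular (z : D) (a : A) : z != 0 -> cval z * a = 0 -> a = 0.
Proof.
move=> z0 /(central_regular A_prime (cval_central z))[] // e.
by move/eqP: z0; case; exact: cval_inj.
Qed.
Lemma cvalC (z : D) a : cval z * a = a * cval z.
Proof. exact: cval_central. Qed.

Definition cscal (c : k) : D := c *: (1 : center A).
Lemma cval_cscal c : cval (cscal c) = c *: (1 : A). Proof. by []. Qed.
Lemma cscalE c a : cval (cscal c) * a = c *: a.
Proof. by rewrite cval_cscal -ascalerAl mul1r. Qed.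
Let cscalB : {morph cscal : x y / x - y}.
Proof. by move=> x y; apply: cval_inj; rewrite cvalD cvalN !cval_cscal scalerBl. Qed.
Let cscalM : monoid_morphism cscal.
Proof.
split=> [|x y]; apply: cval_inj; first by rewrite cval_cscal scale1r.
by rewrite cvalM cscalE !cval_cscal scalerA.
Qed.
HB.instance Definition _ := GRing.isZmodMorphism.Build k D cscal cscalB.
HB.instance Definition _ := GRing.isMonoidMorphism.Build k D cscal cscalM.

Definition cindep r (t : 'I_r -> A) :=
  forall c : 'I_r -> D, \sum_i cval (c i) * t i = 0 -> forall i, c i = 0.

(** A maximal independent part of [s] spans [s] over the fraction field of the center; [c] clears
    the denominators, so this field is never formed. *)
Lemma generic_basis n (s : 'I_n -> A) : exists r (t : 'I_r -> A) (c : D),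
  [/\ c != 0, cindep t & forall i, exists l : 'I_r -> D,
    cval c * s i = \sum_j cval (l j) * t j].
Proof.
elim: n s => [|n IH] s.
  exists 0%N, (fun=> 0), 1; split=> [|c _ []//|[]//]; exact: oner_neq0.
have [r [t [c [c0 it st]]]] := IH (fun i => s (lift ord0 i)).
have [[z [z0 [l zl]]]|H] := pselect (exists z, z != 0 /\ exists l : 'I_r -> D,
    cval z * s ord0 = \sum_j cval (l j) * t j).
  exists r, t, (z * c); split=> [|//|i]; first exact: mulf_neq0.
  case: (unliftP ord0 i) => [j|] ->.
    have [m mE] := st j; exists (fun j => z * m j).
    rewrite cvalM -mulrA mE mulr_sumr; apply: eq_bigr => u _; by rewrite cvalM mulrA.
  exists (fun j => c * l j); rewrite mulrC cvalM -mulrA zl mulr_sumr.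
  by apply: eq_bigr => u _; rewrite cvalM mulrA.
pose t' (i : 'I_r.+1) := oapp t (s ord0) (unlift ord0 i).
have t'0 : t' ord0 = s ord0 by rewrite /t' unlift_none.
have t'S j : t' (lift ord0 j) = t j by rewrite /t' liftK.
have sumE (m : 'I_r.+1 -> D) : \sum_i cval (m i) * t' i =
    cval (m ord0) * s ord0 + \sum_j cval (m (lift ord0 j)) * t j.
  by rewrite big_ord_recl t'0; under eq_bigr do rewrite t'S.
exists r.+1, t', c; split=> // [m|i].
  rewrite sumE => /eqP; rewrite addr_eq0 -sumrN => /eqP e.
  have m0 : m ord0 = 0.
    apply/eqP/negP => /negP nz0; apply: H; exists (m ord0); split=> //.
    by exists (fun j => - m (lift ord0 j)); rewrite e; under [RHS]eq_bigr do rewrite cvalN mulNr.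
  move: e; rewrite m0 cval0 mul0r sumrN => /esym/eqP; rewrite oppr_eq0 => /eqP e i.
  by case: (unliftP ord0 i) => [j|] -> //; apply: (it (fun j => m (lift ord0 j))).
case: (unliftP ord0 i) => [j|] ->.
  have [l lE] := st j; exists (fun i => oapp l 0 (unlift ord0 i)).
  rewrite sumE unlift_none cval0 mul0r add0r lE; apply: eq_bigr => u _.
  by rewrite liftK.
exists (fun i => oapp (fun=> 0) c (unlift ord0 i)).
rewrite sumE unlift_none big1 ?addr0 // => u _; by rewrite liftK cval0 mul0r.
Qed.
End CenterDomain.

(** * Separation of elements by ideals of bounded codimension *)

Section SeparatingPoints.
Variables (k : closedFieldType) (A : algebra k) (A_prime : prime_algebra A).
Hypotheses (A_affine : affine A) (A_finite : module_finite_over_center A).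
Local Notation D := (cdom A_prime).

(* After inverting some nonzero c in the center, A is free over its center, the
   latter is finitely generated, and coordinates can be specialized at a point
   of this localization. *)
Lemma separating_cofinite_ideals :
  exists r, forall a : A, a <> 0 -> exists J : ideal A, ~ J a /\ cofinite r J.
Proof.
have [n [s sP]] := A_finite.
have [r [t [c [c0 it st]]]] := generic_basis A_prime s.
have /choice[Lam LamP] (x : A) : exists l : 'I_r -> D, cval c * x = \sum_j cval (l j) * t j.
  have [z [cz ->]] := sP x.
  have /choice[d dE] (i : 'I_n) : exists d : D, cval d = z i by exact: cval_onto.
  have /choice[m mE] := st.
  exists (fun j => \sum_i d i * m i j); rewrite mulr_sumr.
  under [RHS]eq_bigr do rewrite cval_sum mulr_suml.
  rewrite exchange_big /=; apply: eq_bigr => i _.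
  rewrite mulrA cvalC -mulrA mE -dE mulr_sumr; apply: eq_bigr => j _.
  by rewrite cvalM mulrA.
exists r => a an.
have [gens gensP] := A_affine.
(* The coordinates of these finitely many elements, together with [c], generate a subring of the
   center whose localization at [c] contains the coordinates of all of [A]. *)
pose xs := 1 :: gens ++ [seq t i * t j | i <- enum 'I_r, j <- enum 'I_r].
have [P [kappa [pi [pk ps ext]]]] := enough_points_gen
  (cscal A_prime : {rmorphism k -> D}) (c :: [seq Lam x j | x <- xs, j <- enum 'I_r]).
have [ga gaE] : exists g, pi g = c by apply: ps; rewrite mem_head.
have inP x j : x \in xs -> exists e, pi e = Lam x j.
  move=> xx; apply: ps; rewrite inE; apply/orP; right; apply: allpairs_f => //.
  by rewrite mem_enum.
have /choice[tau tauE] (p : 'I_r * 'I_r * 'I_r) : exists e, pi e = Lam (t p.1.1 * t p.1.2) p.2.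
  apply: inP; rewrite inE mem_cat; apply/orP; right; apply/orP; right.
  by apply: allpairs_f; rewrite mem_enum.
pose C (al : 'I_r -> P) : A := \sum_j cval (pi (al j)) * t j.
have CM (d : P) al : cval (pi d) * C al = C (fun j => d * al j).
  by rewrite mulr_sumr; apply: eq_bigr => j _; rewrite rmorphM cvalM mulrA.
have CD al be : C al + C be = C (fun j => al j + be j).
  by rewrite -big_split; apply: eq_bigr => j _; rewrite rmorphD cvalD mulrDl.
have CE al be : C al = C be -> forall j, pi (al j) = pi (be j).
  move=> /eqP; rewrite -subr_eq0 -sumrB => /eqP e j.
  apply/eqP; rewrite -subr_eq0; apply/eqP.
  apply: (it (fun j => pi (al j) - pi (be j))); rewrite -[RHS]e.
  by apply: eq_bigr => i _; rewrite cvalD cvalN mulrBl.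
(* [al] lifts the numerators of the coordinates of [x] over the denominator [c ^ N]. *)
pose Cs N x al := cval (pi ga) ^+ N * x = C al.
have CsS N x al : Cs N x al -> forall M, Cs (M + N)%N x (fun j => ga ^+ M * al j).
  by move=> e M; rewrite /Cs exprD -mulrA e -cvalX -rmorphXn CM.
have comm (N : nat) (x : A) : cval (pi ga) ^+ N * x = x * cval (pi ga) ^+ N.
  by rewrite -cvalX cvalC.
have CsD (e : k) N M x y al be : Cs N x al -> Cs M y be ->
    Cs (M + N)%N (e *: x + y) (fun j => kappa e * (ga ^+ M * al j) + ga ^+ N * be j).
  move=> /CsS /(_ M) ex /CsS /(_ N) ey; rewrite /Cs mulrDr -CD; congr (_ + _).
    by rewrite -ascalerAr ex -(CM (kappa e)) pk cscalE.
  by rewrite addnC ey.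
(* The extra factor of [c] is the denominator of the structure constants: [tau] lifts the
   coordinates of [c * (t i * t j)]. *)
have CsM N M x y al be : Cs N x al -> Cs M y be ->
    Cs (1 + (N + M))%N (x * y) (fun l => \sum_i \sum_j al i * be j * tau (i, j, l)).
  move=> ex ey; rewrite /Cs exprD expr1 exprD.
  have -> : cval (pi ga) * (cval (pi ga) ^+ N * cval (pi ga) ^+ M) * (x * y) =
      cval (pi ga) * (C al * C be).
    rewrite -ex -ey -!mulrA; congr (_ * (_ * _)); by rewrite mulrA (comm M x) -mulrA.
  rewrite mulr_suml mulr_sumr /C.
  under [RHS]eq_bigr do rewrite rmorph_sum cval_sum mulr_suml.
  rewrite exchange_big; apply: eq_bigr => i _ /=.
  under [RHS]eq_bigr do rewrite rmorph_sum cval_sum mulr_suml.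
  rewrite mulr_sumr mulr_sumr exchange_big; apply: eq_bigr => j _ /=.
  have -> : cval (pi ga) * (cval (pi (al i)) * t i * (cval (pi (be j)) * t j)) =
      cval (pi (al i) * pi (be j)) * (cval c * (t i * t j)).
    rewrite gaE (mulrA (_ * t i))  -(mulrA _ (t i)) -(cvalC (pi (be j))) !mulrA -!cvalM.
    by congr (cval _ * _ * _); rewrite -[LHS]mulrA [LHS]mulrC.
  rewrite LamP mulr_sumr; apply: eq_bigr => l _.
  by rewrite !rmorphM !cvalM tauE /= !mulrA.
have CsLam x : x \in xs -> exists al, Cs 1%N x al.
  move=> xx; have /choice[al alE] j := inP x j xx; exists al.
  by rewrite /Cs expr1 gaE LamP; apply: eq_bigr => j _; rewrite alE.
have all_Cs x : exists N al, Cs N x al.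
  move: x; apply: gensP => [|e x y [N [al ex]] [M [be ey]]|x y [N [al ex]] [M [be ey]]|x xg].
  - have [|al e] := CsLam 1; first by rewrite mem_head.
    by exists 1%N, al.
  - by eexists; eexists; apply: CsD; eassumption.
  - by eexists; eexists; apply: CsM; eassumption.
  - have [|al e] := CsLam x; first by rewrite inE mem_cat xg orbT.
    by exists 1%N, al.
have gan N : pi ga ^+ N != 0 by rewrite expf_neq0 // gaE.
have [N [al ea]] := all_Cs a.
have [j alj] : exists j, pi (al j) != 0.
  apply: contrapT => H; apply: an; apply: (cval_regular (gan N)).
  rewrite cvalX ea /C big1 // => j _; case: (eqVneq (pi (al j)) 0) => [->|?].
    by rewrite cval0 mul0r.
  by exfalso; apply: H; exists j.
have [|chi [ck ker]] := ext (ga * al j).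
  by rewrite rmorphM mulf_neq0 // gaE.
rewrite rmorphM mulf_eq0 negb_or => /andP[chig chia].
have chiE x y : pi x = pi y -> chi x = chi y.
  by move=> e; apply/eqP; rewrite -subr_eq0 -rmorphB ker // rmorphB e subrr.
have gX M : chi ga ^+ M != 0 by rewrite expf_neq0.
(* The coordinates of [x] specialized at [chi]. They are well defined as [chi] kills the kernel of
   [pi], and the elements with zero coordinates form an ideal of codimension at most [r]. *)
pose Val x v := exists N al, Cs N x al /\ v = \row_j (chi (al j) / chi ga ^+ N).
have ValU x v w : Val x v -> Val x w -> v = w.
  move=> [N1 [a1 [e1 ->]]] [N2 [a2 [e2 ->]]]; apply/rowP => i; rewrite !mxE.
  have E1 := CsS _ _ _ e1 N2; have := CsS _ _ _ e2 N1; rewrite /Cs addnC E1.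
  move=> /CE/(_ i)/chiE; rewrite !rmorphM !rmorphXn => e.
  by apply/eqP; rewrite eqr_div // mulrC e mulrC.
have ValD e x y v w : Val x v -> Val y w -> Val (e *: x + y) (e *: v + w).
  move=> [N1 [a1 [e1 ->]]] [N2 [a2 [e2 ->]]]; do 2 eexists; split; first exact: CsD e1 e2.
  apply/rowP => i; rewrite !mxE rmorphD !rmorphM ck !rmorphXn exprD.
  by field; rewrite !gX.
have Val0 : Val 0 0.
  exists 0%N, (fun=> 0); split; last by apply/rowP => i; rewrite !mxE rmorph0 mul0r.
  by rewrite /Cs mulr0 /C big1 // => i _; rewrite rmorph0 cval0 mul0r.
have Val00 x : Val x 0 -> exists N al, Cs N x al /\ forall i, chi (al i) = 0.
  move=> [N1 [a1 [e1 /rowP v0]]]; exists N1, a1; split=> // i.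
  move: (v0 i); rewrite !mxE => /esym/eqP; rewrite mulf_eq0 invr_eq0 (negPf (gX _)) orbF.
  by move/eqP.
have J : exists J : ideal A, forall x, J x <-> Val x 0.
  unshelve eexists (@Ideal k A (fun x => Val x 0) _ _ _ _) => //.
  - by move=> x y vx vy; have := ValD 1 _ _ _ _ vx vy; rewrite scale1r scaler0 addr0.
  - move=> y x /Val00[N1 [a1 [e1 a10]]]; have [N2 [a2 e2]] := all_Cs y.
    do 2 eexists; split; first exact: CsM e2 e1.
    apply/rowP => l; rewrite !mxE rmorph_sum big1 ?mul0r // => i _.
    by rewrite rmorph_sum big1 // => m _; rewrite !rmorphM a10 mulr0 mul0r.
  - move=> y x /Val00[N1 [a1 [e1 a10]]]; have [N2 [a2 e2]] := all_Cs y.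
    do 2 eexists; split; first exact: CsM e1 e2.
    apply/rowP => l; rewrite !mxE rmorph_sum big1 ?mul0r // => i _.
    by rewrite rmorph_sum big1 // => m _; rewrite !rmorphM a10 !mul0r.
have {J}[J JE] := J; exists J; split.
  move=> /JE va; have /ValU/(_ va)/rowP/(_ j) : Val a (\row_j (chi (al j) / chi ga ^+ N)).
    by exists N, al.
  by rewrite !mxE => /eqP; rewrite mulf_eq0 invr_eq0 (negPf chia) (negPf (gX _)).
have /choice[h hP] x : exists v, Val x v.
  have [N1 [a1 e1]] := all_Cs x; by do 3 eexists; split; [exact: e1|].
exists h; split=> [e x y|x]; first by apply: (ValU (e *: x + y)) => //; exact: ValD.
split=> [hx|/JE]; first by apply/JE; rewrite -hx.
exact: ValU.
Qed.
End SeparatingPoints.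

Section Quotients.
Variables (k : fieldType) (A : algebra k) (I : ideal A).

Lemma quot_affine : affine A -> affine (quot I).
Proof.
move=> [s sP]; exists (map (quot_pi I) s) => T T1 TD TM Ts.
elim/quot_ind; apply: sP => [|c x y|x y|x xs].
- by rewrite (quot_pi_monoid I).1.
- by rewrite quot_pi_linear; exact: TD.
- by rewrite (quot_pi_monoid I).2; exact: TM.
- by apply: Ts; exact: map_f.
Qed.

Lemma quot_central z : central z -> central (quot_pi I z : quot I).
Proof. by move=> cz; elim/quot_ind=> a; rewrite -!(quot_pi_monoid I).2 cz. Qed.

Lemma quot_module_finite : module_finite_over_center A -> module_finite_over_center (quot I).
Proof.
move=> [n [s sP]]; exists n, (fun i => quot_pi I (s i)); elim/quot_ind=> a.
have [z [cz ->]] := sP a; exists (fun i => quot_pi I (z i)).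
split=> [i|]; first exact: quot_central.
rewrite (linD_sum _ _ (quot_pi_linear I)); apply: eq_bigr => i _.
exact: (quot_pi_monoid I).2.
Qed.
End Quotients.

(** * Nullstellensatz for affine algebras finite over their center *)

Section Nullstellensatz.
Variables (k : closedFieldType) (A : algebra k).
Hypotheses (A_affine : affine A) (A_finite : module_finite_over_center A).

(** A cofinite ideal of the prime algebra [A/M] that avoids 1 pulls back to a proper ideal above
    [M], hence to [M] itself. *)
Lemma maximal_cofinite (M : ideal A) : is_maximal_ideal M -> exists n, cofinite n M.
Proof.
move=> mM; have pS := prime_quot (maximal_prime mM).
have [r rP] := separating_cofinite_ideals pS (quot_affine M A_affine)
  (quot_module_finite M A_finite).
have [J [J1 [h [hL hJ]]]] := rP 1 (prime_nz pS).
pose J' := ideal_preim (quot_proj M) J.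
have MJ : M `<=` J' by move=> x /quot_eq0 Mx; rewrite /J' /= Mx; exact: ideal0.
have JM : J' `<=` M.
  apply: mM.2 => //=; rewrite (quot_pi_monoid M).1 //.
exists r, (fun x => h (quot_pi M x)); split=> [c x y|x]; first by rewrite quot_pi_linear hL.
by rewrite hJ; split=> [/JM|/MJ].
Qed.

Lemma maximal_mx_rep (M : ideal A) : is_maximal_ideal M ->
  exists m (psi : A -> 'M[k]_m), mx_rep M psi.
Proof.
move=> mM; have [n cM] := maximal_cofinite mM.
exact: prime_cofinite_mx_rep (maximal_prime mM) cM.
Qed.

(** The bound [r] on the separating ideals does not depend on the element. So the [r]-th power of
    the intersection of the maximal ideals lies in all separating ideals and is zero, and primeness
    removes the exponent. *)
Lemma jacobson_prime : prime_algebra A ->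
  forall a : A, (forall M : ideal A, is_maximal_ideal M -> M a) -> a = 0.
Proof.
move=> A_prime; have [r rP] := separating_cofinite_ideals A_prime A_affine A_finite.
pose N := ideal_bigcap [set M : ideal A | is_maximal_ideal M].
have Nr : ideal_pow N r `<=` zero_ideal A.
  move=> x Nx; apply: contrapT => /rP[J [Jx cJ]]; apply: Jx.
  by apply: (cofinite_radical_pow cJ) Nx => M mM _ y; apply.
suff N0 : N `<=` zero_ideal A by move=> a aM; apply: N0 => M mM; exact: aM.
elim: r Nr {rP} => [|r IH] Nr; first by have := prime_nz A_prime; have /= -> := Nr 1 I.
by have [|/IH] := A_prime.2 _ _ Nr.
Qed.
End Nullstellensatz.

(** * PI degree and linear dependence over the center *)

Section PIDegree.
Variables (k : fieldType) (S : algebra k) (S_prime : prime_algebra S).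
Local Notation D := (cdom S_prime).

Section Localization.
Variables (Q : pzRingType) (f : {rmorphism S -> Q}).
Hypothesis fP : is_central_localization f.

Lemma localization_inj s : f s = 0 -> s = 0.
Proof.
case: fP => _ _ fK /fK[z [cz z0]] /(central_regular S_prime cz)[] //.
by move/eqP: z0.
Qed.

Lemma localization_central z : central z -> central (f z).
Proof.
case: fP => fU fS fK cz q; have [s [t [ct t0 e]]] := fS q.
have [u [ut tu]] := fU t ct t0.
have E : (f z * q) * f t = (q * f z) * f t.
  by rewrite -[LHS]mulrA e -[RHS]mulrA -!rmorphM -(ct z) [in RHS]rmorphM mulrA e -rmorphM (cz s).
by rewrite -[LHS]mulr1 -[RHS]mulr1 -tu !mulrA E.
Qed.

Lemma localization_num q : central q -> exists s z : D, z != 0 /\ q * f (cval z) = f (cval s).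
Proof.
case: fP => fU fS fK cq; have [s [t [ct t0 e]]] := fS q.
have cs : central s.
  move=> a; apply/eqP; rewrite -subr_eq0; apply/eqP/localization_inj.
  by rewrite rmorphB !rmorphM -e -mulrA -!rmorphM ct rmorphM mulrA cq -mulrA subrr.
have [d dE] := cval_onto S_prime cs; have [z zE] := cval_onto S_prime ct.
by exists d, z; rewrite zE dE; split=> //; apply: contra_neq t0 => z0; rewrite -zE z0.
Qed.
End Localization.

Lemma row_dependent (E : idomainType) m n (M : 'I_m -> 'I_n -> E) : (n < m)%N ->
  exists u : 'I_m -> E, (exists i, u i != 0) /\ forall j, \sum_i u i * M i j = 0.
Proof.
case: m M => // m M nm.
(* Padding by zero columns gives a square matrix of determinant 0, so the relation is found over the
   domain itself. *)
pose N : 'M[E]_m.+1 := \matrix_(i, j) oapp (M i) 0 (insub (j : nat)).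
have detN : \det N == 0.
  rewrite (expand_det_col _ ord_max) big1 // => i _.
  by rewrite mxE insubF ?mul0r //= ltnNge -ltnS nm.
have /det0P[v v0 vN] := detN; exists (v 0); split.
  apply: contrapT => H; move/eqP: v0; apply; apply/rowP => i; rewrite mxE.
  by apply/eqP/negP => /negP ?; apply: H; exists i.
move=> j; have jm : (j < m.+1)%N by apply: ltn_trans nm.
have /rowP/(_ (Ordinal jm)) := vN; rewrite !mxE => e; rewrite -[RHS]e.
by apply: eq_bigr => i _; rewrite mxE /= valK.
Qed.

Lemma PI_dependent d m (x : 'I_m -> S) : PI_degree S d -> (d ^ 2 < m)%N ->
  exists c : 'I_m -> D, (exists i, c i != 0) /\ \sum_i cval (c i) * x i = 0.
Proof.
move=> [Q [f [fP [b bP]]]] dm.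
have /choice[q qP] i : exists q : 'I_(d ^ 2) -> Q,
   (forall j, central (q j)) /\ f (x i) = \sum_j q j * b j.
  by have [q [qP _]] := bP (f (x i)); exists q.
have /choice[sz szP] (p : 'I_m * 'I_(d ^ 2)) : exists sz : D * D,
    sz.2 != 0 /\ q p.1 p.2 * f (cval sz.2) = f (cval sz.1).
  by have [s [z ?]] := localization_num fP ((qP p.1).1 p.2); exists (s, z).
pose z : D := \prod_p (sz p).2.
have z0 : z != 0 by apply/prodf_neq0 => p _; exact: (szP p).1.
have /choice[s sP] (p : 'I_m * 'I_(d ^ 2)) : exists s : D, q p.1 p.2 * f (cval z) = f (cval s).
  exists ((sz p).1 * \prod_(p' | p' != p) (sz p').2).
  by rewrite /z (bigD1 p) //= !cvalM !rmorphM mulrA (szP p).2.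
have [u [[i0 ui0] uP]] := row_dependent (fun i j => s (i, j)) dm.
exists (fun i => u i * z); split; first by exists i0; rewrite mulf_neq0.
apply: (localization_inj fP); rewrite rmorph_sum.
rewrite (eq_bigr (fun i => \sum_j f (cval (u i * s (i, j))) * b j)).
  rewrite exchange_big /= big1 // => j _; rewrite -mulr_suml -rmorph_sum -cval_sum uP.
  by rewrite cval0 rmorph0 mul0r.
move=> i _; rewrite rmorphM (qP i).2 cvalM rmorphM -mulrA mulr_sumr mulr_sumr.
apply: eq_bigr => j _; rewrite cvalM rmorphM -!mulrA; congr (_ * _).
rewrite mulrA -(sP (i, j)) /=; congr (_ * _).
by rewrite (localization_central fP) //; exact: cval_central.
Qed.

Lemma PI_independent d : PI_degree S d -> exists x : 'I_(d ^ 2) -> S,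
  forall c : 'I_(d ^ 2) -> D, \sum_i cval (c i) * x i = 0 -> forall i, c i = 0.
Proof.
move=> [Q [f [fP [b bP]]]]; case: (fP) => fU fS fK.
have /choice[sz szP] (i : 'I_(d ^ 2)) : exists sz : S * D,
    sz.2 != 0 /\ b i * f (cval sz.2) = f sz.1.
  have [s [z [cz z0 e]]] := fS (b i); have [y yE] := cval_onto S_prime cz.
  exists (s, y); rewrite /= yE; split=> //.
  by apply: contra_neq z0 => y0; rewrite -yE y0.
exists (fun i => (sz i).1) => c c0 i.
have fc (y : D) : central (f (cval y)) by apply: (localization_central fP); exact: cval_central.
have [c1 [_ uni]] := bP 0.
have E : (fun i => f (cval (c i * (sz i).2))) = (fun=> 0).
  rewrite -[RHS](uni (fun=> 0)).
    apply/esym/uni; split=> [j|]; first exact: fc.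
    transitivity (f 0); [by rewrite rmorph0|rewrite -c0 rmorph_sum]; apply: eq_bigr => j _.
    by rewrite rmorphM -(szP j).2 cvalM rmorphM -mulrA (fc (sz j).2).
  split=> [j a|]; first by rewrite mul0r mulr0.
  by rewrite big1 // => j _; rewrite mul0r.
have /(congr1 (fun g => g i)) /= /(localization_inj fP) e := E.
have /eqP : c i * (sz i).2 = 0 by apply: cval_inj; rewrite e.
by rewrite mulf_eq0 (negPf (szP i).1) orbF => /eqP.
Qed.

Lemma PI_degree_uniq d d' : PI_degree S d -> PI_degree S d' -> d = d'.
Proof.
have lt m n : PI_degree S m -> PI_degree S n -> ~ (m < n)%N.
  move=> Sm Sn mn; have [x xP] := PI_independent Sn.
  have [|c [[i ci] /xP/(_ i) e]] := PI_dependent x Sm; first by rewrite ltn_sqr.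
  by rewrite e eqxx in ci.
move=> Sd Sd'; case: (ltngtP d d') => // h; exfalso; first exact: (lt d d').
exact: (lt d' d).
Qed.
End PIDegree.

Section PIMatrix.
Variables (k : fieldType) (S : algebra k) (m : nat) (psi : S -> 'M[k]_m).
Hypothesis psiP : mx_rep (zero_ideal S) psi.

(** The center consists of the scalars, so [S] is its own central localization, and the matrix units
    form a basis over the center. *)
Lemma matrix_PI_degree : PI_degree S m.
Proof.
have [m0 L [p1 pM] sj kM] := psiP.
have inj x y : psi x = psi y -> x = y.
  move=> e; apply/eqP; rewrite -subr_eq0; apply/eqP/kM.
  by rewrite -scaleN1r addrC L scaleN1r e addNr.
have scal (z : S) : central z -> exists c : k, z = c *: (1 : S).
  move=> cz; have [c cE] := mx_rep_central psiP cz; exists c; apply: inj.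
  by rewrite cE (linZ _ _ L) p1 scalemx1.
have c1 (c : k) : central (c *: (1 : S)).
  by move=> a; rewrite -ascalerAl -ascalerAr mul1r mulr1.
exists S, idfun; split; first split.
- move=> z /scal[c ->] cn; exists (c^-1 *: (1 : S)).
  have c0 : c != 0 by apply: contra_neq cn => ->; rewrite scale0r.
  by rewrite /= -!ascalerAl !mul1r !scalerA mulVf // mulfV // scale1r.
- move=> q; exists q, 1; rewrite /= mulr1; split=> //.
    by move=> a; rewrite mul1r mulr1.
  by apply/eqP => e; apply: (mx_rep_maximal psiP).1.
- move=> s /=; split=> [->|[z [/scal[c ->] cn]]].
    exists 1; rewrite mulr0; split=> //; first by move=> a; rewrite mul1r mulr1.
    by apply/eqP => e; apply: (mx_rep_maximal psiP).1.
  rewrite -ascalerAl mul1r => /eqP; rewrite scaler_eq0 => /orP[/eqP c0|/eqP//].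
  by rewrite c0 scale0r eqxx in cn.
have e : (m ^ 2 = #|{: 'I_m * 'I_m}|)%N by rewrite card_prod card_ord.
pose p (i : 'I_(m ^ 2)) := enum_val (cast_ord e i).
pose pV (x : 'I_m * 'I_m) : 'I_(m ^ 2) := cast_ord (esym e) (enum_rank x).
have pK : cancel p pV by move=> i; rewrite /pV /p enum_valK cast_ordK.
have pVK : cancel pV p by move=> x; rewrite /pV /p cast_ordKV enum_rankK.
have /choice[b bE] (i : 'I_(m ^ 2)) : exists x, psi x = delta_mx (p i).1 (p i).2 by exact: sj.
have sumE (a : 'I_(m ^ 2) -> k) : psi (\sum_i a i *: (1 : S) * b i) =
    \matrix_(u, v) a (pV (u, v)).
  rewrite (linD_sum _ _ L); apply/matrixP => u v; rewrite summxE mxE.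
  rewrite (bigD1 (pV (u, v))) //= big1 ?addr0 => [|i iu].
    by rewrite -ascalerAl mul1r (linZ _ _ L) bE pVK !mxE !eqxx mulr1.
  rewrite -ascalerAl mul1r (linZ _ _ L) bE !mxE.
  case: eqP => [e1|_]; case: eqP => [e2|_]; rewrite ?mulr0 //.
  by move/eqP: iu; case; rewrite e1 e2 -surjective_pairing pK.
exists b => q; exists (fun i => psi q (p i).1 (p i).2 *: (1 : S)); split.
  split=> [i|]; first exact: c1.
  by apply: inj; rewrite sumE; apply/matrixP => u v; rewrite mxE pVK.
move=> c [cc ->]; have /choice[a aE] i := scal _ (cc i).
apply/funext => i; rewrite aE; congr (_ *: _).
have -> : \sum_i c i * b i = \sum_i a i *: (1 : S) * b i by apply: eq_bigr => j _; rewrite aE.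
by rewrite sumE mxE -surjective_pairing pK.
Qed.
End PIMatrix.

Section RegularMaximal.
Variables (k : fieldType) (A : algebra k) (d : nat).
Hypotheses (A_prime : prime_algebra A) (A_degree : PI_degree A d).

Lemma maximal_PI_degree (M : ideal A) m (psi : A -> 'M[k]_m) :
  mx_rep M psi -> PI_degree (quot M) m.
Proof.
move=> psiM; have [m0 L [p1 pM] sj kM] := psiM.
pose phi (q : quot M) := psi (repr (q : quot_sort M)).
have phiE x : phi (quot_pi M x) = psi x.
  apply/eqP; rewrite -subr_eq0 -scaleN1r addrC -L scaleN1r addrC; apply/eqP.
  exact/kM/quot_repr.
apply: (matrix_PI_degree (psi := phi)); split=> //.
- by move=> c; elim/quot_ind=> x; elim/quot_ind=> y; rewrite -quot_pi_linear !phiE L.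
- split; first by rewrite -(quot_pi_monoid M).1 phiE.
  by elim/quot_ind=> x; elim/quot_ind=> y; rewrite -(quot_pi_monoid M).2 !phiE pM.
- by move=> X; have [x <-] := sj X; exists (quot_pi M x); rewrite phiE.
- by elim/quot_ind=> x; rewrite phiE kM -quot_eq0.
Qed.

Lemma regular_mx_rep (M : ideal A) m (psi : A -> 'M[k]_m) :
  mx_rep M psi -> regular_ideal M <-> m = d.
Proof.
move=> psiM; have Mm := maximal_PI_degree psiM.
split=> [[d' [Ad' Md']]|e]; last by exists m; split=> //; rewrite e.
rewrite (PI_degree_uniq A_prime A_degree Ad').
apply: (PI_degree_uniq _ Mm Md').
exact: (prime_quot (maximal_prime (mx_rep_maximal psiM))).
Qed.
End RegularMaximal.

(** * Capelli polynomials and central forms *)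

Definition upd (T : Type) n (x : 'I_n -> T) (i0 : 'I_n) (a : T) : 'I_n -> T :=
  fun i => if i == i0 then a else x i.

Lemma upd_id (T : Type) n (x : 'I_n -> T) i0 : upd x i0 (x i0) = x.
Proof. by apply/funext => i; rewrite /upd; case: eqP => // ->. Qed.

Section Capelli.
Variable A : pzRingType.

Definition capelli n (x y : 'I_n -> A) : A :=
  \sum_(s : 'S_n) (-1) ^+ s * \prod_i (x (s i) * y i).

(* The action of the element [\sum u (x) v] of [A (x) A^op], and its transpose
   for the trace form. *)
Definition biact (L : seq (A * A)) (a : A) := \sum_(p <- L) p.1 * a * p.2.
Definition biactT (L : seq (A * A)) (a : A) := \sum_(p <- L) p.2 * a * p.1.

Lemma biactD L a b : biact L (a + b) = biact L a + biact L b.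
Proof. by rewrite -big_split; apply: eq_bigr => p _; rewrite mulrDr mulrDl. Qed.
Lemma biact0 L : biact L 0 = 0.
Proof. by rewrite /biact big1 // => p _; rewrite mulr0 mul0r. Qed.
Lemma biact_sum L (I : finType) (P : pred I) (F : I -> A) :
  biact L (\sum_(i | P i) F i) = \sum_(i | P i) biact L (F i).
Proof. exact: (big_morph (biact L) (biactD L) (biact0 L)). Qed.
Lemma biactZ L z a : central z -> biact L (z * a) = z * biact L a.
Proof.
by move=> cz; rewrite mulr_sumr; apply: eq_bigr => p _; rewrite !mulrA (cz p.1).
Qed.

Lemma capelli_alternate n (x y : 'I_n -> A) i1 i2 : i1 != i2 -> x i1 = x i2 ->
  capelli x y = 0.
Proof.
move=> ni e; pose t := tperm i1 i2.
rewrite /capelli (bigID (@odd_perm _)) /= [X in _ + X](reindex_inj (mulIg t)) /=.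
rewrite [X in _ + X](eq_bigl (@odd_perm _)); last first.
  by move=> s; rewrite odd_permM odd_tperm ni addbT negbK.
rewrite -big_split big1 //= => s os; rewrite odd_permM odd_tperm ni addbT os.
rewrite expr1 expr0 mul1r mulN1r; apply/eqP; rewrite addrC subr_eq0; apply/eqP.
apply: eq_bigr => i _; rewrite permM; congr (_ * _).
by rewrite /t; case: tpermP => // ->.
Qed.

(** Each term of the Capelli polynomial contains [x i0] exactly once. *)
Lemma capelli_biact n (x y : 'I_n -> A) i0 :
  exists L, forall a, capelli (upd x i0 a) y = biact L a.
Proof.
have H (s : 'S_n) : exists p : A * A, forall a,
    (-1) ^+ s * \prod_i (upd x i0 a (s i) * y i) = p.1 * a * p.2.
  suff [u [v uv]] : exists u v, forall a, \prod_i (upd x i0 a (s i) * y i) = u * a * v.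
    by exists ((-1) ^+ s * u, v) => a; rewrite uv !mulrA.
  pose j := (s^-1)%g i0.
  have U a i : upd x i0 a (s i) = upd (x \o s) j a i.
    by rewrite /upd -[i == j](inj_eq (@perm_inj _ s)) permKV.
  suff [u [v uv]] : exists u v, forall a, \prod_i (upd (x \o s) j a i * y i) = u * a * v.
    by exists u, v => a; rewrite -uv; apply: eq_bigr => i _; rewrite U.
  have := mem_index_enum j; have := index_enum_uniq 'I_n.
  elim: (index_enum _) => // i r IH /= /andP[ir ur]; rewrite inE.
  have [e _|ji /= jr] := eqVneq j i.
    rewrite -e in ir *; exists 1, (y j * \prod_(l <- r) (x (s l) * y l)) => a.
    rewrite big_cons {1}/upd eqxx mul1r mulrA; congr (_ * _).
    apply: eq_big_seq => l lr; rewrite /upd ifN //.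
    by apply: contraNneq ir => <-.
  have [u [v uv]] := IH ur jr; exists (x (s i) * y i * u), v => a.
  by rewrite big_cons uv {1}/upd eq_sym (negPf ji) !mulrA.
have /choice[p pP] := H.
exists [seq p s | s <- index_enum _] => a.
by rewrite /biact big_map; apply: eq_bigr => s _; rewrite pP.
Qed.

(** Substitute the relation for the variable [i0]: by alternation only the term with coefficient
    [c i0] survives. *)
Lemma capelli_dependent n (x y c : 'I_n -> A) i0 : (forall i, central (c i)) ->
  \sum_i c i * x i = 0 -> c i0 * capelli x y = 0.
Proof.
move=> cc e; have [L LP] := capelli_biact x y i0.
have := congr1 (biact L) e; rewrite biact0 biact_sum (bigD1 i0) //= biactZ // -LP upd_id.
rewrite big1 ?addr0 // => i ii0; rewrite biactZ // -LP.
rewrite (@capelli_alternate n _ _ i i0) ?mulr0 //.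
by rewrite /upd (negPf ii0) eqxx.
Qed.
End Capelli.

Section CapelliMorph.
Variables (A B : pzRingType) (f : {rmorphism A -> B}).

Lemma capelli_morph n (x y : 'I_n -> A) :
  f (capelli x y) = capelli (f \o x) (f \o y).
Proof.
rewrite rmorph_sum; apply: eq_bigr => s _; rewrite rmorphM rmorph_sign rmorph_prod.
by congr (_ * _); apply: eq_bigr => i _; rewrite rmorphM.
Qed.
Lemma biactT_morph (L : seq (A * A)) a :
  f (biactT L a) = biactT [seq (f p.1, f p.2) | p <- L] (f a).
Proof. by rewrite rmorph_sum /biactT big_map; apply: eq_bigr => p _; rewrite !rmorphM. Qed.
Lemma biact_morph (L : seq (A * A)) a :
  f (biact L a) = biact [seq (f p.1, f p.2) | p <- L] (f a).
Proof. by rewrite rmorph_sum /biact big_map; apply: eq_bigr => p _; rewrite !rmorphM. Qed.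
End CapelliMorph.

Section MatrixIndex.
Variable m : nat.
Let e : (m ^ 2 = #|{: 'I_m * 'I_m}|)%N. Proof. by rewrite card_prod card_ord. Qed.
Definition mxidx (i : 'I_(m ^ 2)) : 'I_m * 'I_m := enum_val (cast_ord e i).
Definition idxmx (x : 'I_m * 'I_m) : 'I_(m ^ 2) := cast_ord (esym e) (enum_rank x).
Lemma mxidxK : cancel mxidx idxmx.
Proof. by move=> i; rewrite /mxidx /idxmx enum_valK cast_ordK. Qed.
Lemma idxmxK : cancel idxmx mxidx.
Proof. by move=> i; rewrite /mxidx /idxmx cast_ordKV enum_rankK. Qed.
End MatrixIndex.

Section MatrixCapelli.
Variables (k : fieldType) (m : nat).
Local Notation Mx := 'M[k]_m.

Lemma trace_biactT (L : seq (Mx * Mx)) (w a : Mx) :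
  \tr (biactT L w *m a) = \tr (w *m biact L a).
Proof.
rewrite mulmx_suml mulmx_sumr !raddf_sum /=; apply: eq_bigr => p _.
by rewrite -!mulmxE -!mulmxA mxtrace_mulC !mulmxA.
Qed.

Lemma trace_nondegenerate (X : Mx) : (forall Y, \tr (X *m Y) = 0) -> X = 0.
Proof.
move=> h; apply/matrixP => i j; rewrite mxE -[RHS](h (delta_mx j i)).
rewrite /mxtrace (bigD1 i) //= big1 ?addr0 => [|l li].
  rewrite mxE (bigD1 j) //= big1 ?addr0 => [|l lj]; first by rewrite mxE !eqxx mulr1.
  by rewrite mxE (negPf lj) mulr0.
by rewrite mxE big1 // => j' _; rewrite mxE (negPf li) andbF mulr0.
Qed.

Definition mx_indep n (x : 'I_n -> Mx) :=
  forall c : 'I_n -> k, \sum_i c i *: x i = 0 -> forall i, c i = 0.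

(** The [i]-th matrix unit leads from column [c i] of one factor to row [r i.+1] of the next, so
    only one path contributes. *)
Lemma path_product (X : nat -> Mx) (r c : nat -> 'I_m) n (l : 'I_m) :
  (\prod_(i < n) (X i * delta_mx (c i) (r i.+1))) (r 0%N) l =
  (\prod_(i < n) X i (r i) (c i)) * (l == r n)%:R.
Proof.
elim: n l => [|n IH] l; first by rewrite !big_ord0 !mxE mul1r eq_sym.
rewrite !big_ord_recr /= -mulmxE mxE (bigD1 (r n)) //= big1 ?addr0 => [|j jr].
  rewrite IH eqxx mulr1 mxE -mulrA; congr (_ * _).
  rewrite (bigD1 (c n)) //= big1 ?addr0 => [|j jc]; first by rewrite mxE eqxx.
  by rewrite mxE (negPf jc) mulr0.
by rewrite IH (negPf jr) mulr0 mul0r.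
Qed.

(* For suitable matrix units y an entry of the Capelli polynomial is the
   determinant of the coordinates of x. *)
Lemma capelli_nonzero (x : 'I_(m ^ 2) -> Mx) : (0 < m)%N -> mx_indep x ->
  exists y, capelli x y != 0.
Proof.
move=> m0 ix; pose o := Ordinal m0.
(* The path has one more row index than there are variables; at [m ^ 2] the default value [o]
   provides it. *)
pose p (i : nat) := oapp (@mxidx m) (o, o) (insub i).
have pE (i : 'I_(m ^ 2)) : p i = mxidx i by rewrite /p valK.
pose r i := (p i).1; pose c i := (p i).2.
pose y (i : 'I_(m ^ 2)) : Mx := delta_mx (c i) (r i.+1).
exists y; pose G := \matrix_(i < m ^ 2, j < m ^ 2) x j (r i) (c i).
have : \det G != 0.
  rewrite -det_tr; apply/det0P => -[v v0 vG]; move/eqP: v0; apply; apply/rowP => i.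
  rewrite mxE; apply: (ix (v 0)); apply/matrixP => a b; rewrite summxE.
  have /rowP/(_ (idxmx (a, b))) := vG; rewrite !mxE => e; rewrite -[RHS]e.
  by apply: eq_bigr => j _; rewrite !mxE /r /c pE idxmxK.
apply: contra_neq => /matrixP/(_ (r 0%N) (r (m ^ 2)%N)); rewrite mxE => e; rewrite -[RHS]e.
rewrite summxE; apply: eq_bigr => s _.
have -> : ((-1) ^+ s * \prod_i (x (s i) * y i)) (r 0%N) (r (m ^ 2)%N) =
    (-1) ^+ s * (\prod_i (x (s i) * y i)) (r 0%N) (r (m ^ 2)%N).
  by case: (odd_perm s); rewrite ?expr1 ?expr0 ?mulN1r ?mul1r // mxE.
congr (_ * _); pose X i : Mx := oapp (fun i => x (s i)) 0 (insub i).
have XE (i : 'I_(m ^ 2)) : X i = x (s i) by rewrite /X valK.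
rewrite (eq_bigr (fun i : 'I_(m ^ 2) => X i * delta_mx (c i) (r i.+1))); last first.
  by move=> i _; rewrite XE.
rewrite path_product eqxx mulr1; apply: eq_bigr => i _; by rewrite mxE XE.
Qed.

(** The trace is a nonzero functional in every characteristic, since matrix units on the diagonal
    have trace 1; so traceless matrices span less than [m ^ 2] dimensions. *)
Lemma traceless_dependent d (x : 'I_(d ^ 2) -> Mx) : (0 < m)%N -> (m <= d)%N ->
  (forall i, \tr (x i) = 0) ->
  exists c : 'I_(d ^ 2) -> k, (exists i, c i != 0) /\ \sum_i c i *: x i = 0.
Proof.
move=> m0 md tx; pose M := \matrix_i mxvec (x i).
have [u uM u0] : exists2 u : 'rV_(d ^ 2), u *m M = 0 & u != 0.
  apply: contrapT => H.
  have /eqP rM : row_free M.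
    apply: inj_row_free => u uM; apply/eqP/negP => /negP u0.
    by apply: H; exists u.
  have /row_fullP[B BM] : row_full M.
    rewrite /row_full eqn_leq rank_leq_col rM mulnn leq_sqr //.
  have M1 : M *m (mxvec (1%:M : Mx))^T = 0.
    apply/matrixP => i j; rewrite !mxE ord1 -[RHS](tx i).
    transitivity (\sum_a \sum_b x i a b * (1%:M : Mx) a b).
      rewrite pair_bigA (reindex _ (curry_mxvec_bij _ _)) /=.
      by apply: eq_bigr => -[a b] _; rewrite !mxE !mxvecE mxE.
    apply: eq_bigr => a _; rewrite (bigD1 a) //= big1 ?addr0 => [|b ba].
      by rewrite mxE eqxx mulr1.
    by rewrite mxE eq_sym (negPf ba) mulr0.
  have : (mxvec (1%:M : Mx))^T = 0.
    by rewrite -[LHS]mul1mx -BM -mulmxA M1 mulmx0.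
  move=> /matrixP/(_ (mxvec_index (Ordinal m0) (Ordinal m0)) 0)/eqP.
  by rewrite !mxE mxvecE mxE eqxx oner_eq0.
exists (u 0); split.
  apply: contrapT => H; move/negP: u0; apply; apply/eqP/rowP => i.
  rewrite mxE; apply/eqP/negP => /negP ui; apply: H; by exists i.
apply: (can_inj mxvecK); rewrite linear0 -uM mulmx_sum_row linear_sum /=.
by apply: eq_bigr => i _; rewrite rowK linearZ.
Qed.
End MatrixCapelli.

Lemma mx_rep_rmorphism (k : fieldType) (A : algebra k) (M : set A) m (psi : A -> 'M[k]_m) :
  mx_rep M psi -> exists f : {rmorphism A -> 'M[k]_m}, psi = f.
Proof.
move=> [_ L mM _ _].
have psiB : {morph psi : x y / x - y}.
  by move=> x y; rewrite -scaleN1r addrC L scaleN1r addrC.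
pose H1 := GRing.isZmodMorphism.Build _ _ psi psiB.
pose H2 := GRing.isMonoidMorphism.Build _ _ psi mM.
by exists (HB.pack_for {rmorphism A -> 'M[k]_m} psi H1 H2).
Qed.

(** * Central alternating forms *)

Section CentralForms.
Variables (k : closedFieldType) (A : algebra k) (d : nat).
Hypotheses (A_prime : prime_algebra A) (A_affine : affine A).
Hypotheses (A_finite : module_finite_over_center A) (A_degree : PI_degree A d).

Lemma capelli_prime n (x y : 'I_n -> A) : (d ^ 2 < n)%N -> capelli x y = 0.
Proof.
move=> dn; have [c [[i ci] e]] := PI_dependent A_prime x A_degree dn.
apply: (cval_regular ci); apply: (@capelli_dependent _ _ x y (fun i => cval (c i)) i) => //.
by move=> j; exact: cval_central.
Qed.

Lemma capelli_mx_dependent m n (x y : 'I_n -> 'M[k]_m) (c : 'I_n -> k) i0 :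
  c i0 != 0 -> \sum_i c i *: x i = 0 -> capelli x y = 0.
Proof.
move=> ci e; have : (c i0)%:M * capelli x y = 0.
  apply: (@capelli_dependent _ _ x y (fun i => (c i)%:M) i0).
    by move=> i a; rewrite -!mulmxE scalar_mxC.
  by rewrite -[RHS]e; apply: eq_bigr => i _; rewrite -mulmxE mul_scalar_mx.
rewrite -mulmxE mul_scalar_mx => /eqP; rewrite scaler_eq0 (negPf ci) /=.
by move/eqP.
Qed.

Lemma delta_indep m : mx_indep (fun i => delta_mx (mxidx i).1 (mxidx i).2 : 'M[k]_m).
Proof.
move=> c e i; have /matrixP/(_ (mxidx i).1 (mxidx i).2) := e.
rewrite summxE mxE (bigD1 i) //= big1 ?addr0 => [|j ji].
  by rewrite !mxE !eqxx mulr1.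
rewrite !mxE; case: eqP => [e1|_]; case: eqP => [e2|_]; rewrite ?mulr0 //.
move/eqP: ji; case; rewrite -[i]mxidxK -[j]mxidxK [mxidx i]surjective_pairing.
by rewrite [mxidx j]surjective_pairing e1 e2.
Qed.

(** For [m > d] the Capelli polynomial in [m ^ 2] variables is an identity of [A], while it has
    nonzero values on the [m x m] matrices. *)
Lemma mx_rep_size (M : set A) m (psi : A -> 'M[k]_m) : mx_rep M psi -> (m <= d)%N.
Proof.
move=> psiM; have [f fE] := mx_rep_rmorphism psiM; have [m0 _ _ sj _] := psiM.
rewrite leqNgt; apply/negP => dm.
have /choice[x xE] (i : 'I_(m ^ 2)) : exists x, f x = delta_mx (mxidx i).1 (mxidx i).2.
  by rewrite -fE.
have [y0 /eqP] := capelli_nonzero m0 (@delta_indep m); apply.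
have /choice[y yE] (i : 'I_(m ^ 2)) : exists y, f y = y0 i by rewrite -fE.
have := congr1 f (capelli_prime x y (_ : (d ^ 2 < m ^ 2)%N)).
rewrite ltn_sqr => /(_ dm); rewrite capelli_morph rmorph0 => e; rewrite -[RHS]e.
by congr capelli; apply/funext => i /=.
Qed.

(* Razmyslov's transform: if all but one of the variables of a Capelli
   polynomial are commutators, then the transpose of the polynomial in the
   remaining variable has central values, because its values are orthogonal to
   all commutators. *)
Lemma razmyslov_central (X y : 'I_(d ^ 2) -> A) i0 L :
  (forall i, i != i0 -> exists p q, X i = p * q - q * p) ->
  (forall a, capelli (upd X i0 a) y = biact L a) ->
  forall w, central (biactT L w).
Proof.
move=> Xc LP w r; apply/eqP; rewrite -subr_eq0; apply/eqP.
apply: (jacobson_prime A_affine A_finite A_prime) => M mM.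
have [m [psi psiM]] := maximal_mx_rep A_affine A_finite mM.
have md := mx_rep_size psiM; have [f fE] := mx_rep_rmorphism psiM.
have [m0 _ _ sj kM] := psiM; apply/kM; rewrite fE; apply: trace_nondegenerate => Y.
have [q <-] := sj Y; rewrite fE.
have tC (a b : A) : \tr (f (a * b - b * a)) = 0.
  by rewrite rmorphB raddfB /= !rmorphM -!mulmxE mxtrace_mulC subrr.
have -> : \tr (f (biactT L w * r - r * biactT L w) *m f q) =
    \tr (f (biactT L w) *m f (r * q - q * r)).
  rewrite !rmorphB mulmxBl mulmxBr !raddfB /= !rmorphM -!mulmxE; congr (_ - _).
    by rewrite mulmxA.
  by rewrite -mulmxA mxtrace_mulC -mulmxA.
rewrite biactT_morph trace_biactT -biact_morph -LP capelli_morph.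
set Z := f \o _.
have [|c [[j cj] e]] := @traceless_dependent k m d Z m0 md.
  move=> i; rewrite /Z /= /upd; case: eqP => [_|/eqP /Xc[a [b ->]]]; exact: tC.
by rewrite (capelli_mx_dependent _ cj e) mulmx0 mxtrace0.
Qed.

(** The last clause gives linearity over the center in each variable, and moreover keeps the value
    in any ideal that contains one of the variables. *)
Definition alternating_form n (F : ('I_n -> A) -> A) :=
  [/\ forall x, central (F x), forall x i j, i != j -> x i = x j -> F x = 0
    & forall x i, exists L, forall a, F (upd x i a) = biact L a].

Lemma biactT_biact (B : pzRingType) (L L' : seq (B * B)) (p q : B) : exists L'',
  forall a, biactT L (p * biact L' a * q) = biact L'' a.
Proof.
exists [seq (u.2 * p * v.1, v.2 * q * u.1) | u <- L, v <- L'] => a.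
rewrite /biact big_allpairs_dep /biactT; apply: eq_bigr => u _.
rewrite !mulr_sumr !mulr_suml mulr_sumr mulr_suml; apply: eq_bigr => v _.
by rewrite /= !mulrA.
Qed.

Lemma central_form_exists (M : set A) (psi : A -> 'M[k]_d) : mx_rep M psi ->
  exists F : ('I_(d ^ 2) -> A) -> A, [/\ alternating_form F,
    forall (M' : set A) m (psi' : A -> 'M[k]_m), mx_rep M' psi' -> (m < d)%N ->
      forall x, M' (F x)
    & forall x, (forall i, psi (x i) = delta_mx (mxidx i).1 (mxidx i).2) -> ~ M (F x)].
Proof.
move=> psiM; have [f fE] := mx_rep_rmorphism psiM; have [d0 L0 _ sj kM] := psiM.
pose o := Ordinal d0; pose dl (i : 'I_(d ^ 2)) : 'M[k]_d := delta_mx (mxidx i).1 (mxidx i).2.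
have /choice[E EP] (p : 'I_d * 'I_d) : exists x, f x = delta_mx p.1 p.2 by rewrite -fE.
(* Modulo [M] these are the units [E_ab] off the diagonal, the differences [E_aa - E_oo], and
   [E_oo]: a basis in every characteristic, all of whose members except [X i0] are written as
   commutators. *)
pose X (i : 'I_(d ^ 2)) : A := let: (a, b) := mxidx i in
  if a != b then E (a, a) * E (a, b) - E (a, b) * E (a, a)
  else if a != o then E (a, o) * E (o, a) - E (o, a) * E (a, o) else E (o, o).
pose i0 := idxmx (o, o).
have Xc i : i != i0 -> exists p q, X i = p * q - q * p.
  move=> ii; rewrite /X; case e: (mxidx i) => [a b]; case: eqP => [ab|_] /=; last by exists (E (a, a)), (E (a, b)).
  case: eqP => [ao|_] /=; last by exists (E (a, o)), (E (o, a)).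
  by move: ii; rewrite -[i]mxidxK e -ab ao eqxx.
have fX i u v : (u, v) != (o, o) -> f (X i) u v = (mxidx i == (u, v))%:R.
  rewrite /X; case e: (mxidx i) => [a b]; rewrite !xpair_eqE => uv.
  case: eqP => [ab|/eqP ab] /=.
    case: eqP => [ao|/eqP ao] /=.
      rewrite EP mxE -ab ao [o == u]eq_sym [o == v]eq_sym //.
    rewrite rmorphB !rmorphM !EP -!mulmxE !mul_delta_mx !mxE /= -ab.
    by rewrite (negPf uv) subr0 [a == u]eq_sym [a == v]eq_sym.
  rewrite rmorphB !rmorphM !EP -!mulmxE mul_delta_mx mul_delta_mx_0 1?eq_sym //.
  by rewrite subr0 mxE [u == a]eq_sym [v == b]eq_sym.
have iX : mx_indep (f \o X).
  move=> c e.
  have ec i : i != i0 -> c i = 0.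
    move=> ii; have uv : (mxidx i) != (o, o) by apply: contra_neq ii => e'; rewrite -[i]mxidxK e'.
    have /matrixP/(_ (mxidx i).1 (mxidx i).2) := e.
    rewrite summxE mxE (bigD1 i) //= big1 ?addr0 => [|j ji].
      by rewrite mxE fX -?surjective_pairing // eqxx mulr1.
    rewrite mxE fX -?surjective_pairing // (inj_eq (can_inj (@mxidxK d))).
    by rewrite (negPf ji) mulr0.
  move=> i; have [->|/ec //] := eqVneq i i0.
  have /matrixP/(_ o o) := e; rewrite summxE mxE (bigD1 i0) //= big1 ?addr0 => [|j ji].
    by rewrite mxE /X idxmxK eqxx /= EP mxE !eqxx mulr1.
  by rewrite ec // scale0r mxE.
have lift (Y : 'I_(d ^ 2) -> 'M[k]_d) : exists y : 'I_(d ^ 2) -> A, f \o y = Y.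
  have /choice[y yE] i : exists y, f y = Y i by rewrite -fE.
  by exists y; apply/funext.
have [Y1 Y1n] := capelli_nonzero d0 iX; have [y1 y1E] := lift Y1.
have [Y2 Y2n] := capelli_nonzero d0 (@delta_indep d); have [y2 y2E] := lift Y2.
have [L LP] := capelli_biact X y1 i0.
have Lc := razmyslov_central Xc LP.
pose fL := [seq (f p.1, f p.2) | p <- L].
have [W Wn] : exists W, biactT fL W != 0.
  apply: contrapT => H; move/eqP: Y1n; apply.
  rewrite -y1E -capelli_morph -(upd_id X i0) LP biact_morph -/fL.
  apply: trace_nondegenerate => W; rewrite mxtrace_mulC -trace_biactT.
  suff -> : biactT fL W = 0 by rewrite mul0mx mxtrace0.
  by apply/eqP/negP => /negP ?; apply: H; exists W.
pose C := capelli dl Y2.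
have biactT0 : biactT fL 0 = 0 by rewrite /biactT big1 // => p _; rewrite mulr0 mul0r.
have biactTD x y : biactT fL (x + y) = biactT fL x + biactT fL y.
  by rewrite -big_split; apply: eq_bigr => p _; rewrite mulrDr mulrDl.
(* As [C] is nonzero, the products [P * C * Q] span all matrices, and the transform is nonzero at
   [W]. *)
have [P [Q PQ]] : exists P Q, biactT fL (P * C * Q) != 0.
  apply: contrapT => H; move/eqP: Wn; apply.
  have [i [j Cij]] : exists i j, C i j != 0.
    apply: contrapT => H'; move/eqP: Y2n; apply; apply/matrixP => i j; rewrite mxE.
    by apply/eqP/negP => /negP nz; apply: H'; exists i, j.
  have WE : W = \sum_a \sum_b (W a b / C i j) *: delta_mx a i * C * delta_mx j b.
    rewrite {1}[W]matrix_sum_delta; apply: eq_bigr => a _; apply: eq_bigr => b _.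
    rewrite -!mulmxE -!scalemxAl; apply/matrixP => u v; rewrite !mxE.
    rewrite (bigD1 j) //= big1 ?addr0 => [|l lj]; last by rewrite !mxE (negPf lj) mulr0.
    rewrite !mxE (bigD1 i) //= big1 ?addr0 => [|l li]; last by rewrite !mxE (negPf li) andbF mul0r.
    rewrite !mxE !eqxx andbT /= -!mulrA; congr (_ * _).
    by case: (u == a); case: (v == b); rewrite ?mul1r ?mul0r ?mulr1 ?mulr0 ?mulVf.
  rewrite WE (big_morph (biactT fL) biactTD biactT0) big1 // => a _.
  rewrite (big_morph (biactT fL) biactTD biactT0) big1 // => b _.
  apply/eqP/negP => /negP ?; apply: H; by do 2 eexists; eassumption.
have [p pE] := sj P; have [q qE] := sj Q.
exists (fun x => biactT L (p * capelli x y2 * q)); split; first split.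
- by move=> x; exact: Lc.
- move=> x i j ij e; rewrite (capelli_alternate _ ij e) mulr0 mul0r.
  by rewrite /biactT big1 // => u _; rewrite mulr0 mul0r.
- move=> x i; have [L' L'P] := capelli_biact x y2 i.
  have [L'' L''P] := biactT_biact L L' p q; exists L'' => a.
  by rewrite L'P L''P.
- move=> M' m psi' psi'M md x.
  have [g gE] := mx_rep_rmorphism psi'M; have [_ _ _ _ kM'] := psi'M; apply/kM'.
  have hL : linear (mxvec : 'M[k]_m -> 'rV_(m * m)) by move=> c u v; rewrite linearP.
  have [|c [[i ci] e]] := lin_dep (g \o x) hL; first by rewrite mulnn ltn_sqr.
  have {}e : \sum_i c i *: (g \o x) i = 0 by apply: (can_inj mxvecK); rewrite e linear0.
  rewrite gE biactT_morph !rmorphM capelli_morph (capelli_mx_dependent _ ci e).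
  by rewrite mulr0 mul0r /biactT big1 // => u _; rewrite mulr0 mul0r.
- move=> x xE /kM; rewrite fE biactT_morph !rmorphM capelli_morph -fE pE qE fE y2E.
  have -> : f \o x = dl by apply/funext => i; rewrite /= -fE xE.
  by move=> e; move/eqP: PQ; rewrite -/C /fL e.
Qed.
End CentralForms.

(** * Matrix coordinates at regular maximal ideals *)

Section Congruence.
Variables (k : fieldType) (A : algebra k) (K : ideal A).
Definition ideq (x y : A) := K (x - y).

Lemma ideq_refl x : ideq x x. Proof. by rewrite /ideq subrr; exact: ideal0. Qed.
Lemma ideq_sym x y : ideq x y -> ideq y x.
Proof. by move=> /idealN; rewrite opprB. Qed.
Lemma ideq_trans y x z : ideq x y -> ideq y z -> ideq x z.
Proof. by move=> xy yz; rewrite /ideq -[x](subrK y) -addrA; exact: idealD. Qed.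
Lemma ideqD x y x' y' : ideq x x' -> ideq y y' -> ideq (x + y) (x' + y').
Proof. by move=> h h'; rewrite /ideq opprD addrACA; exact: idealD. Qed.
Lemma ideqM x y x' y' : ideq x x' -> ideq y y' -> ideq (x * y) (x' * y').
Proof.
move=> h h'; apply: (ideq_trans (y := x * y')).
  by rewrite /ideq -mulrBr; exact: idealMl.
by rewrite /ideq -mulrBl; exact: idealMr.
Qed.
Lemma ideqMl a x y : ideq x y -> ideq (a * x) (a * y).
Proof. by apply: ideqM; exact: ideq_refl. Qed.
Lemma ideqMr a x y : ideq x y -> ideq (x * a) (y * a).
Proof. by move=> h; apply: ideqM => //; exact: ideq_refl. Qed.
Lemma ideq_sum (I : Type) (s : seq I) (P : pred I) (F G : I -> A) :
  (forall i, P i -> ideq (F i) (G i)) ->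
  ideq (\sum_(i <- s | P i) F i) (\sum_(i <- s | P i) G i).
Proof. by move=> h; rewrite /ideq -sumrB; exact: ideal_sum. Qed.
Lemma ideq0 x : ideq x 0 <-> K x. Proof. by rewrite /ideq subr0. Qed.

Definition matrix_units d (E : 'I_d -> 'I_d -> A) :=
  (forall a b c e, ideq (E a b * E c e) (if b == c then E a e else 0)) /\
  ideq (\sum_a E a a) 1.
End Congruence.

(** Lift the idempotent [E o o] to [e], then the column and row [E a o], [E o a] to [v a], [u a],
    and correct [u] to be exactly dual to [v]. The index type is nonempty to provide [o]. *)
Lemma lift_matrix_units0 (k : fieldType) (A : algebra k) (K : ideal A) d
    (E : 'I_d.+1 -> 'I_d.+1 -> A) :
  (forall x y, K x -> K y -> x * y = 0) -> matrix_units K E ->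
  exists E', matrix_units (zero_ideal A) E' /\ forall a b, ideq K (E' a b) (E a b).
Proof.
move=> K2 [EM E1]; pose o : 'I_d.+1 := ord0; pose e0 := E o o.
pose dl := e0 * e0 - e0.
have Kdl : K dl by have := EM o o o o; rewrite eqxx.
have e0e0 : e0 * e0 = e0 + dl by rewrite addrC subrK.
have dlC : dl * e0 = e0 * dl by rewrite mulrBl mulrBr mulrA.
clearbody dl; have [w wE] : exists w, w = e0 * dl by exists (e0 * dl).
have Kw : K w by rewrite wE; exact: idealMl.
have e0w : e0 * w = w by rewrite wE mulrA e0e0 mulrDl (K2 dl dl) // addr0.
have we0 : w * e0 = w by rewrite {1}wE -mulrA dlC -wE e0w.
(* With this [x], [e0 + x] is the usual lift [3 e0^2 - 2 e0^3] of an idempotent. *)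
have [x xE] : exists x, x = dl - w - w by exists (dl - w - w).
have Ke : K x by rewrite xE; do 2!apply: idealB => //.
have e0x : e0 * x = - w by rewrite xE !mulrBr -wE e0w subrr sub0r.
have xe0 : x * e0 = - w by rewrite xE !mulrBl dlC -wE we0 subrr sub0r.
pose e := e0 + x.
have ee : e * e = e.
  by rewrite /e mulrDl !mulrDr (K2 _ _ Ke Ke) addr0 e0e0 e0x xe0 xE !addrA.
have e0E : ideq K e e0 by rewrite /ideq /e addrC addKr.
pose v a := E a o * e; pose u a := e * E o a.
pose H a b := u a * v b - (if a == b then e else 0).
have KH a b : K (H a b).
  apply: (ideq_trans (y := e * (if a == b then E o o else 0) * e)).
    by rewrite /u /v -!mulrA; apply: ideqMl; rewrite !mulrA; apply: ideqMr; exact: EM.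
  case: eqP => _; last by rewrite mulr0 mul0r; exact: ideq_refl.
  have -> : ideq K (e * E o o * e) e = ideq K (e * E o o * e) (e * e * e) by rewrite !ee.
  by apply: ideqMr; apply: ideqMl; exact: ideq_sym.
have uv a b : u a * v b = (if a == b then e else 0) + H a b by rewrite addrC subrK.
have ve a : v a * e = v a by rewrite /v -mulrA ee.
have He a b : H a b * e = H a b.
  rewrite /H mulrBl -mulrA ve; case: eqP => _; first by rewrite ee.
  by rewrite mul0r.
(* The Gram matrix of [u] and [v] is the identity plus [H], and its inverse is the identity minus
   [H] because [K] has square zero. *)
pose u' a := u a - \sum_c H a c * u c.
have u'v a b : u' a * v b = if a == b then e else 0.
  rewrite mulrBl mulr_suml (eq_bigr (fun c => if c == b then H a b else 0)).
    rewrite -big_mkcond /= big_pred1_eq uv.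
    by rewrite addrK.
  move=> c _; rewrite -mulrA uv mulrDr (K2 (H a c) (H c b)) // addr0.
  by case: eqP => [->|_]; rewrite ?He ?mulr0.
have Ev a b : ideq K (v a * u' b) (E a b).
  apply: (ideq_trans (y := v a * u b)).
    rewrite /ideq /u' mulrBr addrAC subrr sub0r; apply: idealN; apply: idealMl.
    by apply: ideal_sum => c _; exact: idealMr.
  rewrite /v /u -mulrA (mulrA e) ee.
  apply: (ideq_trans (y := E a o * (e0 * E o b))).
    by apply: ideqMl; exact: ideqMr.
  apply: (ideq_trans (y := E a o * E o b)).
    by apply: ideqMl; have := EM o o o b; rewrite eqxx.
  by have := EM a o o b; rewrite eqxx.
exists (fun a b => v a * u' b); split=> //.
have MU a b c f : v a * u' b * (v c * u' f) = if b == c then v a * u' f else 0.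
  rewrite -mulrA (mulrA (u' b)) u'v; case: eqP => _; last by rewrite mul0r mulr0.
  by rewrite mulrA ve.
split=> [a b c f|]; first by rewrite MU; exact: ideq_refl.
pose s := \sum_a v a * u' a.
have ss : s * s = s.
  rewrite mulr_suml; apply: eq_bigr => a _; rewrite mulr_sumr.
  under eq_bigr do rewrite MU; by rewrite -big_mkcond /= (big_pred1 a) // => b; rewrite eq_sym.
have Ks : K (1 - s).
  apply: ideq_trans (ideq_sym E1) _; apply: ideq_sum => a _; exact: ideq_sym.
apply: ideq_sym; rewrite /ideq /=.
(* An idempotent in an ideal of square zero vanishes. *)
have <- : (1 - s) * (1 - s) = 1 - s by rewrite mulrBl mul1r mulrBr mulr1 ss subrr subr0.
exact: K2.
Qed.

Section Extension.
Variables (k : fieldType) (A : algebra k).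
Local Notation Z := (center A).
Local Notation iota := (center_incl A).

Lemma incl_central (z : Z) a : iota z * a = a * iota z.
Proof. by case: z => z zP; have /asboolP h := zP; exact: h. Qed.

Definition ideal_ext (j : ideal Z) : ideal A :=
  ideal_gen [set x | exists2 z, j z & x = iota z].

Lemma ideal_ext_in (j : ideal Z) z : j z -> ideal_ext j (iota z).
Proof. by move=> jz K h; apply: h; exists z. Qed.
Lemma ideal_ext_min (j : ideal Z) (K : ideal A) :
  (forall z, j z -> K (iota z)) -> ideal_ext j `<=` K.
Proof. by move=> h x; apply=> _ [z jz ->]; exact: h. Qed.
Lemma ideal_ext_mono (j j' : ideal Z) : j `<=` j' -> ideal_ext j `<=` ideal_ext j'.
Proof. by move=> h; apply: ideal_ext_min => z /h; exact: ideal_ext_in. Qed.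

Lemma ideal_ext_mul (j j' : ideal Z) x y :
  ideal_ext j x -> ideal_ext j' y -> ideal_ext (ideal_mul j j') (x * y).
Proof.
move=> jx j'y; move: x jx y j'y.
have [L HL] : exists L : ideal A, forall x, L x <->
    forall y, ideal_ext j' y -> ideal_ext (ideal_mul j j') (x * y).
  unshelve eexists (@Ideal k A (fun x =>
    forall y, ideal_ext j' y -> ideal_ext (ideal_mul j j') (x * y)) _ _ _ _) => //.
  - by move=> y _; rewrite mul0r; exact: ideal0.
  - by move=> x x' Hx Hx' y Hy; rewrite mulrDl; apply: idealD; [exact: Hx|exact: Hx'].
  - by move=> a x Hx y Hy; rewrite -mulrA; apply: idealMl; exact: Hx.
  - by move=> a x Hx y Hy; rewrite -mulrA; apply: Hx; exact: idealMl.
suff : ideal_ext j `<=` L by move=> jL x /jL /HL.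
apply: ideal_ext_min => z jz; apply/HL => y j'y; move: y j'y.
have [L' HL'] : exists L' : ideal A, forall y, L' y <->
    ideal_ext (ideal_mul j j') (iota z * y).
  unshelve eexists (@Ideal k A (fun y =>
    ideal_ext (ideal_mul j j') (iota z * y)) _ _ _ _) => //.
  all: cbv beta.
  - by rewrite mulr0; exact: ideal0.
  - by move=> x x' Hx Hx'; rewrite mulrDr; exact: idealD.
  - by move=> a x Hx; rewrite mulrA incl_central -mulrA; exact: idealMl.
  - by move=> a x Hx; rewrite mulrA; exact: idealMr.
suff : ideal_ext j' `<=` L' by move=> jL x /jL /HL'.
apply: ideal_ext_min => z' jz'; apply/HL'.
by rewrite -(alghom_monoid iota).2; apply: ideal_ext_in; exact: ideal_mul_in.
Qed.

Lemma inverse_mod_pow (m : ideal Z) (t0 s : Z) l : m (1 - t0 * s) ->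
  exists t, ideal_pow m l (1 - t * s).
Proof.
move=> mt; elim: l => [|l [t IH]]; first by exists 0.
exists (t0 + t - t0 * t * s).
have -> : 1 - (t0 + t - t0 * t * s) * s = (1 - t0 * s) * (1 - t * s).
  have e : t0 * s * (t * s) = t0 * t * s * s.
    by rewrite mulrA -(mulrA t0 s t) (@comalg_mulC _ Z s t) !mulrA.
  rewrite !mulrBl mulrDl !mul1r mulrBr mulr1 e -[RHS]addrA -opprD.
  by rewrite addrCA addrA.
exact: ideal_mul_in.
Qed.

Lemma ideal_ext_linear_form (j : ideal Z) (F : A -> Z) (r : A) :
  F 0 = 0 -> (forall x y, F (x + y) = F x + F y) -> (forall z x, F (iota z * x) = z * F x) ->
  ideal_ext j r -> j (F r).
Proof.
move=> F0 FD FZ; have [L HL] : exists L : ideal A, forall x, L x <->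
    forall a b, j (F (a * x * b)).
  unshelve eexists (@Ideal k A (fun x => forall a b, j (F (a * x * b))) _ _ _ _) => //.
  - by move=> a b; rewrite mulr0 mul0r F0; exact: ideal0.
  - by move=> x x' Hx Hx' a b; rewrite mulrDr mulrDl FD; exact: idealD.
  - by move=> c x Hx a b; rewrite mulrA.
  - by move=> c x Hx a b; rewrite mulrA -mulrA.
suff : ideal_ext j `<=` L by move=> jL /jL/HL/(_ 1 1); rewrite mul1r mulr1.
apply: ideal_ext_min => z jz; apply/HL => a b.
by rewrite -incl_central -mulrA FZ; exact: idealMr.
Qed.
End Extension.

(** * Cramer's rule and matrix units at a regular maximal ideal *)

Section RegularPoint.
Variables (k : closedFieldType) (A : algebra k) (d : nat).
Hypotheses (A_prime : prime_algebra A) (A_affine : affine A).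
Hypotheses (A_finite : module_finite_over_center A) (A_degree : PI_degree A d).
Variables (M : ideal A) (psi : A -> 'M[k]_d) (psiM : mx_rep M psi).
Local Notation Z := (center A).
Local Notation iota := (center_incl A).
Local Notation m := (ideal_preim (center_incl A) M).
Local Notation std x :=
  (forall i : 'I_(d ^ 2), psi (x i) = delta_mx (mxidx i).1 (mxidx i).2).

Let iota_inj : injective iota. Proof. exact: val_inj. Qed.
Let iotaM (x y : Z) : iota (x * y) = iota x * iota y. Proof. by []. Qed.
Let iotaD (x y : Z) : iota (x + y) = iota x + iota y. Proof. by []. Qed.
Let iotaN (x : Z) : iota (- x) = - iota x. Proof. by []. Qed.
Let iota1 : iota 1 = 1. Proof. by []. Qed.

(** Cramer's rule holds because [r] and the [d ^ 2] elements [x i] are dependent over the center;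
    the coefficient of [r] cannot vanish as [F x] is nonzero. The last clause holds because matrices
    at a nonregular ideal have size less than [d]. *)
Lemma local_form : exists F : ('I_(d ^ 2) -> A) -> Z,
  [/\ forall x, std x -> forall r, iota (F x) * r = \sum_i iota (F (upd x i r)) * x i,
      forall x, std x -> ~ m (F x),
      forall x i, [/\ F (upd x i 0) = 0, forall a b, F (upd x i (a + b)) =
        F (upd x i a) + F (upd x i b) & forall z a, F (upd x i (iota z * a)) = z * F (upd x i a)],
      forall x i r, M r -> m (F (upd x i r))
    & forall M', is_maximal_ideal M' -> ~ regular_ideal M' -> forall x, M' (iota (F x))].
Proof.
have [G [[Gc Galt Gb] GM' Gnz]] := central_form_exists A_prime A_affine A_finite A_degree psiM.
have /choice[F FE] x : exists z : Z, iota z = G x by have [z] := cval_onto A_prime (Gc x); exists z.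
have Glin x i : exists L, forall a, G (upd x i a) = biact L a by exact: Gb.
exists F; split.
- move=> x xs r; rewrite FE; under eq_bigr do rewrite FE.
  have Gx0 : G x <> 0 by move=> e; apply: (Gnz x xs); rewrite e; exact: ideal0.
  pose y (i : 'I_(d ^ 2).+1) := oapp x r (unlift ord0 i).
  have [c [cn]] := PI_dependent A_prime y A_degree (ltnSn _).
  rewrite big_ord_recl /y unlift_none /=; under eq_bigr do rewrite liftK /=.
  set S := \sum_(i < d ^ 2) _ => cS.
  (* Put the relation into slot [i] of the form: the terms with [x j], [j != i], repeat a variable
     and vanish. *)
  have cF i : cval (c ord0) * G (upd x i r) = - (cval (c (lift ord0 i)) * G x).
    have [L LP] := Glin x i; rewrite -{2}(upd_id x i) !LP -!biactZ; try exact: cval_central.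
    have -> : cval (c ord0) * r = - S by apply/eqP; rewrite -addr_eq0 cS.
    rewrite /S (bigD1 i) //= opprD biactD -[RHS]addr0; congr (_ + _).
      by rewrite /biact -sumrN; apply: eq_bigr => p _; rewrite mulrN mulNr.
    rewrite -sumrN biact_sum big1 // => j ji.
    rewrite -mulrN biactZ; last exact: cval_central.
    rewrite -[RHS](mulr0 (cval (c (lift ord0 j)))); congr (_ * _).
    rewrite -LP -[RHS]oppr0 -(Galt (upd x i (x j)) j i ji); last by rewrite /upd (negPf ji) eqxx.
    by rewrite !LP /biact -sumrN; apply: eq_bigr => p _; rewrite mulrN mulNr.
  have [c0|c0] := eqVneq (c ord0) 0.
    exfalso; case: cn => i0 /eqP; apply; case: (unliftP ord0 i0) => [i|] -> //.
    move: (cF i); rewrite c0 cval0 mul0r => /esym/eqP; rewrite oppr_eq0 => /eqP e.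
    apply/eqP/negP => /negP ci; apply: Gx0; exact: (cval_regular ci e).
  apply/eqP; rewrite -subr_eq0; apply/eqP/(cval_regular c0).
  rewrite mulrBr mulr_sumr; under eq_bigr do rewrite mulrA cF mulNr -mulrA.
  rewrite sumrN opprK mulrA (cval_central (c ord0) (G x)) -mulrA.
  under eq_bigr do rewrite mulrA cvalC -mulrA.
  by rewrite -mulr_sumr -mulrDr -/S cS mulr0.
- by move=> x xs h; apply: (Gnz x xs); rewrite -FE; exact: h.
- move=> x i; have [L LP] := Glin x i; split=> [|a b|z a]; apply: iota_inj.
  + by rewrite FE LP biact0.
  + by rewrite iotaD !FE !LP biactD.
  + by rewrite iotaM !FE !LP biactZ // => r; exact: incl_central.
- move=> x i r Mr; have [L LP] := Glin x i; suff : M (iota (F (upd x i r))) by [].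
  by rewrite FE LP; apply: ideal_sum => p _; apply: idealMr; exact: idealMl.
- move=> M' mM' nr x; rewrite FE.
  have [m' [psi' psi'M]] := maximal_mx_rep A_affine A_finite mM'.
  apply: (GM' M' m' psi' psi'M); rewrite ltn_neqAle.
  rewrite (mx_rep_size A_prime A_degree psi'M) andbT; apply/eqP => e.
  by apply: nr; apply/(regular_mx_rep A_prime A_degree psi'M).
Qed.

Lemma center_inverse (z : Z) l : ~ m z -> exists t, ideal_pow m l (1 - t * z).
Proof.
move=> mz; have cz : central (iota z) by move=> a; exact: incl_central.
have [c cE] := mx_rep_central psiM cz; have [_ L [p1 pM] _ kM] := psiM.
have c0 : c != 0.
  apply/eqP => c0; apply: mz; apply/kM.
  by rewrite -/(iota z) cE c0; apply/matrixP => i j; rewrite !mxE mul0rn.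
apply: (@inverse_mod_pow _ _ m (c^-1 *: (1 : Z)) z l).
apply/kM; rewrite -/(iota _) iotaD iotaN (linD _ _ L).
have -> : iota (c^-1 *: (1 : Z) * z) = c^-1 *: iota z by rewrite -ascalerAl mul1r.
rewrite -scaleN1r (linZ _ _ L) (linZ _ _ L) iota1 p1 cE scaleN1r.
by rewrite -mul_scalar_mx -scalar_mxM mulVf // subrr.
Qed.

(** For [r] in [M] the coefficients in Cramer's rule lie in m, and [F x] is invertible modulo m. *)
Lemma maximal_sub_ext : M `<=` ideal_ext (ideal_pow m 1).
Proof.
have [F [Fexp Fnz _ FM _]] := local_form; have [_ _ _ sj _] := psiM.
have /choice[x xs] (i : 'I_(d ^ 2)) : exists y, psi y = delta_mx (mxidx i).1 (mxidx i).2 by exact: sj.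
have [t tP] := center_inverse 1 (Fnz x xs).
have m1 z : m z -> ideal_pow m 1 z by move=> mz; rewrite -[z]mulr1; exact: ideal_mul_in.
move=> r Mr; have -> : r = iota t * (iota (F x) * r) + iota (1 - t * F x) * r.
  by rewrite iotaD iotaN iotaM mulrBl mulrA iota1 mul1r addrC subrK.
apply: idealD; last by apply: idealMr; exact: ideal_ext_in.
apply: idealMl; rewrite Fexp //; apply: ideal_sum => i _.
by apply: idealMr; apply: ideal_ext_in; apply: m1; exact: FM.
Qed.

Local Notation K l := (ideal_ext (ideal_pow m l.+1)).

Lemma ext_pow_mono l l' : (l <= l')%N -> K l' `<=` K l.
Proof. by move=> ll; apply: ideal_ext_mono; apply: ideal_powS. Qed.

Lemma ext_pow_sub l : K l `<=` M.
Proof.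
apply: ideal_ext_min => z h.
by have := ideal_powS (isT : (1 <= l.+1)%N) h; apply: (ideal_mul_min (K := m)) => x y mx _; exact: idealMr.
Qed.

(** [K l] is generated by the power [l + 1] of m, so its image modulo [K l.+1] has square zero. *)
Lemma matrix_units_step l n (E : 'I_n -> 'I_n -> A) : (0 < n)%N -> matrix_units (K l) E ->
  exists E' : 'I_n -> 'I_n -> A, matrix_units (K l.+1) E' /\
    forall a b, ideq (K l) (E' a b) (E a b).
Proof.
case: n E => // d' E _ [EM E1].
pose q := quot_pi (K l.+1); pose KQ0 := K l.
have [KQ HKQ] : exists KQ : ideal (quot (K l.+1)), forall x, KQ (q x) <-> K l x.
  unshelve eexists (@Ideal k (quot (K l.+1)) (fun x => exists2 y, K l y & x = q y) _ _ _ _).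
  - by exists 0; [exact: ideal0|rewrite /q (lin0 (quot_pi_linear _))].
  - move=> _ _ [x Kx ->] [y Ky ->]; exists (x + y); first exact: idealD.
    by rewrite /q (linD _ _ (quot_pi_linear _)).
  - elim/quot_ind=> a _ [x Kx ->]; exists (a * x); first exact: idealMl.
    by rewrite /q (quot_pi_monoid _).2.
  - elim/quot_ind=> a _ [x Kx ->]; exists (x * a); first exact: idealMr.
    by rewrite /q (quot_pi_monoid _).2.
  - move=> x; split=> [[y Ky /quot_piP xy]|Kx]; last by exists x.
    by rewrite -[x](subrK y); apply: idealD => //; exact: ext_pow_mono xy.
have qB x y : q x - q y = q (x - y).
  by rewrite -scaleN1r addrC -quot_pi_linear scaleN1r addrC.
have KQ2 x y : KQ x -> KQ y -> x * y = 0.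
  elim/quot_ind: x => x; elim/quot_ind: y => y /HKQ Kx /HKQ Ky.
  rewrite -(quot_pi_monoid _).2; apply/quot_eq0.
  have := ideal_ext_mul Kx Ky; apply: ideal_ext_mono.
  apply: (ideal_mul_min (K := ideal_pow m l.+2)) => u v mu mv.
  have := ideal_powD_in mu mv; apply: ideal_powS.
  by rewrite addSn ltnS leq_addl.
have qS (F : 'I_d'.+1 -> A) : \sum_a q (F a) = q (\sum_a F a).
  by rewrite /q (linD_sum _ _ (quot_pi_linear _)).
have q0 : q 0 = 0 by rewrite /q (lin0 (quot_pi_linear _)).
have [|E' [[EM' E1'] EE']] := @lift_matrix_units0 _ _ KQ d' (fun a b => q (E a b)) KQ2.
  split=> [a b c e|].
    have -> : (if b == c then q (E a e) else 0) = q (if b == c then E a e else 0).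
      by case: eqP.
    by rewrite -(quot_pi_monoid _).2 /ideq qB; apply/HKQ; exact: EM.
  by rewrite /ideq qS -(quot_pi_monoid _).1 qB; apply/HKQ; exact: E1.
pose E2 a b : A := repr (E' a b : quot_sort (K l.+1)).
have qE2 a b : q (E2 a b) = E' a b by rewrite /q /quot_pi reprK.
exists E2; split; first split.
- move=> a b c e; rewrite /ideq -quot_eq0 -/(q _) -qB.
  have -> : q (if b == c then E2 a e else 0) = if b == c then E' a e else 0.
    by case: eqP; rewrite ?qE2.
  rewrite /q (quot_pi_monoid _).2 -/q; apply/eqP; rewrite subr_eq0; apply/eqP.
  have /eqP := EM' a b c e; rewrite subr_eq0 => /eqP <-.
  by rewrite -!qE2.
- rewrite /ideq -quot_eq0 -/(q _) -qB -qS; under eq_bigr do rewrite qE2.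
  have /eqP := E1'; rewrite subr_eq0 => /eqP ->.
  by rewrite /q (quot_pi_monoid _).1 subrr.
- by move=> a b; rewrite /ideq -HKQ -qB qE2; exact: EE'.
Qed.

(** The congruence between consecutive stages makes the coordinates at different powers of m agree,
    which is [co_le] below. *)
Lemma matrix_units_chain : exists E : nat -> 'I_d -> 'I_d -> A,
  forall l, [/\ matrix_units (K l) (E l), forall a b, psi (E l a b) = delta_mx a b
    & forall a b, ideq (K l) (E l.+1 a b) (E l a b)].
Proof.
have [d0 L [p1 pM] sj kM] := psiM.
have pB x y : psi x = psi y <-> M (x - y).
  rewrite -kM -scaleN1r addrC L scaleN1r addrC; split=> [->|/eqP]; first by rewrite subrr.
  by rewrite subr_eq0 => /eqP.
have /choice[E0 E0P] (p : 'I_d * 'I_d) : exists x, psi x = delta_mx p.1 p.2 by exact: sj.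
have base : matrix_units (K 0%N) (fun a b => E0 (a, b)).
  split=> [a b c e|].
    apply: maximal_sub_ext; apply/pB; rewrite pM !E0P /= -mulmxE.
    case: eqP => [->|/eqP bc]; first by rewrite mul_delta_mx E0P.
    by rewrite mul_delta_mx_0 // (lin0 L).
  apply: maximal_sub_ext; apply/pB; rewrite (linD_sum _ _ L) p1.
  under eq_bigr do rewrite E0P /=.
  apply/matrixP => a b; rewrite summxE mxE (bigD1 a) //= big1 ?addr0 => [|c ca].
    by rewrite mxE eqxx /= eq_sym.
  by rewrite mxE eq_sym (negPf ca).
have /choice[nx nxP] (p : nat * ('I_d -> 'I_d -> A)) : exists E', matrix_units (K p.1) p.2 ->
    matrix_units (K p.1.+1) E' /\ forall a b, ideq (K p.1) (E' a b) (p.2 a b).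
  have [h|h] := pselect (matrix_units (K p.1) p.2); last by exists p.2 => /h.
  by have [E' E'P] := matrix_units_step d0 h; exists E'.
pose E := fix E l := if l is l'.+1 then nx (l', E l') else (fun a b => E0 (a, b)).
have EU l : matrix_units (K l) (E l).
  by elim: l => // l IH; have [] := nxP (l, E l) IH.
exists E => l; split=> //; last by have [] := nxP (l, E l) (EU l).
elim: l => [|l IH] a b; first by rewrite /= E0P.
rewrite -IH; apply/pB; apply: (@ext_pow_sub l).
by have [_] := nxP (l, E l) (EU l); exact.
Qed.

End RegularPoint.

(* [co l r c]: modulo the (l+1)-st power of the maximal ideal m of the center,
   the element r is the matrix c with central entries. *)
Record coordinates (k : fieldType) (A : algebra k) (m : ideal (center A)) (d : nat)
  (co : nat -> A -> ('I_d -> 'I_d -> center A) -> Prop) : Prop := Coordinates {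
  co_ex : forall l r, exists c, co l r c;
  co_uniq : forall l r c c', co l r c -> co l r c' ->
    forall a b, ideal_pow m l.+1 (c a b - c' a b);
  co_le : forall l l' r c, (l <= l')%N -> co l' r c -> co l r c;
  co_lin : forall l x r r' c c', co l r c -> co l r' c' ->
    co l (x *: r + r') (fun a b => x *: c a b + c' a b);
  co_mul : forall l r r' c c', co l r c -> co l r' c' ->
    co l (r * r') (fun a b => \sum_e c a e * c' e b);
  co_center : forall l z, co l (center_incl A z) (fun a b => if a == b then z else 0);
  co_ker : forall (j : ideal (center A)) l r c, co l r c -> (forall a b, j (c a b)) ->
    exists r0, ideal_ext j r0 /\ ideal_ext (ideal_pow m l.+1) (r - r0);
  co_onto : forall l c, exists r, co l r c }.

Section Coordinates.
Variables (k : closedFieldType) (A : algebra k) (d : nat).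
Hypotheses (A_prime : prime_algebra A) (A_affine : affine A).
Hypotheses (A_finite : module_finite_over_center A) (A_degree : PI_degree A d).
Variables (M : ideal A) (psi : A -> 'M[k]_d) (psiM : mx_rep M psi).
Local Notation Z := (center A).
Let iota (z : Z) : A := center_incl A z.
Local Notation m := (ideal_preim (center_incl A) M).
Local Notation K l := (ideal_ext (ideal_pow m l.+1)).

Let iotaM (x y : Z) : iota (x * y) = iota x * iota y. Proof. by []. Qed.
Let iotaD (x y : Z) : iota (x + y) = iota x + iota y. Proof. by []. Qed.
Let iotaN (x : Z) : iota (- x) = - iota x. Proof. by []. Qed.
Let iota1 : iota 1 = 1. Proof. by []. Qed.
Let iota0 : iota 0 = 0. Proof. by []. Qed.
Let iotaS (I : Type) (s : seq I) (F : I -> Z) :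
  iota (\sum_(i <- s) F i) = \sum_(i <- s) iota (F i).
Proof. exact: (linD_sum _ _ (alghom_linear (center_incl A))). Qed.

Lemma coordinates_exist : exists co, @coordinates k A m d co.
Proof.
have [E EP] := matrix_units_chain A_prime A_affine A_finite A_degree psiM.
have [F [Fexp Fnz Flin _ _]] := local_form A_prime A_affine A_finite A_degree psiM.
pose comb l (c : 'I_d -> 'I_d -> Z) := \sum_a \sum_b iota (c a b) * E l a b.
have combD l c c' : comb l c + comb l c' = comb l (fun a b => c a b + c' a b).
  rewrite -big_split; apply: eq_bigr => a _; rewrite -big_split; apply: eq_bigr => b _.
  by lazy beta; rewrite iotaD mulrDl.
have combM l z c : iota z * comb l c = comb l (fun a b => z * c a b).
  rewrite mulr_sumr; apply: eq_bigr => a _; rewrite mulr_sumr; apply: eq_bigr => b _.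
  by rewrite iotaM mulrA.
have EM l : matrix_units (K l) (E l) by have [] := EP l.
pose x l i := E l (mxidx i).1 (mxidx i).2.
have xs l i : psi (x l i) = delta_mx (mxidx i).1 (mxidx i).2 by have [_ + _] := EP l; apply.
have inv l : exists t, ideal_pow m l.+1 (1 - t * F (x l)).
  by apply: (center_inverse psiM); exact: Fnz.
(* The extended ideal meets the center in the ideal itself: slot [i] of the form is linear over the
   center and sends [z * x i] to [z * F x], where [F x] is invertible. *)
have ext_center l z : K l (iota z) -> ideal_pow m l.+1 z.
  move=> Kz; have [t tP] := inv l; have [d0 _ _ _ _] := psiM.
  pose i := idxmx (Ordinal d0, Ordinal d0); have [F0 FD FZ] := Flin (x l) i.
  have := ideal_ext_linear_form F0 FD FZ (idealMr (x l i) Kz).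
  rewrite FZ upd_id => h.
  have -> : z = t * (z * F (x l)) + (1 - t * F (x l)) * z.
    rewrite (@comalg_mulC _ Z z) mulrA mulrBl mul1r addrC subrK //.
  by apply: idealD; [exact: idealMl|exact: idealMr].
have mulE l c c' : ideq (K l) (comb l c * comb l c') (comb l (fun a b => \sum_e c a e * c' e b)).
  have -> : comb l (fun a b => \sum_e c a e * c' e b) =
      \sum_a \sum_b \sum_u \sum_v iota (c a b * c' u v) * (if b == u then E l a v else 0).
    apply: eq_bigr => a _; rewrite [RHS](eq_bigr (fun b => \sum_v iota (c a b * c' b v) * E l a v)).
      rewrite exchange_big; apply: eq_bigr => v _; lazy beta; rewrite -mulr_suml iotaS //.
    move=> b _; rewrite (bigD1 b) //= [X in _ + X]big1 ?addr0 => [|u ub].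
      by apply: eq_bigr => v _; rewrite eqxx.
    by rewrite big1 // => v _; rewrite eq_sym (negPf ub) mulr0.
  rewrite mulr_suml; apply: ideq_sum => a _; rewrite mulr_suml; apply: ideq_sum => b _.
  rewrite mulr_sumr; apply: ideq_sum => u _; rewrite mulr_sumr; apply: ideq_sum => v _.
  have -> : iota (c a b) * E l a b * (iota (c' u v) * E l u v) =
      iota (c a b * c' u v) * (E l a b * E l u v).
    by rewrite iotaM -!mulrA; congr (_ * _); rewrite mulrA -incl_central mulrA.
  by apply: ideqMl; exact: (EM l).1.
have oneE l z : ideq (K l) (iota z) (comb l (fun a b => if a == b then z else 0)).
  have -> : comb l (fun a b => if a == b then z else 0) = iota z * \sum_a E l a a.
    rewrite mulr_sumr; apply: eq_bigr => a _; rewrite (bigD1 a) //= eqxx big1 ?addr0 //.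
    by move=> b ba; rewrite eq_sym (negPf ba); exact: mul0r.
  by rewrite -{1}[iota z]mulr1; apply: ideqMl; apply: ideq_sym; exact: (EM l).2.
have uniq0 l (c : 'I_d -> 'I_d -> Z) : K l (comb l c) -> forall a b, ideal_pow m l.+1 (c a b).
  move=> h a b; apply: ext_center.
  pose dl (u v : 'I_d) := fun a' b' : 'I_d => if (a' == u) && (b' == v) then 1 else 0 : Z.
  have dl1 u v : dl u v u v = 1 by rewrite /dl !eqxx.
  have dl0 u v a' b' : (a' != u) || (b' != v) -> dl u v a' b' = 0.
    by rewrite -negb_and /dl => /negPf ->.
  have dlE u v : comb l (dl u v) = E l u v.
    rewrite /comb (bigD1 u) //= (bigD1 v) //= dl1 iota1 mul1r.
    rewrite big1 ?addr0 => [|b' bv]; last by rewrite dl0 ?bv ?orbT // iota0 mul0r.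
    rewrite big1 ?addr0 // => a' au; rewrite big1 // => b' _.
    by rewrite dl0 ?au // iota0 mul0r.
  (* The units [E u a] and [E b u] extract the entry at [(a, b)] and spread it along the diagonal,
     which yields a central element. *)
  have e : ideq (K l) (\sum_u E l u a * comb l c * E l b u) (iota (c a b)).
    apply: ideq_trans (ideq_sym (oneE l _)).
    have -> : comb l (fun a0 b0 => if a0 == b0 then c a b else 0) =
        \sum_u comb l (fun a' b' => \sum_e (\sum_f dl u a a' f * c f e) * dl b u e b').
      rewrite /comb [RHS]exchange_big; apply: eq_bigr => a' _; lazy beta.
      rewrite [RHS]exchange_big; apply: eq_bigr => b' _; lazy beta.
      rewrite -mulr_suml -iotaS; congr (iota _ * _).
      rewrite (bigD1 a') //= [X in _ + X]big1 ?addr0 => [|u ua]; last first.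
        rewrite big1 // => e' _; rewrite big1 ?mul0r // => f _.
        by rewrite dl0 ?mul0r // eq_sym ua.
      rewrite (bigD1 b) //= [X in _ + X]big1 ?addr0 => [|e' eb]; last first.
        by rewrite (dl0 b) ?eb // mulr0.
      rewrite (bigD1 a) //= [X in _ + X]big1 ?addr0 => [|f fa]; last first.
        by rewrite dl0 ?fa ?orbT // mul0r.
      rewrite dl1 mul1r; case: eqP => [<-|/eqP ab]; first by rewrite dl1 mulr1.
      by rewrite dl0 ?mulr0 // eq_sym ab orbT.
    apply: ideq_sum => u _; apply: ideq_trans (mulE _ _ _); rewrite dlE.
    by apply: ideqMr; apply: ideq_trans (mulE _ _ _); rewrite dlE; exact: ideq_refl.
  rewrite -ideq0; apply: ideq_trans (ideq_sym e) _.
  by apply/ideq0/ideal_sum => u _; apply: idealMr; exact: idealMl.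
have combN l (c : 'I_d -> 'I_d -> Z) : - comb l c = comb l (fun a b => - c a b).
  rewrite -sumrN; apply: eq_bigr => a _; rewrite -sumrN; apply: eq_bigr => b _.
  by rewrite iotaN mulNr.
have chain l l' a b : (l <= l')%N -> ideq (K l) (E l' a b) (E l a b).
  move=> /subnK <-; elim: (l' - l)%N => [|n IH]; first exact: ideq_refl.
  apply: ideq_trans IH; have [_ _ h] := EP (n + l)%N.
  exact: (ext_pow_mono (leq_addl n l)) (h a b).
exists (fun l r c => ideq (K l) r (comb l c)); split.
(* The coordinates are the coefficients of Cramer's rule divided by [F x] modulo the power of m. *)
- move=> l r; have [t tP] := inv l.
  exists (fun a b => t * F (upd (x l) (idxmx (a, b)) r)).
  have -> : comb l (fun a b => t * F (upd (x l) (idxmx (a, b)) r)) = iota (t * F (x l)) * r.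
    rewrite iotaM -mulrA Fexp // mulr_sumr /comb pair_bigA /=.
    rewrite (reindex (@mxidx d)); last first.
      by exists (@idxmx d) => y _; [exact: mxidxK|exact: idxmxK].
    by apply: eq_bigr => i _; rewrite -surjective_pairing mxidxK iotaM mulrA.
  rewrite /ideq -{1}[r]mul1r -mulrBl -iota1 -iotaN -iotaD.
  by apply: idealMr; exact: ideal_ext_in.
- move=> l r c c' h h' a b; apply: (uniq0 l (fun a b => c a b - c' a b)).
  by rewrite -combD -combN; exact: ideq_trans (ideq_sym h) h'.
- move=> l l' r c ll h; apply: (ideq_trans (y := comb l' c)).
    exact: ext_pow_mono ll _ h.
  by apply: ideq_sum => a _; apply: ideq_sum => b _; apply: ideqMl; exact: chain.
- move=> l y r r' c c' h h'.
  have -> : comb l (fun a b => y *: c a b + c' a b) = y *: comb l c + comb l c'.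
    rewrite -combD; congr (_ + _).
    rewrite scaler_sumr; apply: eq_bigr => a _; rewrite scaler_sumr; apply: eq_bigr => b _.
    by rewrite [iota _](linZ _ _ (alghom_linear (center_incl A))) ascalerAl.
  by apply: ideqD => //; rewrite /ideq -scalerBr; exact: idealZ.
- by move=> l r r' c c' h h'; apply: ideq_trans (mulE l c c'); exact: ideqM.
- by move=> l z; exact: oneE.
- move=> j l r c h jc; exists (comb l c); split=> //.
  apply: ideal_sum => a _; apply: ideal_sum => b _.
  by apply: idealMr; exact: ideal_ext_in.
- by move=> l c; exists (comb l c); exact: ideq_refl.
Qed.
End Coordinates.

(** * Finite closed subschemes *)

Section Fitting.
Variables (k : fieldType) (A : algebra k) (n : nat) (j : ideal A).
Hypothesis cj : cofinite n j.

(** The chain of subspaces [z^i A + j] becomes stationary. *)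
Lemma fitting (z : A) : central z -> exists a w, j (z ^+ a * (1 - z * w)).
Proof.
move=> cz; have [h [hL hj]] := cj; have [mu [mun muP]] := codim_measure hL.
pose P i := [set x : A | exists y, j (x - z ^+ i * y)].
have lP i : lin_closed (P i).
  split; first by exists 0; rewrite mulr0 subrr; exact: ideal0.
  move=> c x y [u Pu] [v Pv]; exists (c *: u + v).
  rewrite mulrDr -ascalerAr opprD addrACA -scalerBr; apply: idealD => //.
  exact: idealZ.
have kP i x : h x = 0 -> P i x by move=> /hj jx; exists 0; rewrite mulr0 subr0.
have PS i : P i.+1 `<=` P i by move=> x [y]; rewrite exprSr -mulrA => ?; exists (z * y).
have [i st] : exists i, P i `<=` P i.+1.
  apply: contrapT => H.
  have lt i : (mu (P i.+1) < mu (P i))%N.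
    have [le eq] := muP _ _ (lP i.+1) (@kP i.+1) (@PS i).
    by rewrite ltn_neqAle le andbT; apply/eqP => /eq PP; apply: H; exists i.
  have le i : (mu (P i) + i <= mu (P 0%N))%N.
    elim: i => [|i IH]; first by rewrite addn0.
    by apply: leq_trans IH; rewrite addnS -addSn leq_add2r lt.
  have := leq_trans (le (mu (P 0%N)).+1) (leqnn _).
  by rewrite addnS ltnNge leq_addl.
have [|w] := st (z ^+ i); first by exists 1; rewrite mulr1 subrr; exact: ideal0.
by rewrite exprSr -mulrA => h1; exists i, w; rewrite mulrBr mulr1.
Qed.
End Fitting.

Lemma geometric_factor (A : pzRingType) (t : A) a : exists v, 1 - t ^+ a = (1 - t) * v.
Proof.
elim: a => [|a [v e]]; first by exists 0; rewrite subrr mulr0.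
exists (v + t ^+ a); rewrite mulrDr -e mulrBl mul1r exprS addrA subrK //.
Qed.

(** * Primary decomposition of cofinite ideals *)

Section Primary.
Variables (k : closedFieldType) (C : comalgebra k).

(** A partition of unity modulo [j] in place of an intersection of primary ideals: [eps i] is
    supported at [m i] to order [L]. Neither idempotence of the [eps i] nor distinctness of the
    [m i] is part of the notion. *)
Definition primary_decomposition (j : ideal C) :=
  exists N (m : 'I_N -> ideal C) (eps : 'I_N -> C) L,
  [/\ forall i, is_maximal_ideal (m i), forall i, j `<=` m i,
      j (1 - \sum_i eps i) & forall i x, ideal_pow (m i) L x -> j (eps i * x)].

Let mulC (x y : C) : x * y = y * x. Proof. exact: comalg_mulC. Qed.
Let allcentral (x : C) : central x. Proof. by move=> y; exact: mulC. Qed.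

Definition ideal_addp (j : ideal C) (z : C) : ideal C.
Proof.
apply: (@Ideal k C (fun x => exists y, j (x - z * y))).
- by exists 0; rewrite mulr0 subrr; exact: ideal0.
- move=> x y [u Pu] [v Pv]; exists (u + v).
  by rewrite mulrDr opprD addrACA; exact: idealD.
- move=> a x [u Pu]; exists (a * u).
  by rewrite mulrA [z * a]mulC -mulrA -mulrBr; exact: idealMl.
- move=> a x [u Pu]; exists (u * a).
  by rewrite mulrA -mulrBl; exact: idealMr.
Defined.

Lemma ideal_addp_sub (j : ideal C) z : j `<=` ideal_addp j z.
Proof. by move=> x jx; exists 0; rewrite mulr0 subr0. Qed.
Lemma ideal_addp_in (j : ideal C) z : ideal_addp j z z.
Proof. by exists 1; rewrite mulr1 subrr; exact: ideal0. Qed.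

(* If some z lies in one maximal ideal above j and not in another then, by
   Fitting, z^a (1 - z w) lies in j, and j is split by the coprime ideals
   j + (z^a) and j + (1 - z w); otherwise j is primary. *)
Lemma cofinite_primary n (j0 : ideal C) : cofinite n j0 -> primary_decomposition j0.
Proof.
move=> cj0; have [h [hL hj]] := cj0; have [mu [mun muP]] := codim_measure hL.
suff main b (j : ideal C) : j0 `<=` j -> (n - mu j < b)%N -> primary_decomposition j.
  exact: (main (n - mu j0).+1).
elim: b j => // b IH j jj; rewrite ltnS => jb.
have bigger (j' : ideal C) : j `<=` j' -> ~ j' `<=` j -> primary_decomposition j'.
  move=> jj' nj; apply: IH; first by move=> x /jj /jj'.
  have [le eq] := muP j j' (ideal_lin_closed _) (fun x hx => jj _ ((hj x).1 hx)) jj'.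
  apply: leq_trans jb; apply: ltn_sub2l; last first.
    by rewrite ltn_neqAle le andbT; apply/eqP => /eq.
  apply: leq_trans (mun j'); rewrite ltn_neqAle le andbT; apply/eqP => /eq //.
have [j1|j1] := pselect (j 1).
  by exists 0%N, (fun=> j), (fun=> 0), 0%N; split=> [[]|[]||[]] //; rewrite big_ord0 subr0.
have [[m1 [m2 [mm1 mm2 jm1 jm2 [z m1z m2z]]]]|uni] := pselect (exists m1 m2,
    [/\ is_maximal_ideal m1, is_maximal_ideal m2, j `<=` m1, j `<=` m2
      & exists2 z, m1 z & ~ m2 z]); last first.
  have [m [mm jm]] := maximal_above j1.
  (* Every maximal ideal above [j] contains [m], so the radical argument puts the power [n] of [m]
     into [j]. *)
  exists 1%N, (fun=> m), (fun=> 1), n; split=> //.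
    by rewrite big_ord1 subrr; exact: ideal0.
  move=> _ x; rewrite mul1r; apply: cofinite_radical_pow; first exact: cofinite_sup cj0.
  move=> M mM jM z mz; apply: contrapT => Mz; apply: uni.
  by exists m, M; split=> //; exists z.
have [a [w zw]] := fitting (cofinite_sup jj cj0) (allcentral z).
have [v vE] := geometric_factor (z * w) a.
have zwa : (z * w) ^+ a = z ^+ a * w ^+ a.
  by rewrite exprMn_comm //; exact: mulC.
have [|N1 [p1 [e1 [L1 [P1 P2 P3 P4]]]]] := bigger (ideal_addp j (z ^+ a)) (@ideal_addp_sub _ _).
  move=> /(_ _ (ideal_addp_in _ _)) /jm2 m2za.
  have [_ m2p] := (prime_idealP m2).1 (maximal_prime mm2).
  clear zw vE zwa; elim: a m2za => [|a IHa]; first exact: mm2.1.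
  rewrite exprS => m2a; have [||] // := m2p z (z ^+ a).
  by move=> x; rewrite -mulrA mulC -mulrA [_ * z]mulC; exact: idealMl.
have [|N2 [p2 [e2 [L2 [Q1 Q2 Q3 Q4]]]]] := bigger (ideal_addp j (1 - z * w)) (@ideal_addp_sub _ _).
  move=> /(_ _ (ideal_addp_in _ _)) /jm1 m1w; apply: mm1.1.
  by rewrite -[1](subrK (z * w)); apply: idealD => //; exact: idealMr.
(* [t + u = 1], while modulo [j] the element [t] kills [z ^+ a] and [u] kills [1 - z * w]; so they
   combine the two partitions of unity. *)
pose t := (1 - z * w) * v; pose u := (z * w) ^+ a.
have tu : t + u = 1 by rewrite /t -vE subrK.
have tj x : ideal_addp j (z ^+ a) x -> j (t * x).
  move=> [y jy]; rewrite -[x](subrK (z ^+ a * y)) mulrDr; apply: idealD; first exact: idealMl.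
  have -> : t * (z ^+ a * y) = z ^+ a * (1 - z * w) * (v * y).
    by rewrite mulrA [t * _]mulC /t !mulrA.
  exact: idealMr.
have uj x : ideal_addp j (1 - z * w) x -> j (u * x).
  move=> [y jy]; rewrite -[x](subrK ((1 - z * w) * y)) mulrDr; apply: idealD; first exact: idealMl.
  rewrite mulrA; apply: idealMr; rewrite /u zwa -mulrA [w ^+ a * _]mulC mulrA; exact: idealMr.
exists (N1 + N2)%N, (fun i => match split i with inl i => p1 i | inr i => p2 i end),
  (fun i => match split i with inl i => t * e1 i | inr i => u * e2 i end), (L1 + L2)%N.
split=> [i|i||i x].
- by case: (split i).
- by move=> x jx; case: (split i) => l; [apply: P2|apply: Q2]; exact: ideal_addp_sub.
- rewrite big_split_ord /=.
  under eq_bigr do rewrite (unsplitK (inl _)).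
  under [X in _ - (_ + X)]eq_bigr do rewrite (unsplitK (inr _)).
  rewrite -!mulr_sumr -{1}tu opprD addrACA -{1}[t]mulr1 -{1}[u]mulr1 -!mulrBr.
  by apply: idealD; [exact: tj|exact: uj].
- case: (split i) => l mx; rewrite -mulrA; [apply: tj|apply: uj].
    by apply: P4; exact: (ideal_powS (leq_addr L2 L1)) mx.
  by apply: Q4; exact: (ideal_powS (leq_addl L1 L2)) mx.
Qed.
End Primary.

(** * Finite closed subschemes of the open set as cofinite ideals of the center *)

Section Subschemes.
Variables (k : closedFieldType) (C : comalgebra k) (I : ideal C).
Implicit Types S T : finite_closed_subscheme I.

Let mulC (x y : C) : x * y = y * x. Proof. exact: comalg_mulC. Qed.

Lemma spec_pointP (B : comalgebra k) (p : ideal B) : spec_point p <-> is_prime_ideal p.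
Proof.
rewrite prime_idealP; split=> -[p1 h]; split=> // a b pab.
  by apply: h; rewrite -[a]mulr1.
apply: h => x; rewrite -mulrA [x * b](@comalg_mulC _ B) mulrA; exact: idealMr.
Qed.

Definition subker S : ideal C := ideal_preim (subscheme_map S) (zero_ideal _).
Local Notation phi := subscheme_map.

Lemma subker_cofinite S : cofinite (subscheme_dim S) (subker S).
Proof.
exists (fun z => subscheme_map S z : 'rV[k]_(subscheme_dim S)).
by split=> //; exact: (alghom_linear (subscheme_map S)).
Qed.

Let phiM S x y : phi S (x * y) = phi S x * phi S y.
Proof. exact: (alghom_monoid (phi S)).2. Qed.
Let phi1 S : phi S 1 = 1. Proof. exact: (alghom_monoid (phi S)).1. Qed.
Let phiD S x y : phi S (x + y) = phi S x + phi S y.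
Proof. exact: (linD _ _ (alghom_linear (phi S))). Qed.
Let phi0 S : phi S 0 = 0. Proof. exact: (lin0 (alghom_linear (phi S))). Qed.
Let phiB S x y : phi S (x - y) = phi S x - phi S y.
Proof. by rewrite phiD -scaleN1r (linZ _ _ (alghom_linear (phi S))) scaleN1r. Qed.

(** A closed immersion into the open set is only known to be surjective on stalks. If the ideal of
    those [z] with [phi z * b] in the image were proper, it would lie in a maximal ideal [m]. As [m]
    contains the kernel, it is the image of a point of S, and surjectivity on the stalk there gives
    an element of the ideal outside [m]. *)
Lemma subscheme_surj S : forall b : coordinate_algebra S, exists z, phi S z = b.
Proof.
have [cl1 _ _ cl4] := subscheme_closed S; set f := phi S.
set B := coordinate_algebra S.
have mulB (x y : B) : x * y = y * x by exact: comalg_mulC.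
move=> b; have [c cP] : exists c : ideal C, forall z, c z <-> exists z', f z * b = f z'.
  unshelve eexists (@Ideal k C (fun z => exists z', f z * b = f z') _ _ _ _) => //.
  - by exists 0; rewrite /f !phi0 mul0r.
  - by move=> x y [x' ex] [y' ey]; exists (x' + y'); rewrite /f !phiD mulrDl -/f ex ey.
  - by move=> a x [x' ex]; exists (a * x'); rewrite /f !phiM -mulrA -/f ex.
  - by move=> a x [x' ex]; exists (a * x'); rewrite mulC /f !phiM -mulrA -/f ex.
have [/cP[z]|c1] := pselect (c 1); first by rewrite /f phi1 mul1r => e; exists z.
exfalso; have [m [mm cm]] := maximal_above c1; have m1 := mm.1.
have mp := (spec_pointP m).2 (maximal_prime mm).
have jm : subker S `<=` m.
  by move=> z; rewrite /subker /= => fz; apply: cm; apply/cP; exists 0; rewrite /f fz mul0r phi0.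
have [N [p [eps [L [P1 P2 P3 P4]]]]] := cofinite_primary (subker_cofinite S).
have [i mi] : exists i, ~ m (eps i).
  apply: contrapT => H; apply: m1; rewrite -[1](subrK (\sum_i eps i)).
  apply: idealD; first exact: jm; apply: ideal_sum => i _.
  by apply: contrapT => ?; apply: H; exists i.
have pm : p i `<=` m.
  move=> x px; have /jm mx := P4 i _ (ideal_powX L px).
  have {mx}[//|] := mp.2 _ _ mx.
  elim: (L) => [|l IH]; first by move=> /m1.
  by rewrite exprS => /mp.2[].
have mp' : m `<=` p i by apply: (P1 i).2.
(* There is a point of S above [p i] because [Q] is proper: otherwise the nilpotence of [p i] on
   [f (eps i)] would give [f (eps i) = 0]. *)
pose Q := ideal_gen [set x : B | exists2 z, p i z & x = f z].
have Q1 : ~ Q 1.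
  move=> Q1; have H l : (forall x, ideal_pow (p i) l x -> f (eps i * x) = 0) -> f (eps i) = 0.
    elim: l => [h|l IH h]; first by rewrite -[eps i]mulr1 h.
    apply: IH => x px.
    have [R RP] : exists R : ideal B, forall y, R y <-> f (eps i * x) * y = 0.
      unshelve eexists (@Ideal k B (fun y => f (eps i * x) * y = 0) _ _ _ _) => //.
      all: cbv beta.
      - exact: mulr0.
      - by move=> u v eu ev; rewrite mulrDr eu ev addr0.
      - by move=> a u eu; rewrite mulrA [_ * a]mulB -mulrA eu mulr0.
      - by move=> a u eu; rewrite mulrA eu mul0r.
    suff QR : Q `<=` R by have /RP := QR 1 Q1; rewrite mulr1.
    move=> y; apply=> _ [z pz ->]; apply/RP; rewrite /f -phiM -mulrA.
    by apply: h; rewrite mulC; exact: ideal_mul_in.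
  by apply/mi/jm/(H L) => x /P4.
have [q [mq Qq]] := maximal_above Q1.
have sq := (spec_pointP q).2 (maximal_prime mq).
have [[q1 qp] oq] := cl1 q sq.
have pq : p i `<=` ideal_preim f q.
  by move=> z pz; apply: Qq => R h; apply: h; exists z.
have [a [s [u [ps pu e]]]] := cl4 _ (cl1 q sq) b 1 q1.
have : c (u * s).
  apply/cP; exists (u * a); rewrite -/f in e *; rewrite /f !phiM -mulrA -/f e.
  by rewrite /f phi1 mul1r.
move=> /cm /mp' /pq /qp[]; [exact: pu|exact: ps].
Qed.

(** A maximal ideal above both [I] and the kernel would be the image of a point of S outside the
    open set. *)
Lemma subscheme_coprime S : exists2 x, I x & subker S (1 - x).
Proof.
apply: contrapT => H.
have [|m [mm am]] := @maximal_above _ _ (ideal_add I (subker S)).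
  by move=> [x [y [Ix jy e]]]; apply: H; exists x => //; rewrite e addrC addKr.
have jm z : phi S z = 0 -> m z by move=> e; apply: am; exact: ideal_addr.
have mp := (spec_pointP m).2 (maximal_prime mm).
have eqm x y : phi S x = phi S y -> m y -> m x.
  move=> e my; rewrite -[x](subrK y); apply: idealD => //; apply: jm.
  by rewrite phiB e subrr.
have [q qP] : exists q : ideal (coordinate_algebra S), forall b, q b <->
    exists2 z, m z & b = phi S z.
  unshelve eexists (@Ideal k (coordinate_algebra S) (fun b => exists2 z, m z & b = phi S z)
     _ _ _ _) => //.
  - by exists 0; [exact: ideal0|rewrite phi0].
  - by move=> _ _ [x mx ->] [y my ->]; exists (x + y); [exact: idealD|rewrite phiD].
  - move=> a _ [x mx ->]; have [z <-] := subscheme_surj a.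
    by exists (z * x); [exact: idealMl|rewrite phiM].
  - move=> a _ [x mx ->]; have [z <-] := subscheme_surj a.
    by exists (x * z); [exact: idealMr|rewrite phiM].
have qm z : q (phi S z) -> m z by move=> /qP[y my e]; exact: eqm my.
have [cl1 _ _ _] := subscheme_closed S.
have [|_ oq] := cl1 q.
  split; first by rewrite -(phi1 S) => /qm; exact: mp.1.
  move=> a b; have [x <-] := subscheme_surj a; have [y <-] := subscheme_surj b.
  rewrite -phiM => /qm /mp.2[mx|my]; [left|right]; apply/qP.
    by exists x.
  by exists y.
by apply: oq => x Ix; apply/qP; exists x => //; apply: am; exact: ideal_addl.
Qed.

(** The quotient by [j] is transported to [k^N] along a linear bijection; the element [x] keeps its
    spectrum away from the zero locus of [I]. *)
Lemma subscheme_exists (j : ideal C) n : cofinite n j -> (exists2 x, I x & j (1 - x)) ->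
  exists S, forall z, subker S z <-> j z.
Proof.
move=> cj [x Ix jx]; have [N [[f fL [g fK gK]]]] := (findim_cofinite j).2 (ex_intro _ n cj).
pose Q := quot j.
have gL : linear g by move=> c u v; apply: (can_inj fK); rewrite fL !gK.
pose mul u v := f (g u * g v).
have QmulC (u v : Q) : u * v = v * u.
  elim/quot_ind: u => u; elim/quot_ind: v => v.
  by rewrite -!(quot_pi_monoid j).2 mulC.
have mA : associative mul by move=> u v w; rewrite /mul !fK mulrA.
have m1 : left_id (f 1) mul by move=> u; rewrite /mul fK mul1r gK.
have mr1 : right_id (f 1) mul by move=> u; rewrite /mul fK mulr1 gK.
have mDl : left_distributive mul +%R.
  by move=> u v w; rewrite /mul (linD _ _ gL) mulrDl (linD _ _ fL).
have mDr : right_distributive mul +%R.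
  by move=> u v w; rewrite /mul (linD _ _ gL) mulrDr (linD _ _ fL).
have mAl (c : k) u v : c *: mul u v = mul (c *: u) v.
  by rewrite /mul (linZ _ _ gL) -ascalerAl (linZ _ _ fL).
have mAr (c : k) u v : c *: mul u v = mul u (c *: v).
  by rewrite /mul (linZ _ _ gL) -ascalerAr (linZ _ _ fL).
pose str : alg_on 'rV[k]_N := AlgOn mA m1 mr1 mDl mDr mAl mAr.
have strC : commutative (@GRing.mul (Algebra str)).
  by move=> u v; rewrite /GRing.mul /= /mul QmulC.
pose F (z : C) : ComAlgebra strC := f (quot_pi j z).
have FL : linear F by move=> c u v; rewrite /F quot_pi_linear fL.
have FM : monoid_morphism F.
  split; first by rewrite /F (quot_pi_monoid j).1.
  by move=> u v; rewrite /F (quot_pi_monoid j).2 /GRing.mul /= /mul !fK.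
pose Fh := AlgHom FL FM.
have Fs b : exists z, Fh z = b.
  by have [z zE] : exists z, quot_pi j z = g b; [elim/quot_ind: (g b) => z; exists z
    |exists z; rewrite /= /F zE gK].
have F0 z : Fh z = 0 <-> j z.
  rewrite -quot_eq0 /= /F; split=> [e|->]; last exact: lin0.
  by apply: (can_inj fK); rewrite e (lin0 fL).
have FB u v : Fh u = Fh v -> j (u - v).
  move=> e; apply/F0; have {}e : F u = F v := e.
  by change (F (u - v) = 0); rewrite -scaleN1r addrC FL e scaleN1r addNr.
have cl : closed_immersion I Fh.
  split.
  - move=> q qs; split.
      split=> [h|a b h]; first by apply: qs.1; rewrite -FM.1.
      by apply: qs.2; rewrite -FM.2.
    move=> Iq; apply: qs.1; rewrite -FM.1 -[1](subrK x) (linD _ _ FL).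
    apply: idealD; last exact: Iq.
    by have := (F0 _).2 jx => /= ->; exact: ideal0.
  - by move=> q q' _ _ h b; have [z <-] := Fs b; exact: h.
  - move=> J; exists (ideal_preim Fh J) => p [ps op]; split=> [Jp|[q [qs Jq qp]]]; last first.
      by move=> a /Jq /qp.
    have jp z : j z -> p z by move=> /F0 e; apply: Jp; change (J (Fh z)); rewrite e; exact: ideal0.
    have pF u v : Fh u = Fh v -> p v -> p u.
      by move=> /FB /jp puv pv; rewrite -[u](subrK v); exact: idealD.
    have [q qP] : exists q : ideal (ComAlgebra strC), forall b, q b <-> exists2 z, p z & b = Fh z.
      unshelve eexists (@Ideal k (ComAlgebra strC) (fun b => exists2 z, p z & b = Fh z)
         _ _ _ _) => //.
      + by exists 0; [exact: ideal0|rewrite (lin0 (alghom_linear Fh))].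
      + move=> _ _ [u pu ->] [v pv ->]; exists (u + v); first exact: idealD.
        by rewrite (linD _ _ (alghom_linear Fh)).
      + move=> a _ [u pu ->]; have [v <-] := Fs a.
        by exists (v * u); [exact: idealMl|rewrite (alghom_monoid Fh).2].
      + move=> a _ [u pu ->]; have [v <-] := Fs a.
        by exists (u * v); [exact: idealMr|rewrite (alghom_monoid Fh).2].
    have qp z : q (Fh z) <-> p z.
      split=> [/qP[y py e]|pz]; first exact: pF e py.
      by apply/qP; exists z.
    exists q; split=> //; last first.
      by move=> b Jb; have [z zb] := Fs b; rewrite -zb; apply/qp/Jp; change (J (Fh z)); rewrite zb.
    split; first by rewrite -(alghom_monoid Fh).1 => /qp; exact: ps.1.
    move=> a b; have [u <-] := Fs a; have [v <-] := Fs b.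
    by rewrite -(alghom_monoid Fh).2 => /qp/ps.2[]; [left|right]; apply/qp.
  - move=> p op b t pt; have [z zb] := Fs b.
    exists z, t, 1; split=> //; first exact: op.1.1.
    by rewrite zb.
by exists (FiniteClosedSubscheme cl) => z; exact: F0.
Qed.

Lemma subscheme_le_exists S T : subker T `<=` subker S -> inhabited (subscheme_le S T).
Proof.
move=> h; have /choice[f fE] := @subscheme_surj T.
have eqS x y : phi T x = phi T y -> phi S x = phi S y.
  move=> e; apply/eqP; rewrite -subr_eq0 -phiB; apply/eqP; apply: h => /=.
  by rewrite phiB e subrr.
pose g (b : coordinate_algebra T) : coordinate_algebra S := phi S (f b).
have gE z : g (phi T z) = phi S z by apply: eqS; rewrite fE.
have gL : linear g.
  move=> c a b; have [x <-] := subscheme_surj a; have [y <-] := subscheme_surj b.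
  by rewrite -(alghom_linear (phi T)) !gE (alghom_linear (phi S)).
have gM : monoid_morphism g.
  split; first by rewrite -(phi1 T) gE phi1.
  move=> a b; have [x <-] := subscheme_surj a; have [y <-] := subscheme_surj b.
  by rewrite -phiM !gE phiM.
by constructor; exists (AlgHom gL gM).
Qed.

Lemma subscheme_join S T : exists U, inhabited (subscheme_le S U) /\ inhabited (subscheme_le T U).
Proof.
have fd V : findim (quot (subker V)).
  by apply/findim_cofinite; exists (subscheme_dim V); exact: subker_cofinite.
have [n cST] := (findim_cofinite _).1 (findim_capI (fd S) (fd T)).
have [x Ix jx] := subscheme_coprime S; have [y Iy jy] := subscheme_coprime T.
have [|U UP] := subscheme_exists cST.
  (* Chosen so that [1] minus it is [(1 - x) * (1 - y)], which lies in both kernels. *)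
  exists (x + y - x * y); first by apply: idealB; [exact: idealD|exact: idealMl].
  have -> : 1 - (x + y - x * y) = (1 - x) * (1 - y).
    rewrite mulrBl mul1r mulrBr mulr1 -[RHS]addrA -opprD; congr (_ - _).
    by rewrite addrCA addrA.
  by split; [exact: idealMr|exact: idealMl].
by exists U; split; apply: subscheme_le_exists => z /UP[].
Qed.

(** The empty subscheme, with the zero algebra on [k^0]. *)
Lemma subscheme_nonempty : inhabited (finite_closed_subscheme I).
Proof.
have [||S _] := @subscheme_exists (full_ideal C) 0%N; last by constructor.
  by exists (fun=> 0); split=> [c x y|x]; [rewrite scaler0 addr0|].
by exists 0 => //; exact: ideal0.
Qed.
End Subschemes.

Section DirectedColimit.
Variables (k : fieldType) (D : diagram k).
Hypothesis D_inhabited : inhabited (dobj D).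
Hypothesis D_directed : forall i j : dobj D, exists l, inhabited (dhom i l) /\ inhabited (dhom j l).

(** Elements of the colimit are formal sums over several stages; directedness moves all terms of
    finitely many sums to one stage. *)
Lemma colim_directed_family (I : finType) (x : I -> colim D) :
  exists l (c : I -> dcoalg D l), forall a, x a = colim_in l (c a).
Proof.
have inL (i : dobj D) := coalghom_linear (colim_in i).
have inH (i j : dobj D) (h : dhom i j) c : colim_in j (dmap h c) = colim_in i c.
  exact: ((@colim_in_cocone k D).2 i j h c).
have one (y : colim D) : exists l c, y = colim_in l c.
  rewrite [y]pres_genE /pres_lift /formal_eval; elim: (repr y : seq _) => [|[a [i c]] s [l [c' IH]]].
    rewrite big_nil; have [l] := D_inhabited; exists l, 0; by rewrite (lin0 (inL l)).
  rewrite big_cons /= IH; have [j [[f] [g]]] := D_directed i l.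
  exists j, (a *: dmap f c + dmap g c').
  have := inL j a (dmap f c) (dmap g c'); rewrite !inH => e; exact: (esym e).
suff H (s : seq I) : exists l (c : I -> dcoalg D l), forall a, a \in s -> x a = colim_in l (c a).
  by have [l [c cP]] := H (enum I); exists l, c => a; apply: cP; rewrite mem_enum.
elim: s => [|b s [l [c IH]]].
  by have [l] := D_inhabited; exists l, (fun=> 0).
have [i [cb bE]] := one (x b); have [j [[f] [g]]] := D_directed i l.
exists j, (fun a => if a == b then dmap f cb else dmap g (c a)) => a.
rewrite inE; case: eqP => [-> _|_ /= /IH ->]; last exact: (esym (inH _ _ g _)).
rewrite bE; exact: (esym (inH _ _ f _)).
Qed.
End DirectedColimit.

Lemma ideal_eq (k : fieldType) (A : algebra k) (I J : ideal A) :
  (forall x, I x <-> J x) -> I = J.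
Proof.
case: I J => [I I0 ID Il Ir] [J J0 JD Jl Jr] /= h.
have e : I = J by apply/funext => x; exact/propext.
subst J; congr Ideal; exact: Prop_irrelevance.
Qed.

(** * Matrix coordinates over the Azumaya locus *)

Section LyingOver.
Variables (k : closedFieldType) (A : algebra k).
Hypothesis A_finite : module_finite_over_center A.
Local Notation Z := (center A).
Let iota (z : Z) : A := center_incl A z.

Let Zmul (x y : Z) : x * y = y * x. Proof. exact: comalg_mulC. Qed.

(** It suffices that [mA] is proper, which is Nakayama's lemma localized at m: if [mA = A],
    generators are eliminated one by one until some [t] outside m kills [A]. *)
Lemma lying_over (m : ideal Z) : is_maximal_ideal m ->
  exists M : ideal A, is_maximal_ideal M /\ m = ideal_preim (center_incl A) M.
Proof.
move=> mm; have mp := (spec_pointP m).2 (maximal_prime mm).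
suff /maximal_above[M [mM jM]] : ~ ideal_ext m 1.
  exists M; split=> //; apply: ideal_eq => z; split=> [mz|]; first by apply: jM; exact: ideal_ext_in.
  apply: mm.2; first by move=> x mx; apply: jM; exact: ideal_ext_in.
  exact: mM.1.
move=> m1; have [n [s0 sP0]] := A_finite.
pose s i := oapp s0 0 (insub i : option 'I_n).
have iB (x y : Z) : iota (x - y) = iota x - iota y by [].
have iM (x y : Z) : iota (x * y) = iota x * iota y by [].
pose gen r (t : Z) := forall x, exists c : nat -> Z, iota t * x = \sum_(i < r) iota (c i) * s i.
(* [t * s r] is a combination of the generators with coefficients in m; moving its last term to the
   left, [t - mu r], still outside m, sends [s r] into the span of the others. *)
have step r t : ~ m t -> gen r.+1 t -> exists t', ~ m t' /\ gen r t'.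
  move=> mt g.
  have [L LP] : exists L : ideal A, forall x, L x <-> forall a b, exists c : nat -> Z,
      (forall i, m (c i)) /\ iota t * (a * x * b) = \sum_(i < r.+1) iota (c i) * s i.
    unshelve eexists (@Ideal k A (fun x => forall a b, exists c : nat -> Z,
      (forall i, m (c i)) /\ iota t * (a * x * b) = \sum_(i < r.+1) iota (c i) * s i) _ _ _ _) => //.
    - move=> a b; exists (fun=> 0); split=> [i|]; first exact: ideal0.
      rewrite mulr0 mul0r mulr0 big1 // => i _; exact: mul0r.
    - move=> x y Hx Hy a b; have [c [mc ec]] := Hx a b; have [e [me ee]] := Hy a b.
      exists (fun i => c i + e i); split=> [i|]; first exact: idealD.
      rewrite mulrDr mulrDl mulrDr ec ee -big_split; apply: eq_bigr => i _.
      exact: (esym (mulrDl _ _ _)).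
    - move=> u x Hx a b; have -> : a * (u * x) * b = a * u * x * b by rewrite !mulrA.
      exact: Hx.
    - move=> u x Hx a b; have -> : a * (x * u) * b = a * x * (u * b) by rewrite !mulrA.
      exact: Hx.
  have Ls : L (s r).
    rewrite -[s r]mulr1; apply: idealMl; suff : ideal_ext m `<=` L by apply.
    apply: ideal_ext_min => z mz; apply/LP => a b; have [c e] := g (a * b).
    exists (fun i => z * c i); split=> [i|]; first exact: idealMr.
    rewrite -incl_central -mulrA mulrA incl_central -mulrA e mulr_sumr.
    by apply: eq_bigr => i _; rewrite mulrA.
  have [mu [mmu emu]] := (LP _).1 Ls 1 1; rewrite mul1r mulr1 in emu.
  exists ((t - mu r) * t); split.
    move=> /mp.2[h|//]; apply: mt; rewrite -[t](subrK (mu r)); exact: idealD.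
  move=> x; have [c ec] := g x.
  exists (fun i => (t - mu r) * c i + c r * mu i).
  have sr : iota (t - mu r) * s r = \sum_(i < r) iota (mu i) * s i.
    by rewrite iB mulrBl emu big_ord_recr addrK.
  rewrite iM -mulrA ec big_ord_recr mulrDr mulrA -iM Zmul iM -mulrA sr !mulr_sumr -big_split.
  by apply: eq_bigr => i _; rewrite /= !mulrA -mulrDl -!iM.
have [t [mt g]] : exists t, ~ m t /\ gen 0%N t.
  have : exists t, ~ m t /\ gen n t.
    exists 1; split; first exact: mm.1.
    move=> x; have [z [cz e]] := sP0 x.
    have /choice[y yE] i : exists y : Z, iota y = z i.
      by exists (@CenterElt k A (z i) (introT (asboolP _) (cz i))).
    exists (fun i => oapp y 0 (insub i : option 'I_n)).
    rewrite mul1r e; apply: eq_bigr => i _; by rewrite /s valK /= yE.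
  by elim: (n) => // r IH [t [mt g]]; apply: IH; exact: step g.
apply: mt; have [c] := g 1; rewrite big_ord0 mulr1 => e.
by have -> : t = 0; [exact: val_inj|exact: ideal0].
Qed.
End LyingOver.

Section Open.
Variables (k : closedFieldType) (A : algebra k) (d : nat).
Hypotheses (A_prime : prime_algebra A) (A_affine : affine A).
Hypotheses (A_finite : module_finite_over_center A) (A_degree : PI_degree A d).
Local Notation Z := (center A).
Local Notation I := (ideal_preim (center_incl A) (nonregular_ideal A)).

(** One choice for all m, shared by all subschemes, on which the compatibility with restriction in
    [rho_restr] rests. *)
Lemma coordinates_open : exists co, forall m : ideal Z, is_maximal_ideal m -> ~ I `<=` m ->
  @coordinates k A m d (co m).
Proof.
have /choice[co coP] (m : ideal Z) : exists co,
    is_maximal_ideal m -> ~ I `<=` m -> @coordinates k A m d co; last by exists co.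
have [[mm Im]|h] := pselect (is_maximal_ideal m /\ ~ I `<=` m); last first.
  by exists (fun _ _ _ => True) => mm Im; exfalso; apply: h.
have [M [mM mE]] := lying_over A_finite mm.
have rM : regular_ideal M.
  apply: contrapT => nr; apply: Im => z /= Nz; rewrite mE /=; exact: Nz.
have [m' [psi psiM]] := maximal_mx_rep A_affine A_finite mM.
have e := (regular_mx_rep A_prime A_degree psiM).1 rM; subst m'.
have [co coP] := coordinates_exist A_prime A_affine A_finite A_degree psiM.
by exists co => _ _; rewrite mE.
Qed.

(* The values of a form that is nonzero at M lie in the nonregular ideal. *)
Lemma regular_open (M : ideal A) : is_maximal_ideal M -> regular_ideal M ->
  exists2 z, I z & ~ M (center_incl A z).
Proof.
move=> mM rM; have [m' [psi psiM]] := maximal_mx_rep A_affine A_finite mM.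
have e := (regular_mx_rep A_prime A_degree psiM).1 rM; subst m'.
have [F [_ Fnz _ _ FN]] := local_form A_prime A_affine A_finite A_degree psiM.
have [_ _ _ sj _] := psiM.
have /choice[x xs] (i : 'I_(d ^ 2)) : exists y, psi y = delta_mx (mxidx i).1 (mxidx i).2 by exact: sj.
by exists (F x); [move=> M' [mM' nr]; exact: FN|exact: Fnz].
Qed.
End Open.

(** * Gluing local coordinates over a finite closed subscheme *)

Section Rho.
Variables (k : closedFieldType) (A : algebra k) (d : nat).
Local Notation Z := (center A).
Variables (I : ideal Z) (co : ideal Z -> nat -> A -> ('I_d -> 'I_d -> Z) -> Prop).
Hypothesis coP : forall m : ideal Z, is_maximal_ideal m -> ~ I `<=` m ->
  @coordinates k A m d (co m).
Implicit Types S T : finite_closed_subscheme I.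
Let iota (z : Z) : A := center_incl A z.
Let Zmul (x y : Z) : x * y = y * x. Proof. exact: comalg_mulC. Qed.

Local Notation phi := subscheme_map.
Let phiM S (x y : Z) : phi S (x * y) = phi S x * phi S y.
Proof. exact: (alghom_monoid (phi S)).2. Qed.
Let phi1 S : phi S 1 = 1. Proof. exact: (alghom_monoid (phi S)).1. Qed.
Let phiD S (x y : Z) : phi S (x + y) = phi S x + phi S y.
Proof. exact: (linD _ _ (alghom_linear (phi S))). Qed.
Let phi0 S : phi S 0 = 0. Proof. exact: (lin0 (alghom_linear (phi S))). Qed.
Let phiZ S c (x : Z) : phi S (c *: x) = c *: phi S x.
Proof. exact: (linZ _ _ (alghom_linear (phi S))). Qed.
Let phiB S (x y : Z) : phi S (x - y) = phi S x - phi S y.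
Proof. by rewrite phiD -scaleN1r phiZ scaleN1r. Qed.
Let phiS S (J : finType) (F : J -> Z) : phi S (\sum_i F i) = \sum_i phi S (F i).
Proof. exact: (linD_sum _ _ (alghom_linear (phi S))). Qed.

Lemma subker_open S (m : ideal Z) : is_maximal_ideal m -> subker S `<=` m -> ~ I `<=` m.
Proof.
move=> mm jm Im; have [x Ix jx] := subscheme_coprime S.
by apply: mm.1; rewrite -[1](subrK x); apply: idealD; [exact: jm|exact: Im].
Qed.

(* The entry b of the matrix of r over S is characterized by its images in all
   the quotients by powers of the maximal ideals in the open set. *)
Definition entry S r (u v : 'I_d) (b : coordinate_algebra S) :=
  forall m : ideal Z, is_maximal_ideal m -> ~ I `<=` m ->
  forall l c, co m l r c -> exists2 z, ideal_pow m l.+1 z & b - phi S (c u v) = phi S z.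

Lemma pow_coprime (m m' : ideal Z) l L : is_maximal_ideal m -> is_maximal_ideal m' ->
  m <> m' -> exists2 e, ideal_pow m l e & ideal_pow m' L (1 - e).
Proof.
move=> mm mm' ne.
have [x [y [mx my e]]] : exists x y, [/\ m x, m' y & 1 = x + y].
  apply: contrapT => H; apply: ne; apply: ideal_eq => z.
  have h : ~ ideal_add m m' 1 by move=> [x [y [? ? ?]]]; apply: H; exists x, y.
  split=> mz; first exact: (mm'.2 _ (@ideal_addr _ _ m m') h z (ideal_addl m' mz)).
  exact: (mm.2 _ (@ideal_addl _ _ m m') h z (ideal_addr m mz)).
have [v vE] := geometric_factor x l.
have [w wE] := geometric_factor (1 - x ^+ l) L.
(* This is [1 - (1 - x^l)^L], where [x] is in [m] and [1 - x] in [m']. *)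
exists (x ^+ l * w); first by apply: idealMr; exact: ideal_powX.
have -> : 1 - x ^+ l * w = (1 - x ^+ l) ^+ L.
  by move: wE; rewrite subKr => <-; rewrite subKr.
by apply: ideal_powX; rewrite vE; apply: idealMr; rewrite e addrC addKr.
Qed.

Lemma entry_exists S r u v : exists b : coordinate_algebra S, entry r u v b.
Proof.
have [N [p [eps [L [P1 P2 P3 P4]]]]] := cofinite_primary (subker_cofinite S).
have Po i : ~ I `<=` p i by apply: (@subker_open S).
have /choice[c cP] i : exists c, co (p i) L r c := co_ex (coP (P1 i) (Po i)) L r.
exists (phi S (\sum_i eps i * c i u v)) => m mm om l c' c'P.
suff /choice[z zP] i : exists z, ideal_pow m l.+1 z /\
    phi S (eps i * (c i u v - c' u v)) = phi S z.
  exists (\sum_i z i); first by apply: ideal_sum => i _; exact: (zP i).1.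
  rewrite phiS -phiB.
  have -> : \sum_i eps i * c i u v - c' u v =
      \sum_i eps i * (c i u v - c' u v) - (1 - \sum_i eps i) * c' u v.
    under [X in _ = X - _]eq_bigr do rewrite mulrBr.
    by rewrite sumrB -mulr_suml mulrBl mul1r opprB addrA subrK.
  rewrite phiB phiS [X in _ - X](_ : _ = 0) ?subr0; last first.
    by rewrite phiM (P3 : phi S _ = 0) mul0r.
  by apply: eq_bigr => i _; exact: (zP i).2.
have kz z : subker S z -> phi S z = 0 by [].
(* At [p i] the two coordinate matrices agree modulo the smaller of the two powers, and [eps i]
   kills the power [L]. At any other [m] each multiple of [eps i] lies, on S, in all powers of
   [m]. *)
have [e|ne] := pselect (m = p i).
  subst m; have cp := coP (P1 i) (Po i); have [lL|Ll] := leqP l L.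
    exists (eps i * (c i u v - c' u v)); split=> //; apply: idealMl.
    exact: (co_uniq cp (co_le cp lL (cP i)) c'P).
  exists 0; split; first exact: ideal0.
  rewrite phi0; apply: kz; apply: P4; apply: (ideal_powS (leqnSn L)).
  exact: (co_uniq cp (cP i) (co_le cp (ltnW Ll) c'P)).
have [e me pe] := pow_coprime l.+1 L mm (P1 i) ne.
exists (e * (eps i * (c i u v - c' u v))); split; first exact: idealMr.
apply/eqP; rewrite -subr_eq0 -phiB; apply/eqP/kz.
rewrite -[X in X - _]mul1r -mulrBl mulrA [_ * eps i]Zmul; apply: idealMr.
exact: P4.
Qed.

Lemma entry_uniq S r u v (b b' : coordinate_algebra S) : entry r u v b -> entry r u v b' -> b = b'.
Proof.
move=> h h'; have [w wE] := subscheme_surj (b - b').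
have [N [p [eps [L [P1 P2 P3 P4]]]]] := cofinite_primary (subker_cofinite S).
have Po i : ~ I `<=` p i by apply: (@subker_open S).
apply/eqP; rewrite -subr_eq0 -wE.
have kz z : subker S z -> phi S z = 0 by [].
have ew i : phi S (eps i * w) = 0.
  have [c cP] := co_ex (coP (P1 i) (Po i)) L r.
  have [z1 pz1 e1] := h _ (P1 i) (Po i) _ _ cP.
  have [z2 pz2 e2] := h' _ (P1 i) (Po i) _ _ cP.
  have e : phi S w = phi S (z1 - z2).
    by rewrite wE phiB -e1 -e2 opprB addrA subrK.
  rewrite phiM e -phiM; apply: kz; apply: P4; apply: (ideal_powS (leqnSn L)).
  exact: idealB.
have -> : w = (1 - \sum_i eps i) * w + \sum_i eps i * w.
  by rewrite mulrBl mul1r mulr_suml subrK.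
rewrite phiD phiS [X in _ + X]big1 => [|i _]; last exact: ew.
by rewrite addr0 phiM (kz _ P3) mul0r.
Qed.

Definition rho S (r : A) (u v : 'I_d) : coordinate_algebra S := xget 0 [set b : coordinate_algebra S | entry r u v b].

Lemma rhoP S r u v : entry r u v (rho S r u v).
Proof.
rewrite /rho; case: xgetP => [b _ //|h].
by have [b] := entry_exists S r u v; exact: (h b).
Qed.
Lemma rhoE S r u v b : entry r u v b -> rho S r u v = b.
Proof. by move=> h; apply: entry_uniq h; exact: rhoP. Qed.

(** As for the rules that follow, the right-hand side is an entry at every [m] and [l], because
    coordinates obey the same rule up to the power of [m] that [entry] tolerates. *)
Lemma rho_linear S (x : k) r r' u v :
  rho S (x *: r + r') u v = x *: rho S r u v + rho S r' u v.
Proof.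
apply: rhoE => m mm om l c cP; have cp := coP mm om.
have [c1 c1P] := co_ex cp l r; have [c2 c2P] := co_ex cp l r'.
have [z1 pz1 e1] := rhoP S u v mm om c1P.
have [z2 pz2 e2] := rhoP S u v mm om c2P.
exists (x *: z1 + z2 + (x *: c1 u v + c2 u v - c u v)).
  apply: idealD; first by apply: idealD => //; exact: idealZ.
  exact: (co_uniq cp (co_lin cp x c1P c2P) cP).
by rewrite phiD phiB !phiD !phiZ -e1 -e2 scalerBr [X in _ = X + _]addrACA -opprD addrA subrK.
Qed.

Lemma rho_mul S r r' u v : rho S (r * r') u v = \sum_e rho S r u e * rho S r' e v.
Proof.
apply: rhoE => m mm om l c cP; have cp := coP mm om.
have [c1 c1P] := co_ex cp l r; have [c2 c2P] := co_ex cp l r'.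
have /choice[z1 z1P] e : exists z, ideal_pow m l.+1 z /\ rho S r u e = phi S (c1 u e + z).
  by have [z pz ez] := rhoP S u e mm om c1P; exists z; rewrite phiD -ez addrC subrK.
have /choice[z2 z2P] e : exists z, ideal_pow m l.+1 z /\ rho S r' e v = phi S (c2 e v + z).
  by have [z pz ez] := rhoP S e v mm om c2P; exists z; rewrite phiD -ez addrC subrK.
exists (\sum_e (c1 u e * z2 e + z1 e * (c2 e v + z2 e)) + (\sum_e c1 u e * c2 e v - c u v)).
  apply: idealD; last exact: (co_uniq cp (co_mul cp c1P c2P) cP).
  apply: ideal_sum => e _; apply: idealD; first by apply: idealMl; exact: (z2P e).1.
  by apply: idealMr; exact: (z1P e).1.
rewrite addrA -big_split phiB; congr (_ - _); rewrite phiS.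
apply: eq_bigr => e _; rewrite (z1P e).2 (z2P e).2 -phiM; congr (phi S _).
by rewrite /= mulrDl mulrDr [RHS]addrC addrA.
Qed.

Lemma rho_center S z u v : rho S (iota z) u v = if u == v then phi S z else 0.
Proof.
apply: rhoE => m mm om l c cP; have cp := coP mm om.
exists ((if u == v then z else 0) - c u v); first exact: (co_uniq cp (co_center cp l z) cP).
by rewrite phiB; case: eqP; rewrite ?phi0.
Qed.

Lemma rho_centerM S z r u v : rho S (iota z * r) u v = phi S z * rho S r u v.
Proof.
rewrite rho_mul (bigD1 u) //= rho_center eqxx big1 ?addr0 // => e eu.
by rewrite rho_center eq_sym (negPf eu) mul0r.
Qed.

Lemma rho_restr S T (f : subscheme_le S T) r u v : f (rho T r u v) = rho S r u v.
Proof.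
apply/esym/rhoE => m mm om l c cP.
have [z pz ez] := rhoP T u v mm om cP.
exists z => //; rewrite -!(subscheme_restrP f) -ez.
by rewrite -scaleN1r addrC -(alghom_linear f) scaleN1r addrC.
Qed.

(** Locally at [p i], the coordinates of [r] lie in the kernel of S plus a power of [p i], so
    [co_ker] applies; [eps i] moves that power into the kernel, and the [eps i] sum to 1. *)
Lemma rho_ker S r : (forall u v, rho S r u v = 0) -> ideal_ext (subker S) r.
Proof.
move=> r0.
have [N [p [eps [L [P1 P2 P3 P4]]]]] := cofinite_primary (subker_cofinite S).
have Po i : ~ I `<=` p i by apply: (@subker_open S).
have epsP i : ideal_ext (subker S) (iota (eps i) * r).
  have cp := coP (P1 i) (Po i); have [c cP] := co_ex cp L r.
  have E (j : ideal Z) x : (forall z, j z -> subker S (eps i * z)) -> ideal_ext j x ->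
      ideal_ext (subker S) (iota (eps i) * x).
    move=> h; have [K KP] : exists K : ideal A, forall x, K x <->
        ideal_ext (subker S) (iota (eps i) * x).
      unshelve eexists (@Ideal k A (fun x => ideal_ext (subker S) (iota (eps i) * x)) _ _ _ _) => //.
      all: cbv beta.
      - by rewrite mulr0; exact: ideal0.
      - by move=> y y' Hy Hy'; rewrite mulrDr; exact: idealD.
      - by move=> a y Hy; rewrite mulrA /iota incl_central -mulrA; exact: idealMl.
      - by move=> a y Hy; rewrite mulrA; exact: idealMr.
    suff : ideal_ext j `<=` K by move=> jK /jK /KP.
    apply: ideal_ext_min => z jz; apply/KP.
    by apply: (@ideal_ext_in _ _ _ (eps i * z)); exact: h.
  have epow z : ideal_pow (p i) L.+1 z -> subker S (eps i * z).
    by move=> pz; apply: P4; exact: (ideal_powS (leqnSn L)).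
  have [|r1 [h1 h2]] := co_ker cp (j := ideal_add (subker S) (ideal_pow (p i) L.+1)) cP.
    move=> u v; have [z pz ez] := rhoP S u v (P1 i) (Po i) cP.
    exists (c u v + z), (- z); split; last by rewrite addrK.
      by rewrite /subker /= phiD -ez r0 sub0r subrr.
    exact: idealN.
  rewrite -[r](subrK r1) mulrDr; apply: idealD; first exact: (E _ _ epow h2).
  apply: E h1 => _ [x [y [jx py ->]]]; rewrite mulrDr; apply: idealD; first exact: idealMl.
  exact: epow.
have -> : r = iota (1 - \sum_i eps i) * r + \sum_i iota (eps i) * r.
  rewrite -mulr_suml -mulrDl -[X in _ + X](linD_sum _ _ (alghom_linear (center_incl A))).
  by rewrite -[_ + _](linD _ _ (alghom_linear (center_incl A))) subrK (alghom_monoid _).1 mul1r.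
apply: idealD; first by apply: idealMr; exact: ideal_ext_in.
by apply: ideal_sum => i _.
Qed.

Lemma rho_onto S u v : exists r, forall u' v',
  rho S r u' v' = if (u' == u) && (v' == v) then 1 else 0.
Proof.
have [N [p [eps [L [P1 P2 P3 P4]]]]] := cofinite_primary (subker_cofinite S).
have Po i : ~ I `<=` p i by apply: (@subker_open S).
pose dl u' v' : Z := if (u' == u) && (v' == v) then 1 else 0.
have /choice[r rP] i : exists r, co (p i) L r dl := co_onto (coP (P1 i) (Po i)) L dl.
have E i u' v' : rho S (iota (eps i) * r i) u' v' = phi S (eps i * dl u' v').
  rewrite rho_centerM; have [z pz ez] := rhoP S u' v' (P1 i) (Po i) (rP i).
  rewrite -[rho S _ _ _](subrK (phi S (dl u' v'))) ez mulrDr -!phiM.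
  have -> : phi S (eps i * z) = 0 by apply: P4; exact: (ideal_powS (leqnSn L)).
  by rewrite add0r.
have rS (s : seq 'I_N) u' v' : rho S (\sum_(i <- s) iota (eps i) * r i) u' v' =
    \sum_(i <- s) phi S (eps i * dl u' v').
  have L' : linear (fun r => rho S r u' v') by move=> x a b; rewrite rho_linear.
  by rewrite (linD_sum _ _ L'); apply: eq_bigr => i _.
exists (\sum_i iota (eps i) * r i) => u' v'; rewrite rS -phiS -mulr_suml.
have -> : phi S ((\sum_i eps i) * dl u' v') = phi S (dl u' v').
  apply/eqP; rewrite -subr_eq0 -phiB -[X in _ - X]mul1r -mulrBl phiM -opprB.
  have e : phi S (1 - \sum_i eps i) = 0 by [].
  by rewrite -scaleN1r phiZ e scaler0 mul0r.
by rewrite /dl; case: ifP => _; rewrite ?phi1 ?phi0.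
Qed.
End Rho.

(** * Homomorphisms into the finite dual *)

Section CoalgHoms.
Variables (k : fieldType).

Lemma tmap_linear (V W V' W' : lmodType k) (f : V -> V') (g : W -> W') :
  linear f -> linear g -> linear (tmap f g).
Proof. by move=> Lf Lg; rewrite /tmap; linearity. Qed.

Lemma tmap_comp (V W V' W' V'' W'' : lmodType k) (f : V -> V') (g : W -> W')
    (f' : V' -> V'') (g' : W' -> W'') t : linear f' -> linear g' ->
  tmap f' g' (tmap f g t) = tmap (fun x => f' (f x)) (fun y => g' (g y)) t.
Proof.
move=> Lf' Lg'; rewrite /tmap tlift_comp; last by linearity.
by apply: eq_tlift => x y; rewrite tlift_tens //; linearity.
Qed.

Lemma tmap_ext (V W V' W' : lmodType k) (f f' : V -> V') (g g' : W -> W') t :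
  f =1 f' -> g =1 g' -> tmap f g t = tmap f' g' t.
Proof. by move=> e e'; apply: eq_tlift => x y; rewrite e e'. Qed.

Lemma coalghom_inverse (C D : coalgebra k) (f : coalghom C D) : bijective f -> coalg_iso D C.
Proof.
move=> [g fK gK]; have Lf := coalghom_linear f.
have Lg : linear g by move=> c x y; apply: (can_inj fK); rewrite Lf !gK.
have gM d : comul (g d) = tmap g g (comul d).
  rewrite -{2}[d]gK coalghom_comul tmap_comp //.
  by rewrite -[LHS]tlift_id; apply: eq_tlift => x y; rewrite !fK.
have gU d : counit (g d) = counit d by rewrite -{2}[d]gK coalghom_counit.
by exists (CoalgHom Lg gM gU); exists f.
Qed.

Section SumHom.
Variables (C D E : coalgebra k) (f : coalghom C E) (g : coalghom D E).
Let Lf := coalghom_linear f.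
Let Lg := coalghom_linear g.
Definition sum_hom_fun (s : sum_coalg C D) : E := f s.1 + g s.2.

Lemma sum_hom_linear : linear sum_hom_fun.
Proof. by move=> c x y; rewrite /sum_hom_fun Lf Lg scalerDr addrACA. Qed.
Lemma sum_hom_comul s : comul (sum_hom_fun s) = tmap sum_hom_fun sum_hom_fun (comul s).
Proof.
have L := sum_hom_linear.
rewrite (linD _ _ (@comul_linear k E)) !coalghom_comul.
rewrite [RHS](linD _ _ (tmap_linear L L)) !tmap_comp //.
congr (_ + _); apply: tmap_ext => x; rewrite /sum_hom_fun /=.
- by rewrite (lin0 Lg) addr0.
- by rewrite (lin0 Lg) addr0.
- by rewrite (lin0 Lf) add0r.
- by rewrite (lin0 Lf) add0r.
Qed.
Lemma sum_hom_counit s : counit (sum_hom_fun s) = counit s.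
Proof. by rewrite (linD _ _ (@counit_linear k E)) !coalghom_counit. Qed.
Definition sum_hom : coalghom (sum_coalg C D) E :=
  CoalgHom sum_hom_linear sum_hom_comul sum_hom_counit.
End SumHom.
End CoalgHoms.

Section PowerPart.
Variables (k : fieldType) (A : algebra k) (N : ideal A).

Lemma power_hom : exists alpha : coalghom (colim (power_system N)) (finite_dual A),
  forall i (c : dcoalg (power_system N) i) r,
    (alpha (@colim_in k (power_system N) i c) : finite_dual A) r = c (quot_pi (ideal_pow N i.+1) r).
Proof.
have [|g [gE _]] := @colim_universal k (power_system N) (finite_dual A)
  (fun i => finite_dual_map (quot_proj (ideal_pow N i.+1))).
  move=> i j h c; apply: finite_dual_ext => r; have := quot_map_funE (@ideal_powS k A N i.+1 j.+1 h) r; by rewrite /= => ->.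
by exists g => i c r; rewrite gE.
Qed.
End PowerPart.

(** The diagram whose colimit is [Dist I] by definition, named so that the maps of the colimit can
    be applied to it. *)
Definition dist_diagram (k : fieldType) (C : comalgebra k) (I : ideal C) : diagram k :=
  @Diagram k (finite_closed_subscheme I)
  (fun S => finite_dual (coordinate_algebra S)) (@subscheme_le k C I)
  (fun S T r => finite_dual_map (subscheme_restr r)).

(** * The coalgebra map defined on the matrix part *)

Section MatrixPart.
Variables (k : closedFieldType) (A : algebra k) (d : nat).
Local Notation Z := (center A).
Variables (I : ideal Z) (co : ideal Z -> nat -> A -> ('I_d -> 'I_d -> Z) -> Prop).
Hypothesis coP : forall m : ideal Z, is_maximal_ideal m -> ~ I `<=` m ->
  @coordinates k A m d (co m).
Implicit Types S T : finite_closed_subscheme I.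
Local Notation rho := (rho co).
Local Notation D := (dist_diagram I).
Local Notation B := coordinate_algebra.

Lemma rho_entry_finite S (g : finite_dual (B S)) u v :
  (fun r => g (rho S r u v) : k^o) \in finite_dual_pred A.
Proof.
have Lg := finite_dual_linear g.
apply/asboolP; split.
  by move=> c x y; rewrite (rho_linear coP) Lg.
(* The functional factors through the matrices over S, which bounds the codimension by [d ^ 2] times
   the dimension of S. *)
have [K KP] : exists K : ideal A, forall r, K r <-> forall u v, rho S r u v = 0.
  unshelve eexists (@Ideal k A (fun r => forall u v, rho S r u v = 0) _ _ _ _) => //.
  - move=> a b; have := rho_center coP S 0 a b.
    by rewrite (lin0 (alghom_linear (subscheme_map S))) if_same.
  - move=> x y x0 y0 a b; rewrite -[x]scale1r (rho_linear coP) x0 y0 scaler0 addr0 //.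
  - by move=> x r r0 a b; rewrite (rho_mul coP) big1 // => e _; rewrite r0 mulr0.
  - by move=> x r r0 a b; rewrite (rho_mul coP) big1 // => e _; rewrite r0 mul0r.
exists K; split; last by move=> r /KP ->; exact: lin0.
pose n := subscheme_dim S.
apply/findim_cofinite; exists (d ^ 2 * n)%N.
exists (fun r => mxvec (\matrix_(i < d ^ 2, l < n)
  (rho S r (mxidx i).1 (mxidx i).2 : 'rV[k]_n) 0 l)); split.
  move=> c x y; rewrite -linearP; congr mxvec; apply/matrixP => i l.
  by rewrite !mxE (rho_linear coP) !mxE.
move=> r; rewrite KP; split=> [e a b|r0]; last first.
  by apply/eqP; rewrite mxvec_eq0; apply/eqP/matrixP => i l; rewrite !mxE r0 mxE.
have {}e := can_inj mxvecK (etrans e (esym (linear0 _))).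
apply/rowP => l; have /matrixP/(_ (idxmx (a, b)) l) := e.
by rewrite !mxE idxmxK.
Qed.

Definition rho_entry u v S (g : dcoalg D S) : finite_dual A := FiniteDual (rho_entry_finite g u v).

Lemma rho_entry_cocone u v : @dcocone k D (finite_dual A) (rho_entry u v).
Proof.
split=> [S c x y|S T h g]; apply: finite_dual_ext => r //=.
by rewrite (rho_restr coP).
Qed.

Definition beta_entry u v : Dist I -> finite_dual A := @colim_lift k D (finite_dual A) (rho_entry u v).
Lemma beta_entry_linear u v : linear (beta_entry u v).
Proof. exact: colim_lift_linear (rho_entry_cocone u v). Qed.
Lemma beta_entryE u v S (g : dcoalg D S) r :
  beta_entry u v (@colim_in k D S g) r = g (rho S r u v).
Proof. by rewrite /beta_entry [colim_lift _ _](colim_lift_in _ (rho_entry_cocone u v)). Qed.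

Local Notation MD := (tensor_coalg (comatrix k d) (Dist I)).
Definition beta2 (m : comatrix k d) (x : Dist I) : finite_dual A :=
  \sum_u \sum_v (m : 'M[k]_d) u v *: beta_entry u v x.
Lemma beta2_bilin : bilin beta2.
Proof.
split=> [x|m] c y z; rewrite /beta2 scaler_sumr -big_split; apply: eq_bigr => u _;
  rewrite scaler_sumr -big_split; apply: eq_bigr => v _.
  by rewrite /= !mxE scalerDl scalerA.
by rewrite /= beta_entry_linear scalerDr !scalerA mulrC.
Qed.
Definition beta_fun : MD -> finite_dual A := tlift beta2.
Lemma beta_linear : linear beta_fun. Proof. exact: tlift_linear beta2_bilin. Qed.

Lemma eval_sum (J : Type) (s : seq J) (F : J -> finite_dual A) (r : A) :
  (\sum_(i <- s) F i) r = \sum_(i <- s) F i r.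
Proof. by elim: s => [|i s IH]; rewrite ?big_nil ?big_cons -?IH. Qed.

Lemma beta_tens (m : 'M[k]_d) S (g : dcoalg D S) r :
  beta_fun ((m : comatrix k d) \ox (@colim_in k D S g : Dist I)) r =
  \sum_u \sum_v m u v * g (rho S r u v).
Proof.
rewrite /beta_fun (tlift_tens _ _ beta2_bilin) /beta2 eval_sum; apply: eq_bigr => u _.
by rewrite eval_sum; apply: eq_bigr => v _; rewrite -beta_entryE.
Qed.

Lemma MD_ext (U : lmodType k) (h h' : MD -> U) : linear h -> linear h' ->
  (forall (m : 'M[k]_d) S (g : dcoalg D S),
    h ((m : comatrix k d) \ox (@colim_in k D S g : Dist I)) =
    h' ((m : comatrix k d) \ox (@colim_in k D S g : Dist I))) -> h =1 h'.
Proof.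
move=> Lh Lh' e; apply: tens_ext => // m; apply: colim_ext => [| |S g]; last exact: e.
  by apply: lin_comp Lh; exact: (tens_bilin _ _).2.
by apply: lin_comp Lh'; exact: (tens_bilin _ _).2.
Qed.

Lemma beta_delta (i r : 'I_d) S (g : dcoalg D S) x :
  beta_fun ((delta_mx i r : comatrix k d) \ox (@colim_in k D S g : Dist I)) x = g (rho S x i r).
Proof.
rewrite beta_tens (bigD1 i) //= [X in _ + X]big1 => [|u /negPf ui]; last first.
  by apply: big1 => v _; rewrite mxE ui mul0r.
rewrite addr0 (bigD1 r) //= [X in _ + X]big1 => [|v /negPf vr]; last first.
  by rewrite mxE vr andbF mul0r.
by rewrite addr0 mxE !eqxx mul1r.
Qed.

(** Tested on a pair [x], [y], this is the multiplicativity of rho_S: the sum over the inner index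
    in [rho_mul] is the comultiplication of the comatrix coalgebra. *)
Lemma beta_comul t : comul (beta_fun t) = tmap beta_fun beta_fun (comul t).
Proof.
have Lb := beta_linear.
move: t; apply: MD_ext.
- by apply: lin_comp => //; exact: comul_linear.
- by apply: lin_comp; [exact: comul_linear|exact: tmap_linear].
move=> m S g; apply: pairing2_inj => x y; rewrite finite_dual_comulP beta_tens.
have P2 := pairing2_linear x y.
pose G (t t' : MD) : k^o := beta_fun t x * beta_fun t' y.
have GB : bilin G.
  split=> [t'|t] c a b; rewrite /G Lb; first by rewrite mulrDl -scalerAl.
  by rewrite mulrDr -scalerAr.
have Li := coalghom_linear (@colim_in k D S).
pose H (c1 c2 : comatrix k d) : k^o :=
  tlift (fun g1 g2 : dcoalg D S => G (c1 \ox (@colim_in k D S g1 : Dist I))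
    (c2 \ox (@colim_in k D S g2 : Dist I))) (comul g).
have HB : bilin H.
  split=> [c2|c1]; apply: tlift_lin_fun => g1 g2.
    apply: (lin_comp (h := fun c => c \ox _) (g := fun t => G t _)); last exact: GB.1.
    exact: (tens_bilin _ _).1.
  apply: (lin_comp (h := fun c => c \ox _) (g := fun t => G _ t)); last exact: GB.2.
  exact: (tens_bilin _ _).1.
have -> : pairing2 (tmap beta_fun beta_fun
    (@comul k MD ((m : comatrix k d) \ox (@colim_in k D S g : Dist I)))) x y =
    tlift H (comul (m : comatrix k d)).
  rewrite /tmap (tlift_comp _ _ P2) (eq_tlift (g := G)); last first.
    by move=> t t'; rewrite pairing2_tens.
  rewrite /= /tcomul tlift_tens; last exact: tcomul_bilin.
  rewrite tlift_comp; last exact: tlift_linear.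
  apply: eq_tlift => c1 c2; rewrite tlift_comp; last exact: tlift_linear.
  have B' : bilin (fun x0 y0 : Dist I => G (c1 \ox x0) (c2 \ox y0)).
    split=> [y0|x0].
      apply: (lin_comp (h := fun c => c1 \ox c) (g := fun t => G t _)); last exact: GB.1.
      exact: (tens_bilin _ _).2.
    apply: (lin_comp (h := fun c => c2 \ox c) (g := fun t => G _ t)); last exact: GB.2.
    exact: (tens_bilin _ _).2.
  rewrite (eq_tlift (g := fun x0 y0 => G (c1 \ox x0) (c2 \ox y0))); last first.
    by move=> x0 y0; rewrite tlift_tens.
  have -> : @comul k (Dist I) (@colim_in k D S g) =
      tmap (@colim_in k D S) (@colim_in k D S) (comul g) by exact: coalghom_comul.
  rewrite /tmap tlift_comp; last exact: tlift_linear.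
  by apply: eq_tlift => g1 g2; rewrite tlift_tens.
rewrite /= /comatrix_comul (linD_sum _ _ (tlift_linear HB)); apply: eq_bigr => i _.
rewrite (lin_sum _ _ _ (tlift_linear HB)); apply: eq_bigr => j _.
congr (_ * _); rewrite (linD_sum _ _ (tlift_linear HB)) (rho_mul coP).
rewrite (linD_sum _ _ (finite_dual_linear g)); apply: eq_bigr => r _.
rewrite (tlift_tens _ _ HB) -finite_dual_comulP /H; apply: eq_tlift => g1 g2.
by rewrite /G !beta_delta.
Qed.

Lemma beta_counit t : counit (beta_fun t) = counit t.
Proof.
have Lb := beta_linear.
move: t; apply: (MD_ext (U := k^o)).
- by apply: lin_comp => //; exact: counit_linear.
- exact: counit_linear.
move=> m S g; rewrite [RHS](tlift_tens _ _ (@tcounit_bilin _ _ _)).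
have -> : @counit k (Dist I) (@colim_in k D S g) = counit g by exact: coalghom_counit.
rewrite /= /finite_dual_counit beta_tens /comatrix_counit /mxtrace mulr_suml.
have i1 : 1 = center_incl A 1 by rewrite (alghom_monoid _).1.
have p1 : subscheme_map S 1 = 1 by exact: (alghom_monoid _).1.
apply: eq_bigr => i _; rewrite (bigD1 i) //= big1 => [|j /negPf ji].
  by rewrite addr0 i1 (rho_center coP) eqxx p1.
by rewrite i1 (rho_center coP) eq_sym ji (lin0 (finite_dual_linear g)) mulr0.
Qed.

Definition beta : coalghom MD (finite_dual A) := CoalgHom beta_linear beta_comul beta_counit.
End MatrixPart.

Section PowerImage.
Variables (k : closedFieldType) (A : algebra k) (N : ideal A).
Variable alpha : coalghom (colim (power_system N)) (finite_dual A).
Hypothesis alphaE : forall i (c : dcoalg (power_system N) i) r,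
  (alpha (@colim_in k (power_system N) i c) : finite_dual A) r = c (quot_pi (ideal_pow N i.+1) r).

Lemma power_image (f : finite_dual A) n (K : ideal A) : cofinite n K ->
  (forall M, is_maximal_ideal M -> K `<=` M -> N `<=` M) -> (forall x, K x -> f x = 0) ->
  exists u, alpha u = f.
Proof.
move=> cK hM fK; have NK := cofinite_radical_pow cK hM.
(* Stage [n] of the power system is the quotient by the power [n + 1]. *)
have NK' : ideal_pow N n.+1 `<=` K by move=> x /(@ideal_powS k A N n n.+1 (leqnSn n)) /NK.
have fL := finite_dual_linear f.
pose f' (q : quot (ideal_pow N n.+1)) : k^o := f (repr (q : quot_sort _)).
have f'E x : f' (quot_pi _ x) = f x.
  apply/eqP; rewrite -subr_eq0; apply/eqP; rewrite /f' -[RHS](fK _ (NK' _ (quot_repr _ x))).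
  by rewrite -scaleN1r addrC -fL scaleN1r addrC.
have f'P : f' \in finite_dual_pred (quot (ideal_pow N n.+1)).
  apply/asboolP; split.
    move=> c; elim/quot_ind=> x; elim/quot_ind=> y.
    by rewrite -(quot_pi_linear (ideal_pow N n.+1)) !f'E fL.
  have [K' K'P] : exists K' : ideal (quot (ideal_pow N n.+1)), forall x, K' (quot_pi _ x) <-> K x.
    have kK x y : quot_pi (ideal_pow N n.+1) x = quot_pi _ y -> K x -> K y.
      move=> /esym /quot_piP /NK' Kyx Kx; rewrite -[y](subrK x); exact: idealD.
    unshelve eexists (@Ideal k (quot (ideal_pow N n.+1))
      (fun q => exists2 x, K x & q = quot_pi _ x) _ _ _ _).
    - by exists 0; [exact: ideal0|rewrite (lin0 (quot_pi_linear _))].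
    - move=> _ _ [x Kx ->] [y Ky ->]; exists (x + y); first exact: idealD.
      by rewrite (linD _ _ (quot_pi_linear _)).
    - elim/quot_ind=> a _ [x Kx ->]; exists (a * x); first exact: idealMl.
      by rewrite (quot_pi_monoid _).2.
    - elim/quot_ind=> a _ [x Kx ->]; exists (x * a); first exact: idealMr.
      by rewrite (quot_pi_monoid _).2.
    by move=> x; split=> [[y Ky /esym e]|Kx]; [exact: kK e Ky|exists x].
  exists K'; split; last by elim/quot_ind=> x /K'P /fK; rewrite f'E.
  apply/findim_cofinite; have [h [hL hK]] := cK; exists n, (fun q => h (repr (q : quot_sort _))).
  have hE x : h (repr (quot_pi (ideal_pow N n.+1) x)) = h x.
    apply/eqP; rewrite -subr_eq0 -scaleN1r addrC -hL scaleN1r addrC; apply/eqP/hK/NK'.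
    exact: quot_repr.
  split; last by elim/quot_ind=> x; rewrite hE K'P.
  move=> c; elim/quot_ind=> x; elim/quot_ind=> y.
  by rewrite -(quot_pi_linear (ideal_pow N n.+1)) !hE hL.
exists (@colim_in k (power_system N) n (FiniteDual f'P)).
by apply: finite_dual_ext => x; rewrite alphaE.
Qed.
End PowerImage.

Lemma sum_delta2 (V : nmodType) d (F : 'I_d -> 'I_d -> V) a b :
  \sum_a' \sum_b' (if (a == a') && (b == b') then F a' b' else 0) = F a b.
Proof.
rewrite (bigD1 a) //= [X in _ + X]big1 => [|a' /negPf ne]; last first.
  by rewrite big1 // => b' _; rewrite eq_sym ne.
rewrite addr0 (bigD1 b) //= [X in _ + X]big1 => [|b' /negPf ne]; last first.
  by rewrite [b == b']eq_sym ne andbF.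
by rewrite addr0 !eqxx.
Qed.

(** * Image and injectivity of the matrix part *)

Section MatrixImage.
Variables (k : closedFieldType) (A : algebra k) (d : nat).
Local Notation Z := (center A).
Variables (I : ideal Z) (co : ideal Z -> nat -> A -> ('I_d -> 'I_d -> Z) -> Prop).
Hypothesis coP : forall m : ideal Z, is_maximal_ideal m -> ~ I `<=` m ->
  @coordinates k A m d (co m).
Local Notation D := (dist_diagram I).
Local Notation MD := (tensor_coalg (comatrix k d) (Dist I)).
Let iota (z : Z) : A := center_incl A z.

Definition matrix_element S (g : 'I_d -> 'I_d -> dcoalg D S) : MD :=
  \sum_a \sum_b (delta_mx a b : comatrix k d) \ox (@colim_in k D S (g a b) : Dist I).

Lemma beta_matrix_element S (g : 'I_d -> 'I_d -> dcoalg D S) r :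
  (beta coP (matrix_element g) : finite_dual A) r = \sum_a \sum_b g a b (rho co S r a b).
Proof.
rewrite /= /matrix_element (linD_sum _ _ (beta_linear coP)) eval_sum; apply: eq_bigr => a _.
by rewrite (linD_sum _ _ (beta_linear coP)) eval_sum; apply: eq_bigr => b _; exact: beta_delta.
Qed.

(** The matrix units expand a tensor into [d ^ 2] elements of [Dist], which come from one common
    S. *)
Lemma matrix_elementP (t : MD) : exists S g, t = @matrix_element S g.
Proof.
have [x tE] : exists x : 'I_d -> 'I_d -> Dist I,
    t = \sum_a \sum_b (delta_mx a b : comatrix k d) \ox x a b.
  rewrite -[t]tlift_id /tlift /pres_lift /formal_eval.
  elim: (repr t : seq _) => [|[c [m y]] s [x IH]].
    exists (fun _ _ => 0); rewrite big_nil big1 // => a _; rewrite big1 // => b _.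
    exact: lin0 ((tens_bilin _ _).2 _).
  exists (fun a b => (c * (m : 'M_d) a b) *: y + x a b); rewrite big_cons IH /=.
  rewrite {1}[m : 'M_d]matrix_sum_delta.
  rewrite (linD_sum _ _ ((tens_bilin _ _).1 y)) scaler_sumr -big_split; apply: eq_bigr => a _.
  rewrite /= (linD_sum _ _ ((tens_bilin _ _).1 y)) scaler_sumr -big_split; apply: eq_bigr => b _.
  rewrite (linD _ _ ((tens_bilin _ _).2 _)) (linZ _ _ ((tens_bilin _ _).2 _)).
  by rewrite /= (linZ _ _ ((tens_bilin _ _).1 y)) scalerA.
have [|S [g gE]] := @colim_directed_family k D (@subscheme_nonempty _ _ I) _ _ (fun p : 'I_d * 'I_d => x p.1 p.2).
  exact: subscheme_join.
exists S, (fun a b => g (a, b)); rewrite tE /matrix_element.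
by apply: eq_bigr => a _; apply: eq_bigr => b _; rewrite (gE (a, b)).
Qed.

Lemma matrix_image (f : finite_dual A) n (K : ideal A) : cofinite n K ->
  (forall x, K x -> f x = 0) -> (exists2 x, I x & K (iota (1 - x))) ->
  exists t, beta coP t = f.
Proof.
move=> cK fK [x Ix Kx]; have fL := finite_dual_linear f.
have cj : exists n, cofinite n (ideal_preim (center_incl A) K).
  apply/findim_cofinite/findim_preim/findim_cofinite; by exists n.
have {cj}[n' cj] := cj.
have [S SP] := @subscheme_exists k Z I _ n' cj (ex_intro2 _ _ x Ix Kx).
have /choice[sec secP] := @subscheme_surj k Z I S.
have /choice[r rP] (p : 'I_d * 'I_d) := rho_onto coP S p.1 p.2.
(* The restriction of [f] to central multiples of a lifted matrix unit; it does not depend on the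
   section, as [f] kills [K] and the kernel of S is the trace of [K] on the center. *)
pose g p (b : coordinate_algebra S) : k^o := f (iota (sec b) * r p).
have gE p z : g p (subscheme_map S z) = f (iota z * r p).
  apply/eqP; rewrite -subr_eq0; apply/eqP; rewrite /g -scaleN1r addrC -fL scaleN1r.
  apply: fK; rewrite addrC -mulNr -mulrDl; apply: idealMr.
  have /SP : subker S (sec (subscheme_map S z) - z).
    rewrite /subker /= -scaleN1r addrC (alghom_linear (subscheme_map S)) secP.
    by rewrite scaleN1r addNr.
  by rewrite /iota /=.
have gL p : linear (g p).
  move=> c b b'; rewrite -[b]secP -[b']secP -(alghom_linear (subscheme_map S)) !gE.
  by rewrite /iota (alghom_linear (center_incl A)) mulrDl -ascalerAl fL.
have gP p : g p \in finite_dual_pred (coordinate_algebra S).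
  apply: finite_dual_findim (gL p); exists (subscheme_dim S); constructor.
  by exists id => //; exists id.
pose g' a b : dcoalg D S := FiniteDual (gP (a, b)).
exists (matrix_element g'); apply: finite_dual_ext => y; rewrite beta_matrix_element.
have /choice[w wP] (p : 'I_d * 'I_d) : exists z, subscheme_map S z = rho co S y p.1 p.2.
  exact: subscheme_surj.
transitivity (f (\sum_a \sum_b iota (w (a, b)) * r (a, b))).
  rewrite (linD_sum _ _ fL); apply: eq_bigr => a _.
  rewrite (linD_sum _ _ fL); apply: eq_bigr => b _.
  by rewrite -gE wP.
apply/eqP; rewrite -subr_eq0; apply/eqP; rewrite -scaleN1r addrC -fL scaleN1r; apply: fK.
have rL a b : linear (fun r => rho co S r a b).
  by move=> c u v; rewrite (rho_linear coP).
(* [y] and its expansion in the lifted matrix units have the same image under rho_S, so [rho_ker]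
   places their difference in the ideal generated by the kernel of S. *)
suff h : ideal_ext (subker S) (- y + \sum_a \sum_b iota (w (a, b)) * r (a, b)).
  by move: h; apply: ideal_ext_min => z /SP.
apply: (rho_ker coP) => a b; rewrite -scaleN1r (rL a b) scaleN1r; apply/eqP; rewrite addrC subr_eq0.
have rS (F : 'I_d -> A) : rho co S (\sum_i F i) a b = \sum_i rho co S (F i) a b.
  exact: (linD_sum _ _ (rL a b)).
apply/eqP; rewrite rS.
transitivity (\sum_a' \sum_b' if (a == a') && (b == b') then rho co S y a' b' else 0).
  apply: eq_bigr => a' _; rewrite rS; apply: eq_bigr => b' _.
  rewrite (rho_centerM coP) rP wP /=; case: ifP => _; first by rewrite mulr1.
  exact: mulr0.
exact: sum_delta2.
Qed.

(** Evaluation at [z] times a lift of the matrix unit at [(a, b)] isolates [g a b], and such [z]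
    reach every function on S. *)
Lemma matrix_element_eq0 S (g : 'I_d -> 'I_d -> dcoalg D S) :
  (forall r, (beta coP (matrix_element g) : finite_dual A) r = 0) -> matrix_element g = 0.
Proof.
move=> h; rewrite /matrix_element big1 // => a _; rewrite big1 // => b _.
have -> : g a b = 0.
  apply: finite_dual_ext => x; have [z <-] := subscheme_surj x.
  have [r rP] := rho_onto coP S a b.
  have := h (iota z * r); rewrite beta_matrix_element.
  have g0 u v : (g u v : finite_dual _) 0 = 0 by apply: lin0; exact: finite_dual_linear.
  move=> e; apply: etrans _ e; rewrite -[LHS](@sum_delta2 _ d (fun u v => g u v (subscheme_map S z))).
  apply: eq_bigr => u _; apply: eq_bigr => v _.
  rewrite (rho_centerM coP) rP [u == a]eq_sym [v == b]eq_sym.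
  by case: ifP => _; rewrite ?mulr1 ?mulr0 ?g0.
rewrite (lin0 (coalghom_linear _)); exact: lin0 ((tens_bilin _ _).2 _).
Qed.
End MatrixImage.

(** * Bijectivity *)

Section Final.
Variables (k : closedFieldType) (A : algebra k) (d : nat).
Hypotheses (A_prime : prime_algebra A) (A_affine : affine A).
Hypotheses (A_finite : module_finite_over_center A) (A_degree : PI_degree A d).
Local Notation Z := (center A).
Local Notation N := (nonregular_ideal A).
Local Notation I := (ideal_preim (center_incl A) (nonregular_ideal A)).
Local Notation MD := (tensor_coalg (comatrix k d) (Dist I)).
Let iota (z : Z) : A := center_incl A z.
Let iL : linear iota. Proof. exact: alghom_linear. Qed.
Let iM (x y : Z) : iota (x * y) = iota x * iota y. Proof. exact: (alghom_monoid _).2. Qed.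
Let i1 : iota 1 = 1. Proof. exact: (alghom_monoid _).1. Qed.
Let iB (x y : Z) : iota (x - y) = iota x - iota y.
Proof. by rewrite -scaleN1r addrC iL scaleN1r addrC. Qed.

Section Gamma.
Variables (alpha : coalghom (colim (power_system N)) (finite_dual A)).
Hypothesis alphaE : forall i (c : dcoalg (power_system N) i) r,
  (alpha (@colim_in k (power_system N) i c) : finite_dual A) r = c (quot_pi (ideal_pow N i.+1) r).
Variable co : ideal Z -> nat -> A -> ('I_d -> 'I_d -> Z) -> Prop.
Hypothesis coP : forall m : ideal Z, is_maximal_ideal m -> ~ I `<=` m ->
  @coordinates k A m d (co m).
Let gamma := sum_hom alpha (beta coP).

Lemma gamma_inj : injective gamma.
Proof.
have gL := coalghom_linear gamma.
suff H s : gamma s = 0 -> s = 0.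
  move=> s s' e; apply/eqP; rewrite -subr_eq0; apply/eqP/H.
  by rewrite -scaleN1r addrC gL e scaleN1r addNr.
case: s => u t e.
have [||i [c uE]] := @colim_directed_family k (power_system N) _ _ unit (fun=> u).
- by constructor; exact: 0%N.
- by move=> i j; exists (maxn i j); split; constructor; [exact: leq_maxl|exact: leq_maxr].
have {uE} uE := uE tt; move: (c tt) uE => {}c uE.
have [S [g tE]] := matrix_elementP t.
have [x Ix jx] := subscheme_coprime S.
have e' r : c (quot_pi (ideal_pow N i.+1) r) + (beta coP t : finite_dual A) r = 0.
  have := congr1 (fun f : finite_dual A => f r) e.
  by rewrite /= /sum_hom_fun /= -alphaE -uE.
have cL := finite_dual_linear c.
have aux r : quot_pi (ideal_pow N i.+1) (iota (x ^+ i.+1) * r) = 0 :> quot _.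
  apply/quot_eq0; apply: idealMr.
  have -> : iota (x ^+ i.+1) = iota x ^+ i.+1.
    by elim: (i.+1) => [|l IH]; rewrite ?expr0 ?i1 // !exprS iM IH.
  by apply: ideal_powX; exact: Ix.
have b0 r : (beta coP t : finite_dual A) r = 0.
  have -> : (beta coP t : finite_dual A) r = (beta coP t : finite_dual A) (iota (x ^+ i.+1) * r).
    rewrite tE !beta_matrix_element; apply: eq_bigr => a _; apply: eq_bigr => b _.
    rewrite (rho_centerM coP).
    have -> : subscheme_map S (x ^+ i.+1) = 1.
      have [v vE] := geometric_factor x i.+1.
      have : subscheme_map S (1 - x ^+ i.+1) = 0.
        by rewrite vE (alghom_monoid _).2 (jx : subscheme_map S _ = 0) mul0r.
      rewrite -scaleN1r addrC (alghom_linear (subscheme_map S)) scaleN1r (alghom_monoid _).1.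
      by move/eqP; rewrite addrC subr_eq0 => /eqP.
    by rewrite mul1r.
  by have := e' (iota (x ^+ i.+1) * r); rewrite aux (lin0 cL) add0r.
have t0 : t = 0 by rewrite tE; apply: (matrix_element_eq0 (coP := coP)) => r; rewrite -tE.
have u0 : u = 0.
  rewrite uE; have -> : c = 0.
    by apply: finite_dual_ext; elim/quot_ind=> r; have := e' r; rewrite b0 addr0.
  exact: lin0 (coalghom_linear _).
by rewrite t0 u0.
Qed.

Lemma gamma_surj f : exists s, gamma s = f.
Proof.
have gL := coalghom_linear gamma.
have [J [/findim_cofinite[n cJ] fJ]] := finite_dual_ker f.
have fL := finite_dual_linear f.
have [n' cj] : exists n, cofinite n (ideal_preim (center_incl A) J).
  apply/findim_cofinite/findim_preim/findim_cofinite; by exists n.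
have [l [m [eps [L [P1 P2 P3 P4]]]]] := cofinite_primary cj.
have fP i : (fun x => f (iota (eps i) * x) : k^o) \in finite_dual_pred A.
  apply/asboolP; split; first by move=> c x y; rewrite mulrDr -ascalerAr fL.
  exists J; split; first by apply/findim_cofinite; exists n.
  by move=> x Jx; apply: fJ; exact: idealMl.
suff /choice[s sP] i : exists s, gamma s = FiniteDual (fP i).
  exists (\sum_i s i); rewrite (linD_sum _ _ gL); apply: finite_dual_ext => x.
  rewrite eval_sum; under eq_bigr do rewrite sP /=.
  rewrite -(linD_sum _ _ fL) -mulr_suml -(linD_sum _ _ iL); apply/eqP; rewrite eq_sym -subr_eq0.
  apply/eqP; rewrite -scaleN1r addrC -fL; apply: fJ.
  rewrite scaleN1r -[X in _ + X]mul1r -mulNr -mulrDl addrC -i1 -iB.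
  by apply: idealMr; exact: P3.
(* The [i]-th piece of [f] vanishes on [K], which contains the power [L] of [m i]; so the maximal
   ideals above [K] lie over [m i]. *)
have [K KP] : exists K : ideal A, forall x, K x <-> J (iota (eps i) * x).
  unshelve eexists (@Ideal k A (fun x => J (iota (eps i) * x)) _ _ _ _) => //.
  all: cbv beta.
  - by rewrite mulr0; exact: ideal0.
  - by move=> y y' Hy Hy'; rewrite mulrDr; exact: idealD.
  - by move=> a y Hy; rewrite mulrA /iota incl_central -mulrA; exact: idealMl.
  - by move=> a y Hy; rewrite mulrA; exact: idealMr.
have cK : cofinite n K by apply: cofinite_sup cJ => x Jx; apply/KP; exact: idealMl.
have fK x : K x -> (FiniteDual (fP i) : finite_dual A) x = 0 by move/KP/fJ.
have mK z : ideal_pow (m i) L z -> K (iota z) by move=> pz; apply/KP; rewrite -iM; exact: P4.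
have [Im|Im] := pselect (I `<=` m i); last first.
  have [|t tE] := @matrix_image _ _ _ _ _ coP _ _ _ cK fK.
    have [x [y [Ix my e]]] : exists x y, [/\ I x, m i y & 1 = x + y].
      apply: contrapT => H; apply: Im => z Iz.
      apply: ((P1 i).2 (ideal_add I (m i))); last exact: ideal_addl.
        by move=> w; exact: ideal_addr.
      by move=> [x [y [? ? ?]]]; apply: H; exists x, y.
    have [v vE] := geometric_factor y L.
    exists (1 - y ^+ L); first by rewrite vE e addrK; exact: idealMr.
    by apply: (mK (1 - (1 - y ^+ L))); rewrite subKr; exact: ideal_powX.
  by exists (0, t); rewrite -tE /= /sum_hom_fun /= (lin0 (coalghom_linear alpha)) add0r.
have [|u uE] := @power_image _ _ _ _ alphaE _ _ _ cK _ fK; last first.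
  by exists (u, 0); rewrite -uE /= /sum_hom_fun /= (lin0 (beta_linear coP)) addr0.
move=> M mM KM.
(* Primeness of the trace of [M] on the center removes the exponent: the power [L] of [m i] lies in
   [M], hence so does [m i]. *)
have MP : is_prime_ideal (ideal_preim (center_incl A) M).
  apply/prime_idealP; split; first by change (~ M (iota 1)); rewrite i1; exact: mM.1.
  move=> a b h; apply: ((prime_idealP M).1 (maximal_prime mM)).2 => x.
  have H : M (x * iota (a * 1 * b)) by apply: idealMl; exact: h.
  rewrite mulr1 iM in H.
  have -> : iota a * x * iota b = x * (iota a * iota b) by rewrite /iota incl_central mulrA.
  exact: H.
have mMi z : m i z -> M (iota z).
  move=> mz; have /mK /KM := ideal_powX L mz.
  elim: (L) => [|l' IH]; first by rewrite expr0 i1 => /mM.1.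
  have := ((prime_idealP _).1 MP).2 z (z ^+ l') => h H.
  have [|//|] := h _; last by move=> /IH.
  move=> w; change (M (iota (z * w * z ^+ l'))); have := idealMl (iota w) H.
  by rewrite -iM exprS mulrA [w * z](@comalg_mulC _ Z).
(* A regular [M] would miss some element of [I], whereas [I] is contained in [m i] and thus in
   [M]. *)
have nr : ~ regular_ideal M.
  move=> rM; have [z Iz Mz] := regular_open A_prime A_affine A_finite A_degree mM rM.
  by apply/Mz/mMi/Im.
by move=> x Nx; apply: Nx.
Qed.
End Gamma.

Lemma finite_dual_decomposition : coalg_iso (finite_dual A) (sum_coalg (colim (power_system N)) MD).
Proof.
have [alpha alphaE] := power_hom N.
have [co coP] := coordinates_open A_prime A_affine A_finite A_degree.
apply: (@coalghom_inverse _ _ _ (sum_hom alpha (beta coP))).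
have /choice[g gK] := gamma_surj alphaE coP.
exists g => // s; apply: (gamma_inj alphaE (coP := coP)); exact: gK.
Qed.
End Final.

Theorem theorem4p3 (k : closedFieldType) (R : algType k) (d : nat)
    (R_prime : prime_algebra R) (R_affine : affine R)
    (R_finite : module_finite_over_center R) (R_degree : PI_degree (algebra_of R) d) :
  let N := nonregular_ideal R in
  coalg_iso (finite_dual R)
    (sum_coalg (colim (power_system N))
               (tensor_coalg (comatrix k d) (Dist (ideal_preim (center_incl R) N)))).
Proof. exact: finite_dual_decomposition. Qed.
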